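(* Let $G$ be an $n$-dimensional Lie group with unit element $e$ and Lie algebra $\mathfrak g$ of left-invariant vector fields. Let $\tilde g=fg$ be an $f$-left-invariant Riemannian metric on $G$, where $g$ is a left-invariant Riemannian metric, $f=e^{-2\phi}$ for a smooth function $\phi:G\to\mathbb{R}$ with $\phi(e)=0$, and put $\psi=e^{\phi}$. Then the Riemannian manifold $(G,\tilde g)$ is a Ricci soliton if and only if there exist a smooth vector field $X$ on $G$ and a constant $\lambda\in\mathbb{R}$ such that for all $Y,Z\in\mathfrak g$, $$-\frac12\Big(\mathrm{tr}(\mathrm{ad}_Y\circ \mathrm{ad}_Z)+\mathrm{tr}(\mathrm{ad}_Y\circ \mathrm{ad}^\ast_Z)+g(\mathrm{ad}_HY,Z)+g(\mathrm{ad}_HZ,Y)\Big)-\frac14\mathrm{tr}(J_Y\circ J_Z)$$ $$+\Big(\Delta\phi-(n-2)\|\nabla\phi\|^2\Big)g(Y,Z)+\frac{n-2}{\psi}\nabla^2\psi(Y,Z)-\lambda f g(Y,Z)+\frac12(Xf)g(Y,Z)+\frac12 f(\mathcal{L}_Xg)(Y,Z)=0.$$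
   Context: A Riemannian metric $\tilde g$ on $G$ is $f$-left-invariant (with $f$ smooth, positive, $f(e)=1$) if $\tilde g=fg$ for a left-invariant Riemannian metric $g$. A Riemannian manifold $(M,g)$ is a Ricci soliton if there are a smooth vector field $X$ and a constant $\lambda\in\mathbb{R}$ with $\mathcal{L}_Xg=2(\lambda g-\mathrm{Ric}_g)$. Conventions: $R(X,Y)Z=\nabla_X\nabla_YZ-\nabla_Y\nabla_XZ-\nabla_{[X,Y]}Z$ and $\mathrm{Ric}(Y,Z)=\mathrm{tr}(X\mapsto R(X,Y)Z)$. All quantities in the displayed equation are computed with respect to the left-invariant metric $g$: $\mathrm{ad}_X^\ast$ is the adjoint of $\mathrm{ad}_X:\mathfrak g\to\mathfrak g$ with respect to $g$; $H\in\mathfrak g$ is the mean curvature vector defined by $g(H,X)=\mathrm{tr}(\mathrm{ad}_X)$ for $X\in\mathfrak g$; for $X\in\mathfrak g$, $J_X:\mathfrak g\to\mathfrak g$ is the endomorphism $J_X(Y)=\mathrm{ad}_Y^\ast X$; $\nabla\phi$ is the gradient of $\phi$ and $\|\cdot\|$ the $g$-norm; for a smooth function $u$, $\nabla^2u(Y,Z)=g(\nabla_Y(\nabla u),Z)$ is the Hessian form and $\Delta u=\mathrm{tr}(Y\mapsto\nabla_Y(\nabla u))$ is the Laplacian. *)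

(* Defs.v *)
From HB Require Import structures.
From mathcomp Require Import all_boot all_order all_algebra.
From mathcomp Require Import all_classical all_reals all_analysis.

Set Implicit Arguments.
Unset Strict Implicit.
Unset Printing Implicit Defensive.

Import Order.TTheory GRing.Theory Num.Theory.
Import numFieldNormedType.Exports.

Local Open Scope classical_set_scope.
Local Open Scope ring_scope.

(** * Smooth maps between (finite-dimensional) normed spaces *)

(* The derivative of [f] is C^k iff all [x |-> 'd f x v] are, because the
   spaces it is used for ([V = 'rV_n]) are finite-dimensional. *)
Fixpoint Ck_on (R : realType) (V W : normedModType R) (k : nat) (U : set V)
    (f : V -> W) : Prop :=
  if k is k'.+1 then
    (forall x, U x -> differentiable f x) /\
    (forall v, Ck_on k' U (fun x => 'd f x v))
  else forall x, U x -> {for x, continuous f}.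

Definition smooth_on (R : realType) (V W : normedModType R) (U : set V)
    (f : V -> W) : Prop :=
  forall k, Ck_on k U f.

(** * Smooth manifolds and Lie groups *)

(* A homeomorphism between an open subset of [M] and an open subset of R^n; both
   maps are total functions with junk values outside these open sets. *)
Record chart (R : realType) (n : nat) (M : topologicalType) := Chart {
  chart_fun :> M -> 'rV[R]_n;
  chart_inv : 'rV[R]_n -> M;
  chart_dom : set M;
  chart_cod : set 'rV[R]_n;
  chart_open_dom : open chart_dom;
  chart_open_cod : open chart_cod;
  chart_funS : forall p, chart_dom p -> chart_cod (chart_fun p);
  chart_invS : forall x, chart_cod x -> chart_dom (chart_inv x);
  chart_funK : forall p, chart_dom p -> chart_inv (chart_fun p) = p;
  chart_invK : forall x, chart_cod x -> chart_fun (chart_inv x) = x;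
  chart_fun_continuous :
    forall p, chart_dom p -> {for p, continuous chart_fun};
  chart_inv_continuous :
    forall x, chart_cod x -> {for x, continuous chart_inv}
}.

(* An atlas determines the smooth structure; [chart_at p] is a preferred chart
   around [p], used below to identify the tangent space at [p] with R^n. *)
HB.mixin Record isManifold (R : realType) (n : nat) M of Topological M := {
  manifold_hausdorff : hausdorff_space M;
  manifold_second_countable : @second_countable M;
  atlas : set (chart R n M);
  chart_at : M -> chart R n M;
  chart_at_atlas : forall p, atlas (chart_at p);
  chart_at_dom : forall p, chart_dom (chart_at p) p;
  atlas_compatible : forall c d : chart R n M, atlas c -> atlas d ->
    smooth_on (chart_cod c `&` chart_inv c @^-1` chart_dom d) (d \o chart_inv c)
}.

#[short(type="manifoldType")]
HB.structure Definition Manifold (R : realType) (n : nat) :=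
  { M of Topological M & isManifold R n M }.

Arguments atlas {R n s}.
Arguments chart_at {R n s}.

Section SmoothMaps.
Context {R : realType}.

Definition smooth_fun {n} {M : manifoldType R n} (u : M -> R) : Prop :=
  forall c : chart R n M, atlas c -> smooth_on (chart_cod c) (u \o chart_inv c).

Definition smooth_map {m n} {M : manifoldType R m} {N : manifoldType R n}
    (F : M -> N) : Prop :=
  continuous F /\
  forall (c : chart R m M) (d : chart R n N), atlas c -> atlas d ->
    smooth_on (chart_cod c `&` (F \o chart_inv c) @^-1` chart_dom d)
              (d \o F \o chart_inv c).

(* Smoothness of a map [M1 * M2 -> N], in the product charts of [M1 * M2]. *)
Definition smooth_map2 {m1 m2 n} {M1 : manifoldType R m1}
    {M2 : manifoldType R m2} {N : manifoldType R n} (F : M1 * M2 -> N) : Prop :=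
  continuous F /\
  forall (c1 : chart R m1 M1) (c2 : chart R m2 M2) (d : chart R n N),
    atlas c1 -> atlas c2 -> atlas d ->
    let inv12 (z : 'rV[R]_(m1 + m2)) :=
      (chart_inv c1 (lsubmx z), chart_inv c2 (rsubmx z)) in
    smooth_on
      ([set z | chart_cod c1 (lsubmx z) /\ chart_cod c2 (rsubmx z)]
         `&` (F \o inv12) @^-1` chart_dom d)
      (d \o F \o inv12).

End SmoothMaps.

HB.mixin Record Manifold_Group_isLieGroup (R : realType) (n : nat) G
    of Manifold R n G & Group G := {
  mulg_smooth : smooth_map2 (fun x : G * G => (x.1 * x.2)%g);
  invg_smooth : smooth_map (fun x : G => (x^-1)%g)
}.

#[short(type="lieGroupType")]
HB.structure Definition LieGroup (R : realType) (n : nat) :=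
  { G of Manifold R n G & Group G & Manifold_Group_isLieGroup R n G }.

(** * Tangent vectors and vector fields *)

(* The tangent space at [p] is ['rV[R]_n]: a tangent vector is given by its
   coordinates in the chart [chart_at p].  A vector field is thus a map
   [M -> 'rV[R]_n], the value at [p] being read in [chart_at p]. *)
Section VectorFields.
Context {R : realType} {n : nat} {M : manifoldType R n}.

Definition vfield := M -> 'rV[R]_n.

Definition dfun (u : M -> R) (p : M) : 'rV[R]_n -> R :=
  'd (u \o chart_inv (chart_at p)) (chart_at p p).

(* [vcoord c p] maps a tangent vector at [p] to its coordinates in the chart
   [c], and [tvec c p] is the inverse map. *)
Definition vcoord (c : chart R n M) (p : M) : 'rV[R]_n -> 'rV[R]_n :=
  'd (c \o chart_inv (chart_at p)) (chart_at p p).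

Definition tvec (c : chart R n M) (p : M) : 'rV[R]_n -> 'rV[R]_n :=
  'd (chart_at p \o chart_inv c) (c p).

Definition vf_local (c : chart R n M) (X : vfield) (x : 'rV[R]_n) : 'rV[R]_n :=
  vcoord c (chart_inv c x) (X (chart_inv c x)).

Definition smooth_vf (X : vfield) : Prop :=
  forall c : chart R n M, atlas c -> smooth_on (chart_cod c) (vf_local c X).

Definition vf_app (X : vfield) (u : M -> R) : M -> R := fun p => dfun u p (X p).

(* [X, Y]^j = X^i d_i Y^j - Y^i d_i X^j in the chart [chart_at p] *)
Definition lie_bracket (X Y : vfield) : vfield := fun p =>
  'd (vf_local (chart_at p) Y) (chart_at p p) (X p)
  - 'd (vf_local (chart_at p) X) (chart_at p p) (Y p).

(* A smooth vector field with value [v] at [p]; all the uses below are tensorial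
   in it, hence do not depend on the choice. *)
Definition vf_extend (p : M) (v : 'rV[R]_n) : vfield :=
  xget (fun=> 0) [set V : vfield | smooth_vf V /\ V p = v].

End VectorFields.
Arguments vfield {R n} M.

Definition tangent_map {R : realType} {m n : nat} {M : manifoldType R m}
    {N : manifoldType R n} (F : M -> N) (p : M) : 'rV[R]_m -> 'rV[R]_n :=
  'd (chart_at (F p) \o F \o chart_inv (chart_at p)) (chart_at p p).

(** * Euclidean linear algebra on R^n *)

Section LinearAlgebra.
Context {R : realType} {n : nat}.

(* Trace of an endomorphism of R^n ([lin1_mx A] is its matrix). *)
Definition trend (A : 'rV[R]_n -> 'rV[R]_n) : R := \tr (lin1_mx A).

(* The bilinear form with Gram matrix [B]. *)
Definition mxform (B : 'M[R]_n) (u v : 'rV[R]_n) : R := (u *m B *m v^T) 0 0.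

(* The vector representing the linear form [l] with respect to [mxform B]. *)
Definition riesz (B : 'M[R]_n) (l : 'rV[R]_n -> R) : 'rV[R]_n :=
  (\row_i l (delta_mx 0 i)) *m invmx B.

Lemma rieszP (B : 'M[R]_n) (l : {linear 'rV[R]_n -> R^o}) (v : 'rV[R]_n) :
  B \in unitmx -> mxform B (riesz B l) v = l v.
Proof.
move=> Bu; rewrite /mxform /riesz mulmxKV // mxE.
rewrite [v in RHS]row_sum_delta linear_sum /=.
by apply: eq_bigr => i _; rewrite linearZ /= !mxE mulrC.
Qed.

End LinearAlgebra.

(** * Riemannian geometry *)

Section Riemannian.
Context {R : realType} {n : nat} {M : manifoldType R n}.
Implicit Types (g : M -> 'M[R]_n) (X Y Z : vfield M) (u : M -> R).

(* A metric is given by its Gram matrices on the tangent spaces ['rV[R]_n]. *)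
Definition riemannian_metric g : Prop :=
  [/\ forall p, (g p)^T = g p,
      forall p v, v != 0 -> 0 < mxform (g p) v v
    & forall c : chart R n M, atlas c -> forall v w,
        smooth_on (chart_cod c) (fun x => let p := chart_inv c x in
          mxform (g p) (tvec c p v) (tvec c p w))].

Definition inner g X Y : M -> R := fun p => mxform (g p) (X p) (Y p).

Definition vnorm g X : M -> R := fun p => Num.sqrt (inner g X X p).

Definition affine_connection (nabla : vfield M -> vfield M -> vfield M) : Prop :=
  [/\ forall X Y, smooth_vf X -> smooth_vf Y -> smooth_vf (nabla X Y),
      forall u X X' Y, smooth_fun u -> smooth_vf X -> smooth_vf X' ->
        smooth_vf Y ->
        nabla (fun p => u p *: X p + X' p) Y =
          (fun p => u p *: nabla X Y p + nabla X' Y p),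
      forall X Y Y', smooth_vf X -> smooth_vf Y -> smooth_vf Y' ->
        nabla X (fun p => Y p + Y' p) = (fun p => nabla X Y p + nabla X Y' p)
    & forall u X Y, smooth_fun u -> smooth_vf X -> smooth_vf Y ->
        nabla X (fun p => u p *: Y p) =
          (fun p => vf_app X u p *: Y p + u p *: nabla X Y p)].

Definition is_levi_civita g (nabla : vfield M -> vfield M -> vfield M) : Prop :=
  [/\ affine_connection nabla,
      forall X Y Z, smooth_vf X -> smooth_vf Y -> smooth_vf Z ->
        forall p, vf_app X (inner g Y Z) p =
          inner g (nabla X Y) Z p + inner g Y (nabla X Z) p
    & forall X Y, smooth_vf X -> smooth_vf Y ->
        forall p, nabla X Y p - nabla Y X p = lie_bracket X Y p].

(* Two solutions of [is_levi_civita g] agree on smooth vector fields. *)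
Definition levi_civita g : vfield M -> vfield M -> vfield M :=
  xget (fun _ _ _ => 0) [set nabla | is_levi_civita g nabla].

Definition riemann g X Y Z : vfield M := fun p =>
  levi_civita g X (levi_civita g Y Z) p
  - levi_civita g Y (levi_civita g X Z) p
  - levi_civita g (lie_bracket X Y) Z p.

Definition ricci g Y Z : M -> R := fun p =>
  trend (fun v => riemann g (vf_extend p v) Y Z p).

Definition gradient g u : vfield M := fun p => riesz (g p) (dfun u p).

Definition hessian g u Y Z : M -> R :=
  inner g (levi_civita g Y (gradient g u)) Z.

Definition laplacian g u : M -> R := fun p =>
  trend (fun v => levi_civita g (vf_extend p v) (gradient g u) p).

Definition lie_derivative X g Y Z : M -> R := fun p =>
  vf_app X (inner g Y Z) p
  - inner g (lie_bracket X Y) Z p - inner g Y (lie_bracket X Z) p.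

Definition ricci_soliton g : Prop :=
  exists (X : vfield M) (lambda : R), smooth_vf X /\
    forall Y Z, smooth_vf Y -> smooth_vf Z -> forall p,
      lie_derivative X g Y Z p = 2 * (lambda * inner g Y Z p - ricci g Y Z p).

End Riemannian.

(** * Left-invariant objects on a Lie group *)

Section LeftInvariant.
Context {R : realType} {n : nat} {G : lieGroupType R n}.
Implicit Types (g : G -> 'M[R]_n) (X Y : vfield G).

Definition left_translation (a : G) : G -> G := fun p => (a * p)%g.

Definition left_invariant_vf X : Prop := smooth_vf X /\
  forall a p, tangent_map (left_translation a) p (X p) =
    X (left_translation a p).

(* The left-invariant vector field with value [v] at the unit element. *)
Definition left_vf (v : 'rV[R]_n) : vfield G := fun p =>
  tangent_map (left_translation p) (1%g : G) v.

Definition left_invariant_metric g : Prop := riemannian_metric g /\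
  forall a p v w,
    mxform (g (left_translation a p)) (tangent_map (left_translation a) p v)
      (tangent_map (left_translation a) p w) = mxform (g p) v w.

(* An endomorphism of the Lie algebra is represented by an operator on vector
   fields that maps left-invariant fields to left-invariant fields; its trace is
   taken through the isomorphism [v |-> left_vf v], [X |-> X 1] between the
   tangent space at the unit element and the Lie algebra. *)
Definition trLie (A : vfield G -> vfield G) : R :=
  trend (fun v => A (left_vf v) 1%g).

Definition ad X : vfield G -> vfield G := lie_bracket X.

(* g(ad* _X Y, V) = g(Y, ad_X V) for every left-invariant V *)
Definition ad_adj g X : vfield G -> vfield G := fun Y =>
  left_vf (riesz (g 1%g) (fun v => inner g Y (ad X (left_vf v)) 1%g)).

Definition mean_curvature_vector g : vfield G :=
  left_vf (riesz (g 1%g) (fun v => trLie (ad (left_vf v)))).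

Definition Jend g X : vfield G -> vfield G := fun Y => ad_adj g Y X.

End LeftInvariant.

(* Main.v *)
Require Import Defs.
From HB Require Import structures.
From mathcomp Require Import all_boot all_order all_algebra.
From mathcomp Require Import all_classical all_reals all_analysis.
From mathcomp Require Import ring lra.

Set Implicit Arguments.
Unset Strict Implicit.
Unset Printing Implicit Defensive.

Import Order.TTheory GRing.Theory Num.Theory.
Import numFieldNormedType.Exports.
Local Open Scope classical_set_scope.
Local Open Scope ring_scope.

(** The soliton equation for the metric [f g] says that the form
   [Ric(f g) - lambda f g + (1/2) L_X (f g)] vanishes, and the Leibniz rule gives
   [L_X (f g) = (X f) g + f L_X g].  This form is a tensor, and left-invariant
   fields span every tangent space, so that it vanishes as soon as it vanishes on
   left-invariant fields ([soliton_defect_frame]).  What remains is to compute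
   the Ricci tensor of [f g] on left-invariant fields ([ricci_conformal_left]).
   Two classical formulas meet there: the Ricci tensor of a left-invariant
   metric is an expression in [ad] ([christoffel_ricci], [lie_ricciE]), and for
   [f = exp (- 2 phi)] the conformal change adds
   [(n - 2) (Hess phi + dphi (x) dphi) + (Lap phi - (n - 2) |dphi|^2) g], where
   [Hess phi + dphi (x) dphi] is [Hess psi / psi] for [psi = exp phi]
   ([hessian_exp_frame]).

   Both formulas come out of one computation in a left-invariant frame [E_i]
   which is orthonormal for [g].  Its brackets have constant coefficients, the
   structure constants.  The connection whose coefficients are those of the
   Koszul formula, corrected by the derivatives of [phi], is metric and
   torsion-free for [f g] ([frame_connection_levi_civita]); since such a
   connection is unique ([levi_civita_unique]), it is the Levi-Civita
   connection.  As the curvature is a tensor ([curvature_linl] and its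
   companions), the Ricci tensor is a finite sum over the frame, evaluated by
   [conformal_ricci].  The structure constants enter that evaluation through
   their antisymmetry and through the vanishing of the trace of [ad] on
   brackets, a trace of the Jacobi identity ([jacobi_trace]).

   The global frame keeps the analysis elementary.  The coefficients of a smooth
   field are its inner products with the [E_k], hence smooth, which replaces
   partitions of unity and inversions of matrices of functions.  The one analytic
   theorem behind the argument is the symmetry of second derivatives
   ([diff2_sym]): it makes brackets commutators of derivations
   ([vf_app_bracket]), makes them natural under smooth maps
   ([local_bracket_related]), so that left-invariant fields are closed under
   brackets, and yields the Jacobi identity ([local_jacobi]). *)

(** * Differentials and maps of class C^k *)

Section Differentials.
Context {R : realType}.
Implicit Types U V W : normedModType R.

Lemma diff_near V W (f g : V -> W) x :
  (\forall y \near x, f y = g y) -> differentiable f x ->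
  differentiable g x /\ ('d g x : V -> W) = 'd f x.
Proof.
move=> fg df.
have gE : g \o shift x = cst (g x) + 'd f x +o_ (0 : V) id.
  have fx : f x = g x by exact: nbhs_singleton fg.
  apply/eqaddoP => e e0.
  have /eqaddoP/(_ e e0) := diff_locally df.
  have : \forall y \near (0 : V), f (y + x) = g (y + x).
    have : (y + x) @[y --> (0 : V)] --> 0 + x.
      by apply: cvgD; [exact: cvg_id | exact: cvg_cst].
    by rewrite add0r => /(_ _ fg).
  apply: filterS2 => y fgy.
  by rewrite !fctE /= fgy fx.
have dg : ('d g x : V -> W) = 'd f x.
  by apply: diff_unique gE; exact: diff_continuous.
split=> //; apply/diff_locallyP; rewrite dg; split=> //; exact: diff_continuous.
Qed.

Lemma diff_eq_near V W (f g : V -> W) x v :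
  (\forall y \near x, f y = g y) -> differentiable f x -> 'd g x v = 'd f x v.
Proof. by move=> fg df; have [_ ->] := diff_near fg df. Qed.

Lemma linear_cts n W (L : {linear 'rV[R]_n -> W}) : continuous L.
Proof.
have -> : (L : 'rV[R]_n -> W) = fun v => \sum_j v 0 j *: L (delta_mx 0 j).
  apply/funext => v; rewrite {1}[v]row_sum_delta linear_sum /=.
  by apply: eq_bigr => j _; rewrite linearZ.
apply: continuous_big => [|j _ v]; first exact: add_continuous.
apply: (@continuousZr_tmp _ _ _ (fun v : 'rV[R]_n => v 0 j : R^o)).
exact: (@coord_continuous R 1 n 0 j).
Qed.

Lemma diff_linear V W (L : {linear V -> W}) x : continuous L ->
  differentiable L x /\ ('d L x : V -> W) = L.
Proof. by move=> cL; split; [exact: linear_differentiable | exact: diff_lin]. Qed.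

Lemma diff_lincomp V W W' (L : {linear W -> W'}) (f : V -> W) x :
  continuous L -> differentiable f x ->
  differentiable (fun y => L (f y)) x /\
  forall v, 'd (fun y => L (f y)) x v = L ('d f x v).
Proof.
move=> cL df; have [dL LE] := diff_linear (f x) cL.
split; first exact: (differentiable_comp df dL).
by move=> v; rewrite (diff_comp df dL) /= LE.
Qed.

Lemma diff_add V W (f g : V -> W) x :
  differentiable f x -> differentiable g x ->
  differentiable (fun y => f y + g y) x /\
  forall v, 'd (fun y => f y + g y) x v = 'd f x v + 'd g x v.
Proof.
move=> df dg; split; first exact: differentiableD.
by move=> v; rewrite (diffD df dg).
Qed.

Lemma diff_const V W (a : W) x : differentiable (fun _ : V => a) x /\
  forall v, 'd (fun _ : V => a) x v = 0.
Proof.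
by split; [exact: differentiable_cst | move=> v; rewrite (diff_cst a x)].
Qed.

Lemma diff_scale V W (u : V -> R) (f : V -> W) x :
  differentiable u x -> differentiable f x ->
  differentiable (fun y => u y *: f y) x /\
  forall v, 'd (fun y => u y *: f y) x v = 'd u x v *: f x + u x *: 'd f x v.
Proof.
move=> du df.
have sc : continuous (fun p : R^o * W => p.1 *: p.2) by exact: scale_continuous.
have bl : bilinear_for (GRing.Scale.Law.clone _ _ *:%R _)
    (GRing.Scale.Law.clone _ _ *:%R _) (@GRing.scale R W : R^o -> W -> W).
  split=> [w|a] b y z /=; first by rewrite scalerDl scalerA.
  by rewrite scalerDr !scalerA mulrC.
pose BM := bilinear_isBilinear.Build R R^o W W _ _ _ bl.
pose B : {bilinear R^o -> W -> W} := HB.pack (@GRing.scale R W) BM.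
have dp := differentiable_pair du df.
have dB : differentiable (fun q : R^o * W => B q.1 q.2) (u x, f x).
  exact: differentiable_bilin.
split; first exact: (differentiable_comp dp dB).
move=> v; rewrite (diff_comp dp dB) /= (diff_bilin (f := B) (u x, f x) sc) /=.
by rewrite (diff_pair du df) /= addrC.
Qed.

End Differentials.

Section SmoothCalculus.
Context {R : realType}.
Implicit Types U V W : normedModType R.

Definition rcoord n (j : 'I_n) (v : 'rV[R]_n) : R := v 0 j.

Fact rcoord_is_linear n (j : 'I_n) : linear (@rcoord n j).
Proof. by move=> a u v; rewrite /rcoord !mxE. Qed.

HB.instance Definition _ n (j : 'I_n) :=
  GRing.isLinear.Build R 'rV[R]_n R _ (@rcoord n j) (@rcoord_is_linear n j).

(** Openness of [A] turns equality on [A] into equality near each of its points,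
   which differentials respect. *)
Lemma Ck_on_eq V W k (A : set V) (f g : V -> W) : open A ->
  (forall x, A x -> f x = g x) -> Ck_on k A f -> Ck_on k A g.
Proof.
move=> oA; elim: k f g => [|k IH] f g fg.
  move=> cf x Ax; have cfx : f y @[y --> x] --> f x := cf x Ax.
  rewrite /prop_for /continuous_at -(fg x Ax); apply: cvg_trans cfx.
  by apply: near_eq_cvg; near=> y; apply: fg; near: y; exact: open_nbhs_nbhs.
move=> [df Cf]; have nfg x : A x -> \forall y \near x, f y = g y.
  by move=> Ax; near=> y; apply: fg; near: y; exact: open_nbhs_nbhs.
split=> [x Ax|v]; first by have [] := diff_near (nfg x Ax) (df x Ax).
apply: IH (Cf v) => x Ax.
by rewrite (diff_eq_near _ (nfg x Ax) (df x Ax)).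
Unshelve. all: by end_near. Qed.

Lemma Ck_on_sub V W k (A B : set V) (f : V -> W) :
  A `<=` B -> Ck_on k B f -> Ck_on k A f.
Proof.
move=> AB; elim: k f => [|k IH] f /=; first by move=> cf x /AB; exact: cf.
by move=> [df Cf]; split=> [x /AB|v]; [exact: df | exact: IH].
Qed.

Lemma Ck_onW V W k (A : set V) (f : V -> W) : Ck_on k.+1 A f -> Ck_on k A f.
Proof.
elim: k f => [|k IH] f [df Cf]; last by split=> // v; exact: IH.
by move=> x Ax; exact: differentiable_continuous (df x Ax).
Qed.

Lemma Ck_on_cst V W k (A : set V) (a : W) : Ck_on k A (fun=> a).
Proof.
elim: k a => [|k IH] a /=; first by move=> x _; exact: cvg_cst.
split=> [x _|v]; first exact: (diff_const a x).1.
by have -> : (fun x : V => 'd (fun=> a) x v) = (fun=> 0 : W)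
  by apply/funext => x; rewrite (diff_const a x).2.
Qed.

Lemma Ck_on_add V W k (A : set V) (f g : V -> W) : open A ->
  Ck_on k A f -> Ck_on k A g -> Ck_on k A (fun x => f x + g x).
Proof.
move=> oA; elim: k f g => [|k IH] f g /=.
  by move=> cf cg x Ax; apply: cvgD; [exact: cf | exact: cg].
move=> [df Cf] [dg Cg]; split=> [x Ax|v].
  exact: (diff_add (df x Ax) (dg x Ax)).1.
apply: Ck_on_eq (IH _ _ (Cf v) (Cg v)) => // x Ax.
by rewrite (diff_add (df x Ax) (dg x Ax)).2.
Qed.

Lemma Ck_on_sum V W k (A : set V) (I : Type) (r : seq I) (f : I -> V -> W) :
  open A -> (forall i, Ck_on k A (f i)) ->
  Ck_on k A (fun x => \sum_(i <- r) f i x).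
Proof.
move=> oA Cf; elim: r => [|i r IH].
  by under eq_fun do rewrite big_nil; exact: Ck_on_cst.
by under eq_fun do rewrite big_cons; exact: Ck_on_add.
Qed.

Lemma Ck_on_lin V W W' k (A : set V) (L : {linear W -> W'}) (f : V -> W) :
  open A -> continuous L -> Ck_on k A f -> Ck_on k A (fun x => L (f x)).
Proof.
move=> oA cL; elim: k f => [|k IH] f /=.
  by move=> cf x Ax; apply: continuous_comp; [exact: cf | exact: cL].
move=> [df Cf]; split=> [x Ax|v]; first exact: (diff_lincomp cL (df x Ax)).1.
apply: Ck_on_eq (IH _ (Cf v)) => // x Ax.
by rewrite (diff_lincomp cL (df x Ax)).2.
Qed.

Lemma Ck_on_coord V n k (A : set V) (f : V -> 'rV[R]_n) j : open A ->
  Ck_on k A f -> Ck_on k A (fun x => f x 0 j).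
Proof. by move=> oA; apply: (@Ck_on_lin _ _ _ _ _ (@rcoord n j) f oA); exact: linear_cts. Qed.

Lemma Ck_on_scale V W k (A : set V) (u : V -> R) (f : V -> W) : open A ->
  Ck_on k A u -> Ck_on k A f -> Ck_on k A (fun x => u x *: f x).
Proof.
move=> oA; elim: k u f => [|k IH] u f /=.
  by move=> cu cf x Ax; apply: cvgZ; [exact: cu | exact: cf].
move=> Cu Cf; have [du Cdu] := Cu; have [df Cdf] := Cf.
split=> [x Ax|v]; first exact: (diff_scale (du x Ax) (df x Ax)).1.
apply: (@Ck_on_eq _ _ _ _ (fun x => 'd u x v *: f x + u x *: 'd f x v)) => //.
  by move=> x Ax; rewrite (diff_scale (du x Ax) (df x Ax)).2.
by apply: Ck_on_add => //; apply: IH => //; exact: Ck_onW.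
Qed.

(** The chain rule gives ['d h (f x) ('d f x v)], where [x] enters twice.
   Expanding the vector in the canonical basis separates the two dependences and
   lets the induction hypothesis act on the maps [y |-> 'd h y e_j]. *)
Lemma Ck_on_comp n V W k (A : set V) (B : set 'rV[R]_n)
    (f : V -> 'rV[R]_n) (h : 'rV[R]_n -> W) : open A ->
  (forall x, A x -> B (f x)) -> Ck_on k A f -> Ck_on k B h ->
  Ck_on k A (fun x => h (f x)).
Proof.
move=> oA AB; elim: k h => [|k IH] h /=.
  by move=> cf ch x Ax; apply: continuous_comp; [exact: cf | exact/ch/AB].
move=> Cf [dh Ch]; have [df Cdf] := Cf.
split=> [x Ax|v]; first exact: (differentiable_comp (df x Ax) (dh _ (AB x Ax))).
apply: (@Ck_on_eq _ _ _ _ (fun x => \sum_j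
    ('d f x v 0 j) *: 'd h (f x) (delta_mx 0 j))) => //.
  move=> x Ax; rewrite (diff_comp (df x Ax) (dh _ (AB x Ax))) /=.
  rewrite [in RHS](row_sum_delta ('d f x v)) linear_sum /=.
  by apply: eq_bigr => j _; rewrite linearZ.
apply: Ck_on_sum => // j; apply: Ck_on_scale => //; first exact: Ck_on_coord.
by apply: (IH (fun y => 'd h y (delta_mx 0 j))) => //; exact: Ck_onW.
Qed.

End SmoothCalculus.

(** * Symmetry of second derivatives *)

Section Schwarz.
Context {R : realType} {V : normedModType R}.

Lemma is_derive_line (u : V -> R) p (v : V) (s : R) :
  differentiable u (p + s *: v) ->
  is_derive s 1 (fun t : R => u (p + t *: v)) ('d u (p + s *: v) v).
Proof.
move=> du.
have [dc dcE] := diff_const (V := R^o) p (s : R^o).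
have [dv dvE] := diff_const (V := R^o) v (s : R^o).
have di : differentiable (fun t : R^o => t) (s : R^o).
  exact: ex_diff.
have diE : 'd (fun t : R^o => t) (s : R^o) = id :> (R^o -> R^o) by exact: diff_val.
have [dl dlE] := diff_scale di dv.
have [da daE] := diff_add dc dl.
have dd := differentiable_comp da du.
apply: DeriveDef; first exact: diff_derivable.
rewrite deriveE // (diff_comp da du) /= daE dcE dlE dvE scaler0 addr0 add0r.
by rewrite diE scale1r.
Qed.

(** The mean value theorem, first along [v] and then along [w]. *)
Lemma second_difference (u : V -> R) (A : set V) x (v w : V) (e : R) :
  Ck_on 2 A u -> 0 < e ->
  (forall s t, 0 <= s <= e -> 0 <= t <= e -> A (x + s *: v + t *: w)) ->
  exists s t, [/\ 0 <= s <= e, 0 <= t <= e &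
    u (x + e *: v + e *: w) - u (x + e *: v) - (u (x + e *: w) - u x) =
    e * e * 'd (fun z => 'd u z v) (x + s *: v + t *: w) w].
Proof.
move=> [du /(_ v) [ddu _]] e0 inA.
have ee : 0 <= e <= e by rewrite ltW //=.
have zz : 0 <= (0 : R) <= e by rewrite lexx ltW.
pose F s := u (x + e *: w + s *: v) - u (x + s *: v).
have FD s : 0 <= s <= e -> is_derive s 1 F
    ('d u (x + e *: w + s *: v) v - 'd u (x + s *: v) v).
  move=> hs; apply: is_deriveB; apply: is_derive_line; apply: du.
    by rewrite addrAC; exact: inA.
  by have := inA s 0 hs zz; rewrite scale0r addr0.
have [s] : exists2 c, c \in `]0, e[%R & F e - F 0 =
    ('d u (x + e *: w + c *: v) v - 'd u (x + c *: v) v) * (e - 0).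
  apply: MVT => //.
    by move=> s; rewrite in_itv /= => /andP[s0 se]; apply: FD; rewrite !ltW.
  apply: derivable_within_continuous => s; rewrite in_itv /= => hs.
  by have [] := FD s hs.
rewrite in_itv /= => /andP[s0 se] Fe.
have hs : 0 <= s <= e by rewrite !ltW.
pose H t := 'd u (x + s *: v + t *: w) v.
have HD t : 0 <= t <= e -> is_derive t 1 H
    ('d (fun z => 'd u z v) (x + s *: v + t *: w) w).
  by move=> ht; apply: is_derive_line; apply: ddu; exact: inA.
have [t] : exists2 c, c \in `]0, e[%R & H e - H 0 =
    'd (fun z => 'd u z v) (x + s *: v + c *: w) w * (e - 0).
  apply: MVT => //.
    by move=> t; rewrite in_itv /= => /andP[t0 te]; apply: HD; rewrite !ltW.
  apply: derivable_within_continuous => t; rewrite in_itv /= => ht.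
  by have [] := HD t ht.
rewrite in_itv /= => /andP[t0 te] He.
exists s, t; split; rewrite ?ltW //.
move: Fe He; rewrite /F /H !scale0r !addr0 !subr0.
rewrite [x + s *: v + e *: w]addrAC => Fe He.
rewrite [x + e *: v + e *: w]addrAC Fe He; ring.
Qed.

(** The second difference over a parallelogram does not see the order of its
   sides, and both iterated derivatives are limits of it, by continuity. *)
Lemma diff2_sym (u : V -> R) (A : set V) x v w : open A -> Ck_on 2 A u ->
  A x -> 'd (fun y => 'd u y v) x w = 'd (fun y => 'd u y w) x v.
Proof.
move=> oA Cu Ax.
have C0 v' w' : {for x, continuous (fun y => 'd (fun z => 'd u z v') y w')}.
  by have [_ /(_ v') [_ /(_ w') c]] := Cu; exact: c.
set a := LHS; set b := RHS; apply/eqP; rewrite -subr_eq0 -normr_le0.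
apply/ler_addgt0Pl => d d0; rewrite addr0.
have d20 : 0 < d / 2 by rewrite divr_gt0.
have Na : \forall y \near x, `|a - 'd (fun z => 'd u z v) y w| < d / 2.
  by move/cvgrPdist_lt: (C0 v w); exact.
have Nb : \forall y \near x, `|b - 'd (fun z => 'd u z w) y v| < d / 2.
  by move/cvgrPdist_lt: (C0 w v); exact.
have NA : \forall y \near x, A y by exact: open_nbhs_nbhs.
have [r /= r0 Hr] := (nbhs_ballP _ _).1 (filterI NA (filterI Na Nb)).
(* The parallelogram of sides [e *: v] and [e *: w] at [x] stays within
   [e * m = r / 2] of [x].  The summand 1 keeps [m] positive when [v = w = 0]. *)
pose m := `|v| + `|w| + 1.
have m0 : 0 < m by rewrite ltr_wpDl // addr_ge0.
pose e := r / (m + m); have e0 : 0 < e by rewrite divr_gt0 // addr_gt0.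
have inr s t : 0 <= s <= e -> 0 <= t <= e -> ball x r (x + s *: v + t *: w).
  move=> /andP[s0 se] /andP[t0 te].
  rewrite -ball_normE /= -addrA opprD addNKr normrN.
  apply: (le_lt_trans (ler_normD _ _)); rewrite !normrZ !ger0_norm //.
  apply: (@le_lt_trans _ _ (e * m)).
    rewrite /m !mulrDr mulr1 -[X in X <= _]addr0; apply: lerD; last exact: ltW.
    by apply: lerD; apply: ler_wpM2r.
  have -> : e * m = r / 2.
    by rewrite /e -mulr2n -mulr_natr; field; rewrite gt_eqF.
  by rewrite ltr_pdivrMr // ltr_pMr // ltr1n.
have [s [t [hs ht E1]]] := second_difference Cu e0
  (fun s t hs ht => (Hr _ (inr s t hs ht)).1).
have inr' s' t' : 0 <= s' <= e -> 0 <= t' <= e -> ball x r (x + s' *: w + t' *: v).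
  by move=> hs' ht'; rewrite addrAC; exact: inr.
have [s' [t' [hs' ht' E2]]] := second_difference Cu e0
  (fun s t hs ht => (Hr _ (inr' s t hs ht)).1).
have E : 'd (fun z => 'd u z v) (x + s *: v + t *: w) w =
         'd (fun z => 'd u z w) (x + s' *: w + t' *: v) v.
  apply: (@mulfI _ (e * e)); first by rewrite mulf_neq0 // gt_eqF.
  rewrite -E1 -E2 [x + e *: w + e *: v]addrAC; ring.
have /= [_ [+ _]] := Hr _ (inr _ _ hs ht).
have /= [_ [_ +]] := Hr _ (inr' _ _ hs' ht').
rewrite E => hb ha.
have -> : d = d / 2 + d / 2 by rewrite -splitr.
set c := 'd _ _ _ in ha hb.
have -> : a - b = (a - c) - (b - c) by ring.
by apply: le_trans (ler_normB _ _) _; apply: lerD; exact: ltW.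
Qed.

End Schwarz.

Section SmoothOn.
Context {R : realType}.
Implicit Types V W : normedModType R.

Lemma smooth_on_eq V W (A : set V) (f g : V -> W) : open A ->
  (forall x, A x -> f x = g x) -> smooth_on A f -> smooth_on A g.
Proof. by move=> oA fg sf k; exact: Ck_on_eq (sf k). Qed.

Lemma smooth_on_sub V W (A B : set V) (f : V -> W) :
  A `<=` B -> smooth_on B f -> smooth_on A f.
Proof. by move=> AB sf k; exact: Ck_on_sub (sf k). Qed.

Lemma smooth_on_differentiable V W (A : set V) (f : V -> W) x :
  smooth_on A f -> A x -> differentiable f x.
Proof. by move=> /(_ 1%N) [df _]; exact: df. Qed.

Lemma smooth_on_diff V W (A : set V) (f : V -> W) v :
  smooth_on A f -> smooth_on A (fun x => 'd f x v).
Proof. by move=> sf k; have [_] := sf k.+1; exact. Qed.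

Lemma smooth_on_cst V W (A : set V) (a : W) : smooth_on A (fun=> a).
Proof. by move=> k; exact: Ck_on_cst. Qed.

Lemma smooth_on_add V W (A : set V) (f g : V -> W) : open A ->
  smooth_on A f -> smooth_on A g -> smooth_on A (fun x => f x + g x).
Proof. by move=> oA sf sg k; exact: Ck_on_add. Qed.

Lemma smooth_on_sum V W (A : set V) (I : Type) (r : seq I) (f : I -> V -> W) :
  open A -> (forall i, smooth_on A (f i)) ->
  smooth_on A (fun x => \sum_(i <- r) f i x).
Proof. by move=> oA sf k; apply: Ck_on_sum => // i; exact: sf. Qed.

Lemma smooth_on_scale V W (A : set V) (u : V -> R) (f : V -> W) : open A ->
  smooth_on A u -> smooth_on A f -> smooth_on A (fun x => u x *: f x).
Proof. by move=> oA su sf k; exact: Ck_on_scale. Qed.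

Lemma smooth_on_mul V (A : set V) (u v : V -> R) : open A ->
  smooth_on A u -> smooth_on A v -> smooth_on A (fun x => u x * v x).
Proof. by move=> oA su sv; exact: (@smooth_on_scale V R^o). Qed.

Lemma smooth_on_coord V n (A : set V) (f : V -> 'rV[R]_n) j : open A ->
  smooth_on A f -> smooth_on A (fun x => f x 0 j).
Proof. by move=> oA sf k; exact: Ck_on_coord. Qed.

Lemma smooth_on_comp n V W (A : set V) (B : set 'rV[R]_n)
    (f : V -> 'rV[R]_n) (h : 'rV[R]_n -> W) : open A ->
  (forall x, A x -> B (f x)) -> smooth_on A f -> smooth_on B h ->
  smooth_on A (fun x => h (f x)).
Proof. by move=> oA AB sf sh k; exact: Ck_on_comp (sf k) (sh k). Qed.

Lemma diff_expR_comp V (u : V -> R) x : differentiable u x ->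
  differentiable (fun y => expR (u y)) x /\
  forall v, 'd (fun y => expR (u y)) x v = expR (u x) * 'd u x v.
Proof.
move=> du.
have de : differentiable (expR : R -> R) (u x).
  by apply/derivable1_diffP; have [] := is_derive_expR (u x).
split; first exact: (differentiable_comp du de).
move=> v; rewrite (diff_comp du de) /=.
rewrite -[X in 'd expR _ X]mulr1 -[_ * 1]/(_ *: (1 : R^o)) linearZ /=.
rewrite -(deriveE _ de).
have [_ ->] := is_derive_expR (u x).
by rewrite mulrC.
Qed.

Lemma smooth_on_expR V (A : set V) (u : V -> R) : open A ->
  smooth_on A u -> smooth_on A (fun x => expR (u x)).
Proof.
move=> oA su k; elim: k u su => [|k IH] u su.
  move=> x Ax; apply: continuous_comp; first exact: (su 0).
  exact: continuous_expR.
split=> [x Ax|v].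
  exact: (diff_expR_comp (smooth_on_differentiable su Ax)).1.
apply: (@Ck_on_eq _ _ _ _ _ (fun x => expR (u x) * 'd u x v)) => //.
  by move=> x Ax; rewrite (diff_expR_comp (smooth_on_differentiable su Ax)).2.
apply: (@Ck_on_scale _ _ R^o) => //; first exact: IH.
exact: smooth_on_diff su k.
Qed.

Lemma diff_sum V W (I : Type) (r : seq I) (f : I -> V -> W) x :
  (forall i, differentiable (f i) x) ->
  differentiable (fun y => \sum_(i <- r) f i y) x /\
  forall v, 'd (fun y => \sum_(i <- r) f i y) x v = \sum_(i <- r) 'd (f i) x v.
Proof.
move=> df; elim: r => [|i r [IHd IHv]].
  under eq_fun do rewrite big_nil; have [d0 d0E] := diff_const (0 : W) x.
  by split=> // v; rewrite big_nil d0E.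
under eq_fun do rewrite big_cons; have [da daE] := diff_add (df i) IHd.
by split=> // v; rewrite big_cons daE IHv.
Qed.

End SmoothOn.

(** * Vector fields on open subsets of R^n *)

Section LocalFields.
Context {R : realType}.

Lemma diff_coord (V : normedModType R) n (f : V -> 'rV[R]_n) x j :
  differentiable f x -> differentiable (fun y => f y 0 j) x /\
  forall v, 'd (fun y => f y 0 j) x v = 'd f x v 0 j.
Proof. by move=> df; exact: (diff_lincomp (L := @rcoord R n j) (@linear_cts _ _ _ _) df). Qed.

(** The derivative of [y |-> 'd f y (Z y)]: only the dependence on the base
   point of ['d f] needs differentiability, the dependence on the vector being
   linear. *)
Lemma diff_apply m (W : normedModType R) (f : 'rV[R]_m -> W)
    (Z : 'rV[R]_m -> 'rV[R]_m) x w :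
  (forall v, differentiable (fun y => 'd f y v) x) -> differentiable Z x ->
  'd (fun y => 'd f y (Z y)) x w =
  'd (fun y => 'd f y (Z x)) x w + 'd f x ('d Z x w).
Proof.
move=> df dZ.
have E (T : 'rV[R]_m -> 'rV[R]_m) : (fun y => 'd f y (T y)) =
    fun y => \sum_j T y 0 j *: 'd f y (delta_mx 0 j).
  apply/funext => y; rewrite {1}[T y]row_sum_delta linear_sum /=.
  by apply: eq_bigr => j _; rewrite linearZ.
rewrite (E Z) (E (fun=> Z x)).
have S (a : 'I_m -> 'rV[R]_m -> R) : (forall j, differentiable (a j) x) ->
    'd (fun y => \sum_j a j y *: 'd f y (delta_mx 0 j)) x w =
    \sum_j ('d (a j) x w *: 'd f x (delta_mx 0 j) +
            a j x *: 'd (fun y => 'd f y (delta_mx 0 j)) x w).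
  move=> da; pose g j y := a j y *: 'd f y (delta_mx 0 j).
  have dg j : differentiable (g j) x := (diff_scale (da j) (df (delta_mx 0 j))).1.
  apply: etrans ((diff_sum (index_enum 'I_m) dg).2 w) _; apply: eq_bigr => j _.
  exact: (diff_scale (da j) (df (delta_mx 0 j))).2.
have dj j := diff_coord j dZ.
apply: etrans (S (fun j y => Z y 0 j) (fun j => (dj j).1)) _.
have SC := S (fun j y => Z x 0 j) (fun j => (diff_const _ x).1).
apply: etrans _ (congr1 (fun t => t + _) (esym SC)).
have EZ : 'd f x ('d Z x w) = \sum_j 'd Z x w 0 j *: 'd f x (delta_mx 0 j).
  rewrite {1}['d Z x w]row_sum_delta linear_sum.
  by apply: eq_bigr => j _; rewrite linearZ.
apply: etrans _ (congr1 (fun t => _ + t) (esym EZ)).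
rewrite -big_split.
apply: eq_bigr => j _.
have h1 := (dj j).2 w.
have h2 := (diff_const (Z x 0 j) x).2 w.
apply: etrans (congr1 (fun t => t *: _ + _) h1) _.
apply: etrans _ (esym (congr1 (fun t => t *: _ + _ + _) h2)).
by rewrite scale0r add0r addrC.
Qed.

Lemma diff2_sym_rV m n (f : 'rV[R]_m -> 'rV[R]_n) A x v w :
  open A -> smooth_on A f -> A x ->
  'd (fun y => 'd f y v) x w = 'd (fun y => 'd f y w) x v.
Proof.
move=> oA sf Ax; apply/rowP => j.
have E v' w' : 'd (fun y => 'd f y v') x w' 0 j =
    'd (fun y => 'd (fun z => f z 0 j) y v') x w'.
  have dv := smooth_on_differentiable (smooth_on_diff v' sf) Ax.
  rewrite -(diff_coord j dv).2; apply/esym/diff_eq_near; last exact: (diff_coord j dv).1.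
  near=> y; rewrite (diff_coord j _).2 //.
  by apply: (smooth_on_differentiable sf); near: y; exact: open_nbhs_nbhs.
rewrite !E; apply: (diff2_sym _ _ oA _ Ax).
exact: smooth_on_coord oA sf 2.
Unshelve. all: by end_near. Qed.

Definition local_bracket n (V W : 'rV[R]_n -> 'rV[R]_n) : 'rV[R]_n -> 'rV[R]_n :=
  fun x => 'd W x (V x) - 'd V x (W x).

(** The bracket is the commutator of the two derivations: what the commutator
   contains of the second derivative of [u] cancels by symmetry. *)
Lemma local_bracket_derivation n (u : 'rV[R]_n -> R) V W A x :
  open A -> smooth_on A u -> smooth_on A V -> smooth_on A W -> A x ->
  'd u x (local_bracket V W x) =
  'd (fun y => 'd u y (W y)) x (V x) - 'd (fun y => 'd u y (V y)) x (W x).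
Proof.
move=> oA su sV sW Ax.
have du v : differentiable (fun y => 'd u y v) x.
  exact: smooth_on_differentiable (smooth_on_diff v su) Ax.
have EW := diff_apply (V x) du (smooth_on_differentiable sW Ax).
have EV := diff_apply (W x) du (smooth_on_differentiable sV Ax).
apply: etrans _ (esym (congr2 (fun s t => s - t) EW EV)).
have Sym := diff2_sym (V x) (W x) oA (su 2) Ax.
apply: etrans _ (esym (congr1 (fun t => _ - (t + _)) Sym)).
by rewrite opprD addrACA subrr add0r -linearB.
Qed.

(** Naturality of the bracket: the second derivatives of [F] that appear when
   the relations [V' \o F = dF (V)] are differentiated cancel by symmetry. *)
Lemma local_bracket_related m n (F : 'rV[R]_m -> 'rV[R]_n) V W V' W' A x :
  open A -> smooth_on A F -> smooth_on A V -> smooth_on A W -> A x ->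
  differentiable V' (F x) -> differentiable W' (F x) ->
  (forall y, A y -> V' (F y) = 'd F y (V y)) ->
  (forall y, A y -> W' (F y) = 'd F y (W y)) ->
  local_bracket V' W' (F x) = 'd F x (local_bracket V W x).
Proof.
move=> oA sF sV sW Ax dV' dW' EV EW.
have dF := smooth_on_differentiable sF Ax.
have ddF v : differentiable (fun y => 'd F y v) x.
  exact: smooth_on_differentiable (smooth_on_diff v sF) Ax.
have dVx := smooth_on_differentiable sV Ax.
have dWx := smooth_on_differentiable sW Ax.
have key (Z : 'rV[R]_m -> 'rV[R]_m) (Z' : 'rV[R]_n -> 'rV[R]_n) w : differentiable Z x ->
    differentiable Z' (F x) -> (forall y, A y -> Z' (F y) = 'd F y (Z y)) ->
    'd Z' (F x) ('d F x w) = 'd (fun y => 'd F y (Z x)) x w + 'd F x ('d Z x w).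
  move=> dZ dZ' EZ; apply: etrans _ (diff_apply w ddF dZ).
  have Ecomp : 'd (Z' \o F) x w = 'd Z' (F x) ('d F x w).
    exact: (congr1 (fun h : 'rV[R]_m -> 'rV[R]_n => h w) (diff_comp dF dZ')).
  apply: etrans (esym Ecomp) _.
  apply/esym/(@diff_eq_near _ _ _ (Z' \o F)); last exact: differentiable_comp.
  by near=> y; apply: EZ; near: y; exact: open_nbhs_nbhs.
rewrite /local_bracket (EV x Ax) (EW x Ax).
apply: etrans (congr2 (fun s t => s - t) (key W W' _ dWx dW' EW)
  (key V V' _ dVx dV' EV)) _.
have Sym := diff2_sym_rV (V x) (W x) oA sF Ax.
apply: etrans (congr1 (fun t => _ - (t + _)) Sym) _.
by rewrite opprD addrACA subrr add0r -linearB.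
Unshelve. all: by end_near. Qed.

End LocalFields.

(** * Charts, tangent vectors and derivations *)

Section ManifoldCalculus.
Context {R : realType} {n : nat} {M : manifoldType R n}.
Implicit Types (c d : chart R n M) (p : M) (X Y Z : vfield M) (u : M -> R).

(** Linearity in the vector makes this a finite sum of products. *)
Lemma smooth_on_apply m (W : normedModType R) (A : set 'rV[R]_m)
    (f : 'rV[R]_m -> W) (Z : 'rV[R]_m -> 'rV[R]_m) : open A ->
  smooth_on A f -> smooth_on A Z -> smooth_on A (fun x => 'd f x (Z x)).
Proof.
move=> oA sf sZ.
apply: (@smooth_on_eq _ _ _ _ (fun x => \sum_j Z x 0 j *: 'd f x (delta_mx 0 j))) => //.
  move=> x _; rewrite [in RHS](row_sum_delta (Z x)) linear_sum /=.
  by apply: eq_bigr => j _; rewrite linearZ.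
apply: smooth_on_sum => // j; apply: smooth_on_scale => //.
  exact: smooth_on_coord.
exact: smooth_on_diff.
Qed.

Lemma chart_preimage_open c (B : set M) :
  open B -> open (chart_cod c `&` chart_inv c @^-1` B).
Proof.
move=> oB; rewrite openE => x [cx Bx]; apply: filterI.
  by apply: open_nbhs_nbhs; split=> //; exact: chart_open_cod.
by apply: (chart_inv_continuous cx); exact: open_nbhs_nbhs.
Qed.

Lemma atlas_at p : atlas (chart_at p). Proof. exact: chart_at_atlas. Qed.
Lemma dom_at p : chart_dom (chart_at p) p. Proof. exact: chart_at_dom. Qed.
Hint Resolve atlas_at dom_at : core.

Lemma chart_inv_transition c d p : chart_dom c p -> chart_dom d p ->
  (chart_cod c `&` chart_inv c @^-1` chart_dom d) (c p).
Proof. by move=> cp dp; split; [exact: chart_funS | rewrite /= chart_funK]. Qed.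

Lemma transition_differentiable c d p : atlas c -> atlas d ->
  chart_dom c p -> chart_dom d p -> differentiable (d \o chart_inv c) (c p).
Proof.
move=> ac ad cp dp.
exact: (smooth_on_differentiable (atlas_compatible c d ac ad)
  (chart_inv_transition cp dp)).
Qed.

(** Tangent vectors, differentials of functions and tangent maps are all read in
   preferred charts; this rule moves any of them to another chart. *)
Lemma diff_chart_change (W : normedModType R) (h : M -> W) c d p v :
  atlas c -> atlas d -> chart_dom c p -> chart_dom d p ->
  differentiable (h \o chart_inv d) (d p) ->
  'd (h \o chart_inv c) (c p) v =
  'd (h \o chart_inv d) (d p) ('d (d \o chart_inv c) (c p) v).
Proof.
move=> ac ad cp dp dh.
have dt := transition_differentiable ac ad cp dp.
have E : (d \o chart_inv c) (c p) = d p by rewrite /= chart_funK.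
have dh' : differentiable (h \o chart_inv d) ((d \o chart_inv c) (c p)) by rewrite E.
have dc := diff_comp dt dh'; rewrite E in dc.
apply: etrans _ (congr1 (fun f : 'rV[R]_n -> W => f v) dc).
apply: diff_eq_near; last exact: differentiable_comp.
have oA := chart_preimage_open (c := c) (chart_open_dom d).
near=> x.
have [_ dx] : (chart_cod c `&` chart_inv c @^-1` chart_dom d) x.
  by near: x; apply: open_nbhs_nbhs; split=> //; exact: chart_inv_transition.
by rewrite /= chart_funK.
Unshelve. all: by end_near. Qed.

Lemma diff_chart_id c p v : chart_dom c p -> 'd (c \o chart_inv c) (c p) v = v.
Proof.
move=> cp.
have [di diE] : differentiable (id : 'rV[R]_n -> 'rV[R]_n) (c p) /\
    ('d id (c p) : 'rV[R]_n -> 'rV[R]_n) = id by split=> //; exact: diff_val.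
apply: etrans (congr1 (fun f : 'rV[R]_n -> 'rV[R]_n => f v) diE).
apply: diff_eq_near di; near=> x; rewrite /= chart_invK //.
by near: x; apply: open_nbhs_nbhs; split;
  [exact: chart_open_cod | exact: chart_funS].
Unshelve. all: by end_near. Qed.

Lemma vcoord_at p v : vcoord (chart_at p) p v = v.
Proof. exact: diff_chart_id. Qed.

Lemma vcoord_change c d p v : atlas c -> atlas d ->
  chart_dom c p -> chart_dom d p ->
  'd (d \o chart_inv c) (c p) (vcoord c p v) = vcoord d p v.
Proof.
move=> ac ad cp dp; apply/esym/diff_chart_change => //.
exact: transition_differentiable.
Qed.

Lemma tvec_vcoord c p v : atlas c -> chart_dom c p -> tvec c p (vcoord c p v) = v.
Proof. by move=> ac cp; rewrite /tvec vcoord_change ?vcoord_at. Qed.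

Lemma dfun_chart c u p v : atlas c -> chart_dom c p -> smooth_fun u ->
  dfun u p v = 'd (u \o chart_inv c) (c p) (vcoord c p v).
Proof.
move=> ac cp su; apply: diff_chart_change => //.
by apply: (smooth_on_differentiable (su c ac)); exact: chart_funS.
Qed.

Lemma smooth_fun_differentiable u p : smooth_fun u ->
  differentiable (u \o chart_inv (chart_at p)) (chart_at p p).
Proof.
by move=> su; apply: (smooth_on_differentiable (su _ _)) => //; exact: chart_funS.
Qed.

Lemma smooth_vf_differentiable X p : smooth_vf X ->
  differentiable (vf_local (chart_at p) X) (chart_at p p).
Proof.
by move=> sX; apply: (smooth_on_differentiable (sX _ _)) => //; exact: chart_funS.
Qed.

Lemma smooth_fun_cst (a : R) : smooth_fun (fun _ : M => a).
Proof. by move=> c ac; exact: smooth_on_cst. Qed.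

Lemma smooth_fun_add u v : smooth_fun u -> smooth_fun v ->
  smooth_fun (fun p => u p + v p).
Proof.
move=> su sv c ac; apply: (smooth_on_add _ (su c ac) (sv c ac)).
exact: chart_open_cod.
Qed.

Lemma smooth_fun_mul u v : smooth_fun u -> smooth_fun v ->
  smooth_fun (fun p => u p * v p).
Proof.
move=> su sv c ac; apply: (smooth_on_mul _ (su c ac) (sv c ac)).
exact: chart_open_cod.
Qed.

Lemma smooth_fun_sum (I : Type) (r : seq I) (f : I -> M -> R) :
  (forall i, smooth_fun (f i)) -> smooth_fun (fun p => \sum_(i <- r) f i p).
Proof.
move=> sf c ac; have oc : open (chart_cod c) by exact: chart_open_cod.
exact: (@smooth_on_sum _ _ _ _ _ r (fun i => f i \o chart_inv c) oc
  (fun i => sf i c ac)).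
Qed.

Lemma smooth_fun_expR u : smooth_fun u -> smooth_fun (fun p => expR (u p)).
Proof.
by move=> su c ac; apply: (smooth_on_expR _ (su c ac)); exact: chart_open_cod.
Qed.

Lemma smooth_vf_lin u X Y : smooth_fun u -> smooth_vf X -> smooth_vf Y ->
  smooth_vf (fun p => u p *: X p + Y p).
Proof.
move=> su sX sY c ac; have oc : open (chart_cod c) by exact: chart_open_cod.
apply: smooth_on_eq (smooth_on_add oc (smooth_on_scale oc (su c ac) (sX c ac)) (sY c ac)).
  exact: oc.
by move=> x _; rewrite /vf_local /vcoord linearP.
Qed.

Lemma smooth_vf0 : smooth_vf (fun _ : M => 0).
Proof.
move=> c ac; have -> : vf_local c (fun=> 0) = fun=> 0.
  by apply/funext => x; rewrite /vf_local /vcoord linear0.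
exact: smooth_on_cst.
Qed.

Lemma smooth_vf_add X Y : smooth_vf X -> smooth_vf Y ->
  smooth_vf (fun p => X p + Y p).
Proof.
move=> sX sY; have := smooth_vf_lin (smooth_fun_cst 1) sX sY.
by under eq_fun do rewrite scale1r.
Qed.

Lemma smooth_vf_scale u X : smooth_fun u -> smooth_vf X ->
  smooth_vf (fun p => u p *: X p).
Proof.
move=> su sX; have := smooth_vf_lin su sX smooth_vf0.
by under eq_fun do rewrite addr0.
Qed.

Lemma smooth_vf_sum (I : Type) (r : seq I) (F : I -> vfield M) :
  (forall i, smooth_vf (F i)) -> smooth_vf (fun p => \sum_(i <- r) F i p).
Proof.
move=> sF; elim: r => [|i r IH].
  by under eq_fun do rewrite big_nil; exact: smooth_vf0.
by under eq_fun do rewrite big_cons; exact: smooth_vf_add.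
Qed.

Lemma vf_local_app c X u x : atlas c -> chart_cod c x -> smooth_fun u ->
  vf_app X u (chart_inv c x) = 'd (u \o chart_inv c) x (vf_local c X x).
Proof.
move=> ac cx su; rewrite /vf_app (@dfun_chart c) ?chart_invK //.
exact: chart_invS.
Qed.

Lemma vf_app_smooth X u : smooth_vf X -> smooth_fun u -> smooth_fun (vf_app X u).
Proof.
move=> sX su c ac; have oc : open (chart_cod c) by exact: chart_open_cod.
apply: smooth_on_eq (smooth_on_apply oc (su c ac) (sX c ac)) => //.
by move=> x cx; rewrite /= vf_local_app.
Qed.

Lemma vf_app_lin (a : R) X Y u p V : V p = a *: X p + Y p ->
  vf_app V u p = a * vf_app X u p + vf_app Y u p.
Proof. by move=> E; rewrite /vf_app /dfun E linearP. Qed.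

Lemma vf_app_sum (I : Type) (r : seq I) (a : I -> R) (F : I -> vfield M) u p V :
  V p = \sum_(i <- r) a i *: F i p ->
  vf_app V u p = \sum_(i <- r) a i * vf_app (F i) u p.
Proof.
move=> E; rewrite /vf_app /dfun E linear_sum /=.
by apply: eq_bigr => i _; rewrite linearZ.
Qed.

Lemma vf_app_cst X (a : R) p : vf_app X (fun=> a) p = 0.
Proof. exact: (diff_const (a : R^o) _).2. Qed.

Lemma vf_app_add X u v p : smooth_fun u -> smooth_fun v ->
  vf_app X (fun q => u q + v q) p = vf_app X u p + vf_app X v p.
Proof.
move=> su sv.
exact: (diff_add (smooth_fun_differentiable p su) (smooth_fun_differentiable p sv)).2.
Qed.

Lemma vf_app_mul X u v p : smooth_fun u -> smooth_fun v ->
  vf_app X (fun q => u q * v q) p = vf_app X u p * v p + u p * vf_app X v p.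
Proof.
move=> su sv.
have := (diff_scale (W := R^o) (smooth_fun_differentiable p su)
  (smooth_fun_differentiable p sv)).2 (X p).
by rewrite /= !chart_funK.
Qed.

Lemma vf_app_sumr (I : Type) (r : seq I) X (f : I -> M -> R) p :
  (forall i, smooth_fun (f i)) ->
  vf_app X (fun q => \sum_(i <- r) f i q) p = \sum_(i <- r) vf_app X (f i) p.
Proof.
move=> sf; elim: r => [|i r IH].
  by under eq_fun do rewrite big_nil; rewrite big_nil vf_app_cst.
under eq_fun do rewrite big_cons; rewrite big_cons -IH vf_app_add //.
exact: smooth_fun_sum.
Qed.

Lemma vf_app_expR X u p : smooth_fun u ->
  vf_app X (fun q => expR (u q)) p = expR (u p) * vf_app X u p.
Proof.
move=> su; have := (diff_expR_comp (smooth_fun_differentiable p su)).2 (X p).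
by rewrite /= !chart_funK.
Qed.

Lemma lie_bracket_anti X Y p : lie_bracket X Y p = - lie_bracket Y X p.
Proof. by rewrite /lie_bracket opprB. Qed.

Lemma lie_bracket_local X Y p : lie_bracket X Y p =
  local_bracket (vf_local (chart_at p) X) (vf_local (chart_at p) Y) (chart_at p p).
Proof.
by rewrite /lie_bracket /local_bracket /vf_local chart_funK // !vcoord_at.
Qed.

(** The bracket at [p] is taken in the single chart [chart_at p], where this is
   the product rule. *)
Lemma lie_bracket_linr X u Y Z p : smooth_fun u -> smooth_vf Y -> smooth_vf Z ->
  lie_bracket X (fun q => u q *: Y q + Z q) p =
  vf_app X u p *: Y p + u p *: lie_bracket X Y p + lie_bracket X Z p.
Proof.
move=> su sY sZ; pose c := chart_at p.
have du := smooth_fun_differentiable p su.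
have dY := smooth_vf_differentiable p sY.
have dZ := smooth_vf_differentiable p sZ.
have E : vf_local c (fun q => u q *: Y q + Z q) =
    fun x => (u \o chart_inv c) x *: vf_local c Y x + vf_local c Z x.
  by apply/funext => x; rewrite /vf_local /vcoord linearP.
have [ds dsE] := diff_scale du dY.
have D := (diff_add ds dZ).2 (X p); have D1 := dsE (X p).
rewrite /lie_bracket E.
apply: etrans (congr1 (fun t => t - _) D) _.
apply: etrans (congr1 (fun t => t + _ - _) D1) _.
rewrite [in LHS]/= chart_funK //.
have -> : vf_local (chart_at p) Y (chart_at p p) = Y p.
  by rewrite /vf_local chart_funK // vcoord_at.
have L : 'd (vf_local c X) (c p) (u p *: Y p + Z p) =
    u p *: 'd (vf_local c X) (c p) (Y p) + 'd (vf_local c X) (c p) (Z p).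
  exact: linearP.
apply: etrans (congr1 (fun t => _ - t) L) _.
have alg (a b b' e e' : 'rV[R]_n) (k : R) :
    a + k *: b + e - (k *: b' + e') = a + k *: (b - b') + (e - e').
  by rewrite scalerBr opprD -!addrA; congr (_ + (_ + _)); rewrite addrCA.
exact: alg.
Qed.

Lemma lie_bracket0r X p : lie_bracket X (fun=> 0) p = 0.
Proof.
have := lie_bracket_linr X p (smooth_fun_cst 1) smooth_vf0 smooth_vf0.
have -> : (fun q : M => 1 *: 0 + 0) = (fun=> 0) :> vfield M.
  by apply/funext => q; rewrite scaler0 addr0.
rewrite scaler0 scale1r add0r => E.
by apply: (addrI (lie_bracket X (fun=> 0) p)); rewrite addr0 -E.
Qed.

Lemma lie_bracket_sumr (I : Type) (r : seq I) (a : I -> M -> R)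
    (F : I -> vfield M) X p :
  (forall i, smooth_fun (a i)) -> (forall i, smooth_vf (F i)) ->
  lie_bracket X (fun q => \sum_(i <- r) a i q *: F i q) p =
  \sum_(i <- r) (vf_app X (a i) p *: F i p + a i p *: lie_bracket X (F i) p).
Proof.
move=> sa sF; elim: r => [|i r IH].
  by under eq_fun do rewrite big_nil; rewrite big_nil lie_bracket0r.
rewrite big_cons -IH; under eq_fun do rewrite big_cons.
apply: lie_bracket_linr => //; apply: smooth_vf_sum => j.
exact: smooth_vf_scale.
Qed.

(** Applying a field to a smooth function commutes with reading it in a chart, so
   the identity is the one for open subsets of R^n. *)
Lemma vf_app_bracket X Y u p : smooth_vf X -> smooth_vf Y -> smooth_fun u ->
  vf_app (lie_bracket X Y) u p = vf_app X (vf_app Y u) p - vf_app Y (vf_app X u) p.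
Proof.
move=> sX sY su; pose c := chart_at p; have ac : atlas c by exact: atlas_at.
have oc : open (chart_cod c) by exact: chart_open_cod.
have cp : chart_cod c (c p) by apply: chart_funS; exact: dom_at.
have := local_bracket_derivation oc (su c ac) (sX c ac) (sY c ac) cp.
have key V W : smooth_vf V -> smooth_vf W ->
    'd (fun y => 'd (u \o chart_inv c) y (vf_local c W y)) (c p) (vf_local c V (c p))
    = vf_app V (vf_app W u) p.
  move=> sV sW; have VP : vf_local c V (c p) = V p.
    by rewrite /vf_local chart_funK ?vcoord_at //; exact: dom_at.
  rewrite VP; apply: (@diff_eq_near _ _ _ (vf_app W u \o chart_inv c)).
    near=> x; rewrite /= vf_local_app //.
    by near: x; exact: open_nbhs_nbhs.
  exact: smooth_fun_differentiable (vf_app_smooth sW su).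
move=> E; apply: etrans (congr2 (fun s t => s - t) (key X Y sX sY) (key Y X sY sX)).
by apply: etrans _ E; rewrite /vf_app lie_bracket_local.
Unshelve. all: by end_near. Qed.

Lemma mxform_linl (B : 'M[R]_n) (a : R) (u v w : 'rV[R]_n) :
  mxform B (a *: u + v) w = a * mxform B u w + mxform B v w.
Proof. by rewrite /mxform !mulmxDl -!scalemxAl mxE [X in X + _]mxE. Qed.

Lemma mxform_linr (B : 'M[R]_n) (a : R) (u v w : 'rV[R]_n) :
  mxform B w (a *: u + v) = a * mxform B w u + mxform B w v.
Proof.
by rewrite /mxform linearP /= mulmxDr -scalemxAr mxE [X in X + _]mxE.
Qed.

Lemma mxform0l (B : 'M[R]_n) (w : 'rV[R]_n) : mxform B 0 w = 0.
Proof. by rewrite /mxform !mul0mx mxE. Qed.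

Lemma mxform0r (B : 'M[R]_n) (w : 'rV[R]_n) : mxform B w 0 = 0.
Proof. by rewrite /mxform trmx0 mulmx0 mxE. Qed.

Lemma mxform_suml (I : Type) (r : seq I) (B : 'M[R]_n) (a : I -> R) (f : I -> 'rV[R]_n) w :
  mxform B (\sum_(i <- r) a i *: f i) w = \sum_(i <- r) a i * mxform B (f i) w.
Proof.
elim: r => [|i r IH]; first by rewrite !big_nil mxform0l.
by rewrite !big_cons mxform_linl IH.
Qed.

Lemma mxform_sumr (I : Type) (r : seq I) (B : 'M[R]_n) (a : I -> R) (f : I -> 'rV[R]_n) w :
  mxform B w (\sum_(i <- r) a i *: f i) = \sum_(i <- r) a i * mxform B w (f i).
Proof.
elim: r => [|i r IH]; first by rewrite !big_nil mxform0r.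
by rewrite !big_cons mxform_linr IH.
Qed.

Lemma mxform_sym (B : 'M[R]_n) (u v : 'rV[R]_n) : B^T = B -> mxform B u v = mxform B v u.
Proof.
move=> BT; have -> : mxform B u v = (u *m B *m v^T)^T 0 0 by rewrite mxE.
by rewrite !trmx_mul trmxK BT mulmxA.
Qed.

(** The smoothness of a metric is stated for the coordinate fields of a chart;
   bilinearity extends it to all smooth fields. *)
Lemma inner_smooth g X Y : riemannian_metric g -> smooth_vf X -> smooth_vf Y ->
  smooth_fun (inner g X Y).
Proof.
move=> [_ _ sg] sX sY c ac; have oc : open (chart_cod c) by exact: chart_open_cod.
pose G i j x := mxform (g (chart_inv c x)) (tvec c (chart_inv c x) (delta_mx 0 i))
  (tvec c (chart_inv c x) (delta_mx 0 j)).
apply: (@smooth_on_eq _ _ _ _ (fun x => \sum_i vf_local c X x 0 i *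
    (\sum_j vf_local c Y x 0 j * G i j x))) => //.
  move=> x cx; have dx : chart_dom c (chart_inv c x) by exact: chart_invS.
  have E Z : Z (chart_inv c x) = \sum_i vf_local c Z x 0 i *:
      tvec c (chart_inv c x) (delta_mx 0 i).
    rewrite -{1}(tvec_vcoord (Z (chart_inv c x)) ac dx) -/(vf_local c Z x).
    rewrite {1}[vf_local c Z x]row_sum_delta /tvec linear_sum.
    by apply: eq_bigr => i _; rewrite linearZ.
  rewrite /= /inner (E X) (E Y) mxform_suml.
  by apply: eq_bigr => i _; rewrite mxform_sumr.
apply: smooth_on_sum => // i; apply: smooth_on_mul => //.
  by apply: smooth_on_coord => //; exact: sX.
apply: smooth_on_sum => // j; apply: smooth_on_mul => //; last exact: sg.
by apply: smooth_on_coord => //; exact: sY.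
Qed.

End ManifoldCalculus.
#[global] Hint Resolve atlas_at dom_at : core.

(** * The Jacobi identity *)

Section Jacobi.
Context {R : realType} {n : nat}.
Implicit Types (V W Z : 'rV[R]_n -> 'rV[R]_n) (f : 'rV[R]_n -> R).

Lemma smooth_on_id (V : normedModType R) (A : set V) : smooth_on A (fun x => x).
Proof.
case=> [|k]; first by move=> x _; exact: cvg_id.
split=> [x _|v]; first exact: (ex_diff (f := id) (df := id)).
have -> : (fun x : V => 'd (fun y => y) x v) = fun=> v.
  apply/funext => x.
  exact: (congr1 (fun h : V -> V => h v) (diff_val (f := id) (df := id))).
exact: Ck_on_cst.
Qed.

Lemma smooth_on_lin (V W W' : normedModType R) (A : set V) (L : {linear W -> W'})
    (f : V -> W) : open A -> continuous L -> smooth_on A f ->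
  smooth_on A (fun x => L (f x)).
Proof. by move=> oA cL sf k; exact: Ck_on_lin. Qed.

Lemma smooth_on_opp (V W : normedModType R) (A : set V) (f : V -> W) : open A ->
  smooth_on A f -> smooth_on A (fun x => - f x).
Proof.
move=> oA sf; under eq_fun do rewrite -scaleN1r.
by apply: smooth_on_scale => //; exact: smooth_on_cst.
Qed.

Lemma local_bracket_smooth V W A : open A -> smooth_on A V -> smooth_on A W ->
  smooth_on A (local_bracket V W).
Proof.
move=> oA sV sW; apply: smooth_on_add => //; first exact: smooth_on_apply.
by apply: smooth_on_opp => //; exact: smooth_on_apply.
Qed.

(** Brackets are commutators of derivations of the algebra of functions, where
   the identity is formal; the coordinate functions detect the fields. *)
Lemma local_jacobi V W Z A x : open A ->
  smooth_on A V -> smooth_on A W -> smooth_on A Z -> A x ->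
  local_bracket V (local_bracket W Z) x + local_bracket W (local_bracket Z V) x +
  local_bracket Z (local_bracket V W) x = 0.
Proof.
move=> oA sV sW sZ Ax; apply/rowP => j.
pose f := @rcoord R n j.
have cf : continuous f by exact: (@linear_cts R n R f).
have sf : smooth_on A f := smooth_on_lin oA cf (@smooth_on_id _ A).
have dfE (B : 'rV[R]_n) : 'd f x B = B 0 j.
  exact: (congr1 (fun h : 'rV[R]_n -> R => h B) (diff_linear x cf).2).
pose D (X : 'rV[R]_n -> 'rV[R]_n) (h : 'rV[R]_n -> R) y := 'd h y (X y).
have sD X h : smooth_on A X -> smooth_on A h -> smooth_on A (D X h).
  by move=> sX sh; exact: smooth_on_apply.
have key X Y T : smooth_on A X -> smooth_on A Y -> smooth_on A T ->
    local_bracket X (local_bracket Y T) x 0 j =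
    D X (D Y (D T f)) x - D X (D T (D Y f)) x -
    (D Y (D T (D X f)) x - D T (D Y (D X f)) x).
  move=> sX sY sT; have sB := local_bracket_smooth oA sY sT.
  rewrite -dfE (local_bracket_derivation oA sf sX sB Ax).
  have E2 : 'd (D X f) x (local_bracket Y T x) =
      D Y (D T (D X f)) x - D T (D Y (D X f)) x.
    by apply: (local_bracket_derivation oA _ sY sT Ax); exact: sD.
  apply: etrans (congr1 (fun t => _ - t) E2) _; congr (_ - _).
  have dE h : smooth_on A h -> differentiable h x.
    by move=> sh; exact: smooth_on_differentiable sh Ax.
  have d1 : differentiable (D Y (D T f)) x := dE _ _ (sD _ _ sY (sD _ _ sT sf)).
  have d2 : differentiable (D T (D Y f)) x := dE _ _ (sD _ _ sT (sD _ _ sY sf)).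
  have [d3 d3E] := diff_scale (diff_const (-1 : R^o) x).1 d2.
  have [d4 d4E] := diff_add d1 d3.
  have E4 := d4E (X x); have E3 := d3E (X x).
  have E0 := (diff_const (V := 'rV[R]_n) (-1 : R^o) x).2 (X x).
  have := diff_eq_near (f := fun y => D Y (D T f) y + (-1 : R) *: (D T (D Y f) y : R^o))
    (g := fun y => 'd f y (local_bracket Y T y)) (X x) _ d4.
  move=> ->; last first.
    near=> y; rewrite (local_bracket_derivation oA sf sY sT); last first.
      by near: y; exact: open_nbhs_nbhs.
    by rewrite scaleN1r.
  apply: etrans E4 _; apply: etrans (congr1 (fun t => _ + t) E3) _.
  apply: etrans (congr1 (fun t => _ + (t *: _ + _)) E0) _.
  by rewrite scale0r add0r scaleN1r.
have E (a b c : 'rV[R]_n) : (a + b + c) 0 j = a 0 j + b 0 j + c 0 j by rewrite !mxE.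
apply: etrans (E _ _ _) _; rewrite [RHS]mxE.
apply: etrans (congr2 +%R (congr2 +%R (key V W Z sV sW sZ) (key W Z V sW sZ sV))
  (key Z V W sZ sV sW)) _.
have alg (a b c d e h : R) :
  a - b - (c - d) + (c - e - (h - b)) + (h - d - (a - e)) = 0 by ring.
exact: alg.
Unshelve. all: by end_near. Qed.

End Jacobi.

(** * Tangent maps and left-invariant fields *)

Section TangentMaps.
Context {R : realType} {m n : nat} {M : manifoldType R m} {N : manifoldType R n}.

Lemma smooth_map_differentiable (F : M -> N) p (c : chart R m M) (d : chart R n N) :
  smooth_map F -> atlas c -> atlas d -> chart_dom c p -> chart_dom d (F p) ->
  differentiable (d \o F \o chart_inv c) (c p).
Proof.
move=> [_ sF] ac ad cp dFp; apply: (smooth_on_differentiable (sF c d ac ad)).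
by split; [exact: chart_funS | rewrite /= chart_funK].
Qed.

(** The tangent map is defined in the preferred charts; the chain rule gives its
   expression in any pair of charts. *)
Lemma tangent_map_chart (F : M -> N) p (c : chart R m M) (d : chart R n N) v :
  smooth_map F -> atlas c -> atlas d -> chart_dom c p -> chart_dom d (F p) ->
  vcoord d (F p) (tangent_map F p v) =
  'd (d \o F \o chart_inv c) (c p) (vcoord c p v).
Proof.
move=> sF ac ad cp dFp.
have D := smooth_map_differentiable sF ac ad cp dFp.
have E1 := diff_chart_change (h := d \o F) v (atlas_at p) ac (dom_at p) cp D.
apply: etrans _ E1; rewrite /vcoord /tangent_map.
have dF : differentiable (chart_at (F p) \o F \o chart_inv (chart_at p)) (chart_at p p).
  by apply: smooth_map_differentiable => //; exact: dom_at.
have E0 : (chart_at (F p) \o F \o chart_inv (chart_at p)) (chart_at p p) = chart_at (F p) (F p).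
  by rewrite /= chart_funK.
have dd : differentiable (d \o chart_inv (chart_at (F p)))
    ((chart_at (F p) \o F \o chart_inv (chart_at p)) (chart_at p p)).
  by rewrite E0; apply: transition_differentiable => //; exact: dom_at.
have C := diff_comp dF dd; rewrite E0 in C.
apply: etrans (esym (congr1 (fun f : 'rV[R]_m -> 'rV[R]_n => f v) C)) _.
apply/esym/diff_eq_near; last exact: differentiable_comp.
have cF := sF.1.
have oA := chart_preimage_open (c := chart_at p) (B := F @^-1` chart_dom (chart_at (F p))) _.
near=> x.
suff : (chart_cod (chart_at p) `&` chart_inv (chart_at p) @^-1`
    (F @^-1` chart_dom (chart_at (F p)))) x by move=> [_ /= ex]; rewrite /= chart_funK.
near: x; apply: open_nbhs_nbhs; split.
  by apply: oA; apply: open_comp; [move=> q _; exact: cF | exact: chart_open_dom].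
split; first by apply: chart_funS; exact: dom_at.
by rewrite /= chart_funK.
Unshelve. all: by end_near. Qed.

End TangentMaps.

Section LeftInvariantFields.
Context {R : realType} {n : nat} {G : lieGroupType R n}.
Implicit Types (p q a : G) (c d : chart R n G) (v w : 'rV[R]_n).

Local Notation e0 := (chart_at (1%g : G)).
Local Notation E1 := (e0 1%g).

Fact row_mx0_is_linear : linear (fun x : 'rV[R]_n => row_mx x (0 : 'rV[R]_n)).
Proof. by move=> a x y; rewrite scale_row_mx add_row_mx scaler0 addr0. Qed.
Fact row_0mx_is_linear : linear (fun x : 'rV[R]_n => row_mx (0 : 'rV[R]_n) x).
Proof. by move=> a x y; rewrite scale_row_mx add_row_mx scaler0 addr0. Qed.

Definition row_inl : {linear 'rV[R]_n -> 'rV[R]_(n + n)} :=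
  HB.pack (fun x : 'rV[R]_n => row_mx x (0 : 'rV[R]_n))
    (GRing.isLinear.Build _ _ _ _ _ row_mx0_is_linear).
Definition row_inr : {linear 'rV[R]_n -> 'rV[R]_(n + n)} :=
  HB.pack (fun x : 'rV[R]_n => row_mx (0 : 'rV[R]_n) x)
    (GRing.isLinear.Build _ _ _ _ _ row_0mx_is_linear).

Lemma row_mx_inlr (x y : 'rV[R]_n) : row_mx x y = row_inl x + row_inr y.
Proof. by rewrite /= add_row_mx addr0 add0r. Qed.

Definition mul_chart c1 c2 d (z : 'rV[R]_(n + n)) : 'rV[R]_n :=
  d (chart_inv c1 (lsubmx z) * chart_inv c2 (rsubmx z))%g.

Definition mul_chart_dom c1 c2 d : set 'rV[R]_(n + n) :=
  [set z | [/\ chart_cod c1 (lsubmx z), chart_cod c2 (rsubmx z) &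
    chart_dom d (chart_inv c1 (lsubmx z) * chart_inv c2 (rsubmx z))%g]].

Lemma mul_chart_smooth c1 c2 d : atlas c1 -> atlas c2 -> atlas d ->
  smooth_on (mul_chart_dom c1 c2 d) (mul_chart c1 c2 d).
Proof.
move=> a1 a2 ad; have [_ /(_ c1 c2 d a1 a2 ad) /= s] := @mulg_smooth R n G.
by apply: smooth_on_sub s => z [].
Qed.

Lemma mulg_cts : continuous (fun x : G * G => (x.1 * x.2)%g).
Proof. exact: (@mulg_smooth R n G).1. Qed.

Lemma left_translation_cts a : continuous (@left_translation R n G a).
Proof.
move=> p; apply: (@continuous_comp _ _ _ (fun q : G => (a, q)) (fun x : G * G => (x.1 * x.2)%g)).
  by apply: cvg_pair; [exact: cvg_cst | exact: cvg_id].
exact: mulg_cts.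
Qed.

(** In charts, a left translation is the multiplication with its first argument
   held constant. *)
Lemma left_translation_smooth a : smooth_map (@left_translation R n G a).
Proof.
split=> [|c d ac ad]; first exact: left_translation_cts.
pose ca := chart_at a.
have oA : open (chart_cod c `&` chart_inv c @^-1` (left_translation a @^-1` chart_dom d)).
  apply: chart_preimage_open; apply: open_comp; last exact: chart_open_dom.
  by move=> q _; exact: left_translation_cts.
apply: (@smooth_on_eq _ _ _ _ (fun x => mul_chart ca c d (row_mx (ca a) x))) => //.
  move=> x _; rewrite /mul_chart row_mxKl row_mxKr chart_funK //; exact: dom_at.
apply: smooth_on_comp (mul_chart_smooth (atlas_at a) ac ad) => //.
  move=> x [cx dx]; split; rewrite ?row_mxKl ?row_mxKr //.
    by apply: chart_funS; exact: dom_at.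
  by rewrite chart_funK //; exact: dom_at.
apply: (@smooth_on_eq _ _ _ _ (fun x => row_inl (ca a) + row_inr x)) => //.
  by move=> x _; rewrite row_mx_inlr.
apply: smooth_on_add => //; first exact: smooth_on_cst.
exact: (smooth_on_lin oA (@linear_cts R n _ row_inr) (@smooth_on_id R _ _)).
Qed.

Lemma vcoord_inj c p v w : atlas c -> chart_dom c p ->
  vcoord c p v = vcoord c p w -> v = w.
Proof. by move=> ac cp E; rewrite -(tvec_vcoord v ac cp) E tvec_vcoord. Qed.

Lemma vcoord_left_vf c p v : atlas c -> chart_dom c p ->
  vcoord c p (left_vf v p) =
  'd (c \o left_translation p \o chart_inv e0) E1 v.
Proof.
move=> ac cp; have p1 : left_translation p (1%g : G) = p by exact: mulg1.
have := tangent_map_chart (F := left_translation p) (p := 1%g) (c := e0) (d := c) v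
  (left_translation_smooth p) (atlas_at _) ac (dom_at _) _.
by rewrite p1 vcoord_at; exact.
Qed.

Lemma left_vf_left_invariant v : forall a p,
  tangent_map (left_translation a) p (left_vf v p) =
  left_vf v (left_translation a p).
Proof.
move=> a p; pose c := chart_at p; pose d := chart_at (left_translation a p).
apply: (@vcoord_inj d (left_translation a p)); [exact: atlas_at | exact: dom_at |].
have L1 := vcoord_left_vf v (atlas_at (left_translation a p)) (dom_at _).
apply: etrans _ (esym L1).
have sa := left_translation_smooth a.
have T := tangent_map_chart (left_vf v p) sa (atlas_at p)
  (atlas_at (left_translation a p)) (dom_at p) (dom_at _).
apply: etrans T _; rewrite (vcoord_left_vf v (atlas_at p) (dom_at p)).
have p1 : left_translation p (1%g : G) = p by exact: mulg1.
have dp : differentiable (chart_at p \o left_translation p \o chart_inv e0) E1.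
  apply: smooth_map_differentiable => //; first exact: left_translation_smooth.
    exact: dom_at.
  by rewrite p1; exact: dom_at.
have E0 : (c \o left_translation p \o chart_inv e0) E1 = c p.
  by rewrite /= chart_funK ?p1 //; exact: dom_at.
have da : differentiable (d \o left_translation a \o chart_inv c)
    ((c \o left_translation p \o chart_inv e0) E1).
  by rewrite E0; apply: smooth_map_differentiable => //; first [exact: atlas_at | exact: dom_at].
have C := diff_comp dp da; rewrite E0 in C.
apply: etrans (esym (congr1 (fun f : 'rV[R]_n -> 'rV[R]_n => f v) C)) _.
apply/esym/diff_eq_near; last exact: differentiable_comp.
near=> x.
suff : (chart_cod e0 `&` chart_inv e0 @^-1` (left_translation p @^-1` chart_dom c)) x.
  move=> [_ /= cx]; rewrite /= chart_funK //.
  by congr (d _); exact: mulgA.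
near: x; apply: open_nbhs_nbhs; split.
  apply: chart_preimage_open; apply: open_comp; last exact: chart_open_dom.
  by move=> q _; exact: left_translation_cts.
split; first by apply: chart_funS; exact: dom_at.
by rewrite /= chart_funK ?p1 //; exact: dom_at.
Unshelve. all: by end_near. Qed.

Lemma left_vf1 v : left_vf v (1%g : G) = v.
Proof.
rewrite -[LHS](vcoord_at (1%g : G)) (vcoord_left_vf v (atlas_at _) (dom_at _)).
have -> : left_translation (1%g : G) = id by apply/funext => q; exact: mul1g.
by apply: diff_chart_id; exact: dom_at.
Qed.

(** In charts, [left_vf v] is the derivative of the multiplication with respect
   to its second argument, at the unit, in the direction [v]; it is as smooth as the
   multiplication. *)
Lemma left_vf_smooth v : smooth_vf (left_vf v : vfield G).
Proof.
move=> c ac; have oc : open (chart_cod c) by exact: chart_open_cod.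
pose F := mul_chart c e0 c; pose A := mul_chart_dom c e0 c.
have sF := mul_chart_smooth ac (atlas_at (1%g : G)) ac.
have inA x : chart_cod c x -> A (row_mx x E1).
  move=> cx; split; rewrite ?row_mxKl ?row_mxKr //.
    by apply: chart_funS; exact: dom_at.
  by rewrite chart_funK ?mulg1 //; first [exact: chart_invS | exact: dom_at].
apply: (@smooth_on_eq _ _ _ _ (fun x => 'd F (row_mx x E1) (row_inr v))) => //.
  move=> x cx; rewrite /vf_local vcoord_left_vf //; last exact: chart_invS.
  have [dc dcE] := diff_const (V := 'rV[R]_n) (row_inl x) E1.
  have [dr drE] := diff_lincomp (V := 'rV[R]_n) (f := id) (x := E1)
    (@linear_cts R n _ row_inr) (ex_diff (f := id) (df := id)).
  have [da daE] := diff_add dc dr.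
  have Er : row_inl x + row_inr E1 = row_mx x E1 by rewrite row_mx_inlr.
  have dF : differentiable F (row_inl x + row_inr E1).
    by rewrite Er; exact: (smooth_on_differentiable sF (inA x cx)).
  have C := congr1 (fun f : 'rV[R]_n -> 'rV[R]_n => f v) (diff_comp da dF).
  have -> : c \o left_translation (chart_inv c x) \o chart_inv e0 =
      F \o (fun y => row_inl x + row_inr y).
    by apply/funext => y; rewrite /F /mul_chart /= -row_mx_inlr row_mxKl row_mxKr.
  apply: etrans _ (esym C); rewrite -Er.
  apply: (congr1 ('d F _)).
  apply: esym; apply: etrans (daE v) _.
  apply: etrans (congr2 +%R (dcE v) (drE v)) _; rewrite add0r.
  congr (row_inr _).
  exact: (congr1 (fun h : 'rV[R]_n -> 'rV[R]_n => h v) (diff_val (f := id) (df := id))).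
apply: (smooth_on_comp (f := fun x => row_mx x E1)
   (h := fun z => 'd F z (row_inr v)) oc inA); last exact: smooth_on_diff.
apply: (@smooth_on_eq _ _ _ _ (fun x => row_inl x + row_inr E1)) => //.
  by move=> x _; rewrite row_mx_inlr.
apply: smooth_on_add => //; last exact: smooth_on_cst.
exact: (smooth_on_lin oc (@linear_cts R n _ row_inl) (@smooth_on_id R _ _)).
Qed.

Lemma left_vf_linv v : left_invariant_vf (left_vf v : vfield G).
Proof. by split; [exact: left_vf_smooth | exact: left_vf_left_invariant]. Qed.

Lemma left_invariant_vfE (X : vfield G) : left_invariant_vf X -> X = left_vf (X 1%g).
Proof.
move=> [_ LX]; apply/funext => p; rewrite /left_vf LX.
by congr X; exact/esym/mulg1.
Qed.

Lemma left_vf_sum (I : Type) (r : seq I) (a : I -> R) (f : I -> 'rV[R]_n) p :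
  left_vf (\sum_(i <- r) a i *: f i) p = \sum_(i <- r) a i *: left_vf (f i) p.
Proof.
rewrite /left_vf /tangent_map linear_sum.
by apply: eq_bigr => i _; rewrite linearZ.
Qed.

End LeftInvariantFields.

(** * The Lie algebra *)

Section LieAlgebra.
Context {R : realType} {n : nat} {G : lieGroupType R n}.
Implicit Types (p q : G) (c : chart R n G) (u v w : 'rV[R]_n).

Local Notation e0 := (chart_at (1%g : G)).
Local Notation E1 := (e0 1%g).

(** The bracket of the Lie algebra, carried to the tangent space at the unit. *)
Definition lbr v w : 'rV[R]_n := lie_bracket (left_vf v : vfield G) (left_vf w) 1%g.

Lemma left_vf_related c p v y : atlas c -> chart_cod e0 y ->
  chart_dom c (p * chart_inv e0 y)%g ->
  vf_local c (left_vf v) ((c \o left_translation p \o chart_inv e0) y) =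
  'd (c \o left_translation p \o chart_inv e0) y (vf_local e0 (left_vf v) y).
Proof.
move=> ac yc dc; rewrite /vf_local /= chart_funK // -left_vf_left_invariant.
have T := tangent_map_chart (left_vf v (chart_inv e0 y))
  (left_translation_smooth p) (atlas_at _) ac (chart_invS yc) dc.
by apply: etrans T _; rewrite chart_invK.
Qed.

(** The left translation by [p] relates left-invariant fields to themselves, and
   brackets are natural.  The chart [c] is arbitrary because the Jacobi identity
   needs the brackets on a whole chart domain, not only in preferred charts. *)
Lemma local_bracket_left_vf c p v w : atlas c -> chart_dom c p ->
  local_bracket (vf_local c (left_vf v)) (vf_local c (left_vf w)) (c p) =
  vcoord c p (left_vf (lbr v w) p).
Proof.
move=> ac cp; pose F := c \o left_translation p \o chart_inv e0.
pose A := chart_cod e0 `&` (left_translation p \o chart_inv e0) @^-1` chart_dom c.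
have p1 : left_translation p (1%g : G) = p by exact: mulg1.
have oA : open A.
  apply: (chart_preimage_open (B := left_translation p @^-1` chart_dom c)).
  apply: open_comp; last exact: chart_open_dom.
  by move=> q _; exact: left_translation_cts.
have sF : smooth_on A F.
  by have [_ s] := left_translation_smooth p; apply: s => //; exact: atlas_at.
have AE : A E1.
  split; first by apply: chart_funS; exact: dom_at.
  by rewrite /= chart_funK ?p1 //; exact: dom_at.
have FE : F E1 = c p by rewrite /F /= chart_funK ?p1 //; exact: dom_at.
have sA x : smooth_on A (vf_local e0 (left_vf x)).
  apply: (smooth_on_sub (B := chart_cod e0)); first by move=> y [].
  by apply: left_vf_smooth; exact: atlas_at.
have dc x : differentiable (vf_local c (left_vf x)) (F E1).
  rewrite FE; apply: (smooth_on_differentiable (left_vf_smooth x ac)).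
  exact: chart_funS.
have rel x y : A y -> vf_local c (left_vf x) (F y) = 'd F y (vf_local e0 (left_vf x) y).
  by move=> [cy dy]; exact: left_vf_related.
have := local_bracket_related oA sF (sA v) (sA w) AE (dc v) (dc w) (rel v) (rel w).
rewrite FE => ->; rewrite (vcoord_left_vf _ ac cp).
by congr ('d F _ _); rewrite /lbr lie_bracket_local.
Qed.

Lemma lie_bracket_left_vf v w p :
  lie_bracket (left_vf v : vfield G) (left_vf w) p = left_vf (lbr v w) p.
Proof.
rewrite lie_bracket_local (local_bracket_left_vf v w (atlas_at p) (dom_at p)).
exact: vcoord_at.
Qed.

Lemma lbr_anti v w : lbr v w = - lbr w v.
Proof. exact: lie_bracket_anti. Qed.

(** The Jacobi identity in the chart at the unit; the inner brackets are
   differentiated there, hence have to be known near the unit. *)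
Lemma lbr_jacobi u v w :
  lbr u (lbr v w) + lbr v (lbr w u) + lbr w (lbr u v) = 0.
Proof.
have oc : open (chart_cod e0) by exact: chart_open_cod.
have cE : chart_cod e0 E1 by apply: chart_funS; exact: dom_at.
have sl x : smooth_on (chart_cod e0) (vf_local e0 (left_vf x)).
  by apply: left_vf_smooth; exact: atlas_at.
have inner_bracket x y z : local_bracket (vf_local e0 (left_vf x))
    (local_bracket (vf_local e0 (left_vf y)) (vf_local e0 (left_vf z))) E1 =
    lbr x (lbr y z).
  have E t : chart_cod e0 t ->
      local_bracket (vf_local e0 (left_vf y)) (vf_local e0 (left_vf z)) t =
      vf_local e0 (left_vf (lbr y z)) t.
    move=> ct; have := local_bracket_left_vf y z (atlas_at (1%g : G)) (chart_invS ct).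
    by rewrite chart_invK.
  rewrite /lbr lie_bracket_local -/(lbr y z) /local_bracket.
  have E' := E _ cE; rewrite /local_bracket in E'.
  apply: etrans (congr1 (fun b => _ - 'd _ _ b) E') _.
  apply: (congr1 (fun b => b - _)).
  apply: (@diff_eq_near _ _ _ (vf_local e0 (left_vf (lbr y z)))).
    by near=> t; apply: esym; apply: E; near: t; exact: open_nbhs_nbhs.
  exact: (smooth_on_differentiable (sl _) cE).
have := local_jacobi oc (sl u) (sl v) (sl w) cE.
by rewrite !inner_bracket.
Unshelve. all: by end_near. Qed.

End LieAlgebra.
Arguments lbr {R n} G v w.

(** * Orthonormal bases *)

Section Orthonormal.
Context {R : realType}.

Lemma mxform_block n (b x : R) (r w : 'rV[R]_n) (D : 'M[R]_n) :
  mxform (block_mx b%:M r r^T D) (row_mx x%:M w) (row_mx x%:M w) =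
  x * x * b + 2 * x * (r *m w^T) 0 0 + (w *m D *m w^T) 0 0.
Proof.
rewrite /mxform mul_row_block tr_row_mx mul_row_col !mulmxDl.
have -> : w *m r^T *m (x%:M : 'M[R]_1)^T = x *: (r *m w^T)^T.
  by rewrite tr_scalar_mx mul_mx_scalar trmx_mul trmxK.
rewrite tr_scalar_mx -!scalar_mxM mul_scalar_mx -scalemxAl.
have E4 (a b' c d : 'M[R]_1) : (a + b' + (c + d)) 0 0 = a 0 0 + b' 0 0 + c 0 0 + d 0 0.
  by rewrite !mxE; ring.
rewrite E4; move: (r *m w^T) (w *m D *m w^T) => q d.
by rewrite !mxE eqxx mulr1n; ring.
Qed.

(** Cholesky factorization: eliminating the first coordinate leaves the Schur
   complement [S], which is again symmetric and positive definite. *)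
Lemma posdef_orthonormal n (B : 'M[R]_n) : B^T = B ->
  (forall v, v != 0 -> 0 < mxform B v v) -> exists P : 'M[R]_n, P *m B *m P^T = 1%:M.
Proof.
elim: n B => [|n IH] B BT Bpos.
  by exists 0; apply/matrixP => -[].
pose B' : 'M[R]_(1 + n) := B.
pose r := ursubmx B'; pose D := drsubmx B'; pose b := B' 0 0.
have bE : ulsubmx B' = b%:M.
  apply/matrixP => i j; rewrite !ord1 !mxE /b; congr (B _ _); exact: val_inj.
have rT : dlsubmx B' = r^T by rewrite /r trmx_ursub [B'^T]BT.
have DT : D^T = D by rewrite /D trmx_drsub [B'^T]BT.
have BE : B' = block_mx b%:M r r^T D by rewrite -bE -rT submxK.
have form x (w : 'rV_n) : mxform B' (row_mx x%:M w) (row_mx x%:M w) =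
    x * x * b + 2 * x * (r *m w^T) 0 0 + (w *m D *m w^T) 0 0.
  by rewrite BE; exact: mxform_block.
have b0 : 0 < b.
  have := Bpos (row_mx 1%:M 0); rewrite form trmx0 !mulmx0 !mxE !mulr0 !addr0 !mul1r.
  apply; apply/eqP => E; have := congr1 (@lsubmx R 1 1 n) E.
  rewrite row_mxKl linear0 => /matrixP/(_ 0 0).
  by rewrite !mxE => /eqP; rewrite oner_eq0.
pose S := D - b^-1 *: (r^T *m r).
have ST : S^T = S by rewrite /S linearB /= linearZ /= trmx_mul trmxK DT.
have Spos w : w != 0 -> 0 < mxform S w w.
  (* The form [B] at [(- t / b, w)], where it is minimal in the first
     coordinate, is the form [S] at [w]. *)
  move=> w0; pose t := (r *m w^T) 0 0.
  have := Bpos (row_mx (- b^-1 * t)%:M w).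
  have -> : mxform B (row_mx (- b^-1 * t)%:M w) (row_mx (- b^-1 * t)%:M w) = mxform S w w.
    rewrite form -/t /mxform /S mulmxBr mulmxBl.
    have -> : w *m (b^-1 *: (r^T *m r)) *m w^T = (b^-1 * t * t)%:M.
      have tE : r *m w^T = t%:M by rewrite [LHS]mx11_scalar.
      rewrite -scalemxAr -scalemxAl (mulmxA w) -(mulmxA _ r) tE.
      have -> : w *m r^T = t%:M by rewrite -(tr_scalar_mx 1 t) -tE trmx_mul trmxK.
      by rewrite -scalar_mxM scale_scalar_mx mulrA.
    rewrite [in RHS]mxE [X in _ = _ + X]mxE [X in _ = _ - X]mxE eqxx mulr1n.
    by field; rewrite gt_eqF.
  apply; apply: contra w0 => /eqP E; have := congr1 (@rsubmx R 1 1 n) E.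
  by rewrite row_mxKr linear0 => ->.
have [Q QE] := IH S ST Spos.
pose s := (Num.sqrt b)^-1.
have sb : s * b * s = 1.
  rewrite -[X in s * X * s](sqr_sqrtr (ltW b0)) /s; field.
  by rewrite gt_eqF // sqrtr_gt0.
exists (block_mx s%:M 0 (- b^-1 *: (Q *m r^T)) Q).
rewrite -/B' BE.
have -> : block_mx s%:M 0 (- b^-1 *: (Q *m r^T)) Q *m (block_mx b%:M r r^T D : 'M[R]_(1 + n))
   = block_mx (s * b)%:M (s *: r) 0 (Q *m S).
  rewrite [LHS]mulmx_block !mul0mx !addr0 -scalar_mxM mul_scalar_mx mul_mx_scalar.
  rewrite scalerA mulrN mulfV ?gt_eqF // scaleN1r addNr.
  by rewrite /S mulmxBr -scalemxAr -scalemxAl scaleNr mulmxA addrC.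
have TE : (block_mx s%:M 0 (- b^-1 *: (Q *m r^T)) Q)^T =
    block_mx s%:M (- b^-1 *: (r *m Q^T)) 0 Q^T.
  by rewrite tr_block_mx tr_scalar_mx trmx0 linearZ /= trmx_mul trmxK.
apply: etrans (congr1 (fun X => _ *m X) TE) _.
apply: etrans (@mulmx_block R 1 n 1 n 1 n (s * b)%:M (s *: r) 0 (Q *m S) s%:M
  (- b^-1 *: (r *m Q^T)) 0 Q^T) _.
rewrite !mul0mx !mulmx0 !add0r !addr0 QE -scalar_mxM sb.
rewrite -scalemxAr mul_scalar_mx -scalemxAl scalerA.
have -> : - b^-1 * (s * b) = - s by field; rewrite gt_eqF.
by rewrite scaleNr addNr; exact: (esym (scalar_mx_block 1 n 1)).
Qed.

Lemma mxform_row n (B P Q : 'M[R]_n) i j :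
  mxform B (row i P) (row j Q) = (P *m B *m Q^T) i j.
Proof.
rewrite /mxform -!row_mul mxE [LHS]mxE [RHS]mxE; apply: eq_bigr => k _.
by congr (_ * _); rewrite [LHS]mxE [LHS]mxE [RHS]mxE.
Qed.

Definition orthonormal_wrt n (B : 'M[R]_n) (e : 'I_n -> 'rV[R]_n) :=
  forall i j, mxform B (e i) (e j) = (i == j)%:R.

Lemma orthonormal_exists n (B : 'M[R]_n) : B^T = B ->
  (forall v, v != 0 -> 0 < mxform B v v) -> exists e, orthonormal_wrt B e.
Proof.
move=> BT Bpos; have [P PE] := posdef_orthonormal BT Bpos.
by exists (fun i => row i P) => i j; rewrite mxform_row PE mxE.
Qed.

Section OrthonormalBasis.
Context {n : nat} (B : 'M[R]_n) (e : 'I_n -> 'rV[R]_n) (eB : orthonormal_wrt B e).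

Let P := \matrix_i e i.

Let PB : P *m B *m P^T = 1%:M.
Proof. by apply/matrixP => i j; rewrite -mxform_row !rowK eB [RHS]mxE. Qed.

Let BP : B *m P^T *m P = 1%:M.
Proof. by apply: mulmx1C; rewrite mulmxA. Qed.

Lemma orthonormal_unit : B \in unitmx.
Proof. by move: BP; rewrite -mulmxA => /mulmx1_unit[]. Qed.

Lemma orthonormal_expand v : v = \sum_k mxform B v (e k) *: e k.
Proof.
rewrite -[LHS]mulmx1 -BP !mulmxA mulmx_sum_row; apply: eq_bigr => k _.
rewrite rowK; congr (_ *: _); rewrite /mxform [LHS]mxE [RHS]mxE.
by apply: eq_bigr => l _; rewrite !mxE.
Qed.

Lemma orthonormal_inj v w :
  (forall k, mxform B v (e k) = mxform B w (e k)) -> v = w.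
Proof.
by move=> E; rewrite [v]orthonormal_expand [w]orthonormal_expand; under eq_bigr do rewrite E.
Qed.

Lemma trend_orthonormal (A : 'rV[R]_n -> 'rV[R]_n) : linear A ->
  trend A = \sum_k mxform B (A (e k)) (e k).
Proof.
move=> linA; pose L : {linear 'rV[R]_n -> 'rV[R]_n} :=
  HB.pack A (GRing.isLinear.Build _ _ _ _ _ linA).
have AE v : A v = v *m lin1_mx A by rewrite (mul_rV_lin1 L).
rewrite /trend -[lin1_mx A]mulmx1 -BP !mulmxA mxtrace_mulC !mulmxA.
apply: eq_bigr => k _; have rk : row k P = e k := rowK e k.
by rewrite AE -rk -row_mul mxform_row.
Qed.

Lemma riesz_orthonormal (l : 'rV[R]_n -> R) v : linear_for *%R l ->
  mxform B (riesz B l) v = l v.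
Proof.
move=> linl; pose L : {linear 'rV[R]_n -> R^o} :=
  HB.pack l (GRing.isLinear.Build R 'rV[R]_n R^o *:%R l linl).
exact: (rieszP L v orthonormal_unit).
Qed.

End OrthonormalBasis.

End Orthonormal.

(** * The left-invariant orthonormal frame *)

Lemma sum_delta (R : pzRingType) n (F : 'I_n -> R) k : \sum_i F i * (i == k)%:R = F k.
Proof.
rewrite (bigD1 k) //= eqxx mulr1 big1 ?addr0 // => i /negbTE ->.
by rewrite mulr0.
Qed.

Section Frame.
Context {R : realType} {n : nat} {G : lieGroupType R n} (g : G -> 'M[R]_n)
  (e : 'I_n -> 'rV[R]_n).
Implicit Types (p q : G) (X Y Z : vfield G) (u : G -> R).

Definition frame i : vfield G := left_vf (e i).
Definition fderiv i u : G -> R := vf_app (frame i) u.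
Definition coef X k : G -> R := inner g X (frame k).
Definition struct_cst i j k : R := mxform (g 1%g) (lbr G (e i) (e j)) (e k).

Local Notation E := frame.
Local Notation D := fderiv.
Local Notation c := struct_cst.

Hypothesis hg : left_invariant_metric g.
Hypothesis he : orthonormal_wrt (g 1%g) e.

Lemma mxform_left_vf v w p :
  mxform (g p) (left_vf v p) (left_vf w p) = mxform (g 1%g) v w.
Proof.
have := hg.2 p 1%g v w; rewrite -[X in _ = X -> _]/(mxform (g 1%g) v w) => <-.
by have -> : left_translation p (1%g : G) = p by exact: mulg1.
Qed.

Lemma frame_orthonormal p : orthonormal_wrt (g p) (fun i => E i p).
Proof. by move=> i j; rewrite mxform_left_vf. Qed.

Lemma frame_smooth i : smooth_vf (E i). Proof. exact: left_vf_smooth. Qed.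
Hint Resolve frame_smooth : core.

(** Orthonormality of the frame gives the coefficients as inner products, whose
   smoothness is that of the metric. *)
Lemma coef_smooth X k : smooth_vf X -> smooth_fun (coef X k).
Proof. by move=> sX; apply: inner_smooth => //; exact: hg.1. Qed.

Lemma frame_expand X p : X p = \sum_k coef X k p *: E k p.
Proof. exact: (orthonormal_expand (frame_orthonormal p)). Qed.

Lemma frame_expand_fun X : X = fun p => \sum_k coef X k p *: E k p.
Proof. by apply/funext => p; exact: frame_expand. Qed.

Lemma coef_frame_sum X (a : 'I_n -> R) p k : X p = \sum_i a i *: E i p -> coef X k p = a k.
Proof.
move=> XE; rewrite /coef /inner XE mxform_suml.
under eq_bigr do rewrite (frame_orthonormal p).
exact: sum_delta.
Qed.

Lemma coef_frame i k p : coef (E i) k p = (i == k)%:R.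
Proof. exact: frame_orthonormal. Qed.

Lemma coef_lin (a : R) X Y Z k p : Z p = a *: X p + Y p ->
  coef Z k p = a * coef X k p + coef Y k p.
Proof. by move=> ZE; rewrite /coef /inner ZE mxform_linl. Qed.

Lemma vfield_eq X Y p : (forall k, coef X k p = coef Y k p) -> X p = Y p.
Proof. by move=> XY; rewrite frame_expand [RHS]frame_expand; under eq_bigr do rewrite XY. Qed.

Lemma vfield_ext X Y : (forall k p, coef X k p = coef Y k p) -> X = Y.
Proof. by move=> XY; apply/funext => p; apply: vfield_eq => k; exact: XY. Qed.

Lemma inner_coef X Y p : inner g X Y p = \sum_k coef X k p * coef Y k p.
Proof.
rewrite {1}/inner (frame_expand Y p) mxform_sumr.
by apply: eq_bigr => k _; rewrite mulrC.
Qed.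

Lemma vf_app_frame X u p : vf_app X u p = \sum_k coef X k p * D k u p.
Proof. by apply: vf_app_sum; exact: frame_expand. Qed.

Lemma lie_bracket_frame i j p : lie_bracket (E i) (E j) p = \sum_k c i j k *: E k p.
Proof.
rewrite lie_bracket_left_vf {1}(orthonormal_expand he (lbr G (e i) (e j))).
by rewrite left_vf_sum.
Qed.

Lemma struct_cst_anti i j k : c i j k = - c j i k.
Proof.
rewrite /c lbr_anti -scaleN1r -[X in mxform _ X]addr0 mxform_linl mxform0l addr0.
by rewrite mulN1r.
Qed.

Lemma fderiv_comm i j u p : smooth_fun u ->
  D i (D j u) p - D j (D i u) p = \sum_k c i j k * D k u p.
Proof.
move=> su; rewrite /D -vf_app_bracket //.
by apply: vf_app_sum; exact: lie_bracket_frame.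
Qed.

Lemma struct_cst_jacobi i j k m :
  \sum_l (c j k l * c i l m + c k i l * c j l m + c i j l * c k l m) = 0.
Proof.
have lbrE a b d : mxform (g 1%g) (lbr G (e a) (lbr G (e b) (e d))) (e m) =
    \sum_l c b d l * c a l m.
  have E1 : lie_bracket (E a) (left_vf (lbr G (e b) (e d))) (1%g : G) =
      \sum_l c b d l *: lie_bracket (E a) (E l) (1%g : G).
    have -> : left_vf (lbr G (e b) (e d)) =
        (fun p : G => \sum_l c b d l *: E l p) :> vfield G.
      apply/funext => p; rewrite {1}(orthonormal_expand he (lbr G (e b) (e d))).
      by rewrite left_vf_sum.
    rewrite (@lie_bracket_sumr R n G _ _ (fun l _ => c b d l) E) //; last first.
      by move=> l; exact: smooth_fun_cst.
    by apply: eq_bigr => l _; rewrite vf_app_cst scale0r add0r.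
  rewrite {1}/lbr E1 mxform_suml; apply: eq_bigr => l _; congr (_ * _).
have J : mxform (g 1%g) (lbr G (e i) (lbr G (e j) (e k)) +
    lbr G (e j) (lbr G (e k) (e i)) + lbr G (e k) (lbr G (e i) (e j))) (e m) = 0.
  apply: etrans (congr1 (fun v => mxform (g 1%g) v (e m)) (lbr_jacobi _ _ _)) _.
  exact: mxform0l.
have add3 (B : 'M[R]_n) a b d w :
    mxform B a w + mxform B b w + mxform B d w = mxform B (a + b + d) w.
  by rewrite /mxform !mulmxDl [RHS]mxE [X in _ = X + _]mxE.
apply: etrans _ J; apply: etrans _ (add3 _ _ _ _ _).
apply: etrans _ (esym (congr2 +%R (congr2 +%R (lbrE i j k) (lbrE j k i)) (lbrE k i j))).
by rewrite !big_split.
Qed.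

End Frame.

(** Tracing the Jacobi identity over its last argument gives
   [tr (ad_[x, y]) = tr [ad_x, ad_y] = 0]. *)
Lemma jacobi_trace (R : comPzRingType) n (c : 'I_n -> 'I_n -> 'I_n -> R) i j :
  (forall i j k, c i j k = - c j i k) ->
  (forall i j k m,
    \sum_l (c j k l * c i l m + c k i l * c j l m + c i j l * c k l m) = 0) ->
  \sum_l c i j l * \sum_m c l m m = 0.
Proof.
move=> anti jac.
have J : \sum_k \sum_l (c j k l * c i l k + c k i l * c j l k + c i j l * c k l k) = 0.
  by rewrite big1 // => k _; exact: jac.
have S : \sum_k \sum_l c j k l * c i l k + \sum_k \sum_l c k i l * c j l k = 0.
  rewrite exchange_big -big_split big1 // => k _ /=.
  rewrite -big_split big1 // => l _ /=.
  by rewrite (anti k i) mulNr mulrC addrN.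
move: J; under eq_bigr do rewrite !big_split /=.
rewrite !big_split /= S add0r exchange_big => J.
apply: oppr_inj; rewrite oppr0 -[RHS]J -sumrN; apply: eq_bigr => l _ /=.
rewrite -mulrN -sumrN mulr_sumr; apply: eq_bigr => k _.
by rewrite -(anti k l).
Qed.

Section FrameBrackets.
Context {R : realType} {n : nat} {G : lieGroupType R n} (g : G -> 'M[R]_n)
  (e : 'I_n -> 'rV[R]_n).
Implicit Types (p q : G) (X Y Z : vfield G) (u : G -> R).

Local Notation E := (@frame R n G e).
Local Notation D := (@fderiv R n G e).
Local Notation co := (coef g e).
Local Notation c := (struct_cst g e).

Hypothesis hg : left_invariant_metric g.
Hypothesis he : orthonormal_wrt (g 1%g) e.

Lemma coef_bracket_frame X i k p : smooth_vf X ->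
  co (lie_bracket X (E i)) k p = - D i (co X k) p + \sum_j co X j p * c j i k.
Proof.
move=> sX; apply: (@coef_frame_sum R n G g e hg he _ (fun k =>
  - D i (co X k) p + \sum_j co X j p * c j i k)).
rewrite lie_bracket_anti {1}(frame_expand_fun hg he X).
rewrite (@lie_bracket_sumr R n G _ _ (co X) E); last 2 first.
- by move=> l; exact: coef_smooth.
- by move=> l; exact: frame_smooth.
under eq_bigr do rewrite (lie_bracket_frame he) scaler_sumr.
rewrite big_split exchange_big opprD -!sumrN -big_split.
apply: eq_bigr => l _ /=.
rewrite scalerDl scaleNr; congr (_ + _).
rewrite scaler_suml -sumrN; apply: eq_bigr => j _.
by rewrite (struct_cst_anti g e j i) mulrN scaleNr scalerA.
Qed.

Lemma coef_bracket X Y k p : smooth_vf X -> smooth_vf Y ->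
  co (lie_bracket X Y) k p = vf_app X (co Y k) p - vf_app Y (co X k) p +
    \sum_i \sum_j co X i p * co Y j p * c i j k.
Proof.
move=> sX sY; rewrite {1}(frame_expand_fun hg he Y).
have -> : co (lie_bracket X (fun q => \sum_j co Y j q *: E j q)) k p =
    \sum_j (vf_app X (co Y j) p * (j == k)%:R +
            co Y j p * co (lie_bracket X (E j)) k p).
  rewrite /coef /inner (@lie_bracket_sumr R n G _ _ (co Y) E); last 2 first.
  - by move=> l; exact: coef_smooth.
  - by move=> l; exact: frame_smooth.
  elim: (index_enum 'I_n) => [|j r IH]; first by rewrite !big_nil mxform0l.
  rewrite !big_cons -addrA mxform_linl.
  rewrite mxform_linl IH (frame_orthonormal hg he p j k) addrA; congr (_ + _ + _).
rewrite big_split /= sum_delta -addrA; congr (_ + _).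
under eq_bigr do rewrite coef_bracket_frame // mulrDr mulrN.
rewrite big_split /= sumrN -(vf_app_frame hg he); congr (_ + _).
rewrite exchange_big; apply: eq_bigr => j _ /=; rewrite mulr_sumr.
by apply: eq_bigr => i _; ring.
Qed.

(** The bracket is defined point by point, each time in another chart, so its
   smoothness is not immediate; its coefficients in the global frame settle it. *)
Lemma bracket_smooth X Y : smooth_vf X -> smooth_vf Y -> smooth_vf (lie_bracket X Y).
Proof.
move=> sX sY; rewrite (frame_expand_fun hg he (lie_bracket X Y)).
apply: smooth_vf_sum => k; apply: smooth_vf_scale; last exact: frame_smooth.
have -> : co (lie_bracket X Y) k = fun p =>
    (vf_app X (co Y k) p + (-1) * vf_app Y (co X k) p) +
    \sum_i \sum_j co X i p * co Y j p * c i j k.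
  by apply/funext => p; rewrite coef_bracket // mulN1r.
have sco Z l : smooth_vf Z -> smooth_fun (co Z l) by move=> sZ; exact: coef_smooth.
apply: smooth_fun_add.
  apply: smooth_fun_add; first by apply: vf_app_smooth => //; exact: sco.
  apply: smooth_fun_mul; first exact: smooth_fun_cst.
  by apply: vf_app_smooth => //; exact: sco.
apply: smooth_fun_sum => i; apply: smooth_fun_sum => j.
apply: smooth_fun_mul; last exact: smooth_fun_cst.
by apply: smooth_fun_mul; exact: sco.
Qed.

End FrameBrackets.

(** * The Levi-Civita connection of a conformal metric *)

Section Uniqueness.
Context {R : realType} {n : nat} {M : manifoldType R n}.
Implicit Types (X Y Z : vfield M) (g : M -> 'M[R]_n).

(** Lowered with the metric, the difference of the two connections is a form
   symmetric in its first two arguments (torsion) and skew in its last two (metric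
   compatibility); going around the six permutations shows that it is zero. *)
Lemma levi_civita_unique g nabla nabla' X Y Z p : (forall p, (g p)^T = g p) ->
  is_levi_civita g nabla -> is_levi_civita g nabla' ->
  smooth_vf X -> smooth_vf Y -> smooth_vf Z ->
  inner g (nabla X Y) Z p = inner g (nabla' X Y) Z p.
Proof.
move=> gT [_ m t] [_ m' t'] sX sY sZ.
pose a X Y Z := inner g (nabla X Y) Z p - inner g (nabla' X Y) Z p.
have skew U V W : smooth_vf U -> smooth_vf V -> smooth_vf W -> a U V W = - a U W V.
  move=> sU sV sW; have E1 := m U V W sU sV sW p; have E2 := m' U V W sU sV sW p.
  rewrite E1 in E2; apply/eqP; rewrite -subr_eq0 opprK; apply/eqP.
  have sym (nb : vfield M -> vfield M -> vfield M) :
      inner g V (nb U W) p = inner g (nb U W) V p.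
    by rewrite /inner; exact: mxform_sym.
  rewrite !sym in E2; rewrite /a addrACA E2 -opprD; exact: subrr.
have symm U V W : smooth_vf U -> smooth_vf V -> a U V W = a V U W.
  move=> sU sV; have E := etrans (t U V sU sV p) (esym (t' U V sU sV p)).
  have lin x y z : mxform (g p) (x - y) z = mxform (g p) x z - mxform (g p) y z.
    by rewrite addrC -scaleN1r mxform_linl mulN1r addrC.
  have := congr1 (fun v => mxform (g p) v (W p)) E; rewrite !lin => E'.
  have alg (x y z w : R) : x - y = z - w -> x - z = y - w.
    by move=> /eqP; rewrite subr_eq => /eqP ->; ring.
  exact: alg E'.
(* Alternating [symm] and [skew] three times returns to the start with the
   opposite sign. *)
have a0 : a X Y Z = - a X Y Z.
  apply: etrans (symm _ _ Z sX sY) _; apply: etrans (skew _ _ _ sY sX sZ) _.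
  congr (- _); apply: etrans (symm _ _ X sY sZ) _.
  apply: etrans (skew _ _ _ sZ sY sX) _; rewrite (symm _ _ Y sZ sX).
  by rewrite (skew _ _ _ sX sZ sY) opprK.
have az : a X Y Z = 0 by lra.
by apply/eqP; rewrite -subr_eq0; apply/eqP.
Qed.

End Uniqueness.

(** How the compatibility of a connection with a metric [r * delta], known on the
   frame, passes to arbitrary fields. *)
Lemma conn_metric_alg (R : comPzRingType) n (x y z d : 'I_n -> R)
    (a : 'I_n -> 'I_n -> 'I_n -> R) (r : R) :
  (forall i j k, r * (a i j k + a i k j) = d i * (j == k)%:R) ->
  (\sum_i x i * d i) * \sum_k y k * z k =
  r * (\sum_k (\sum_i \sum_j x i * y j * a i j k) * z k +
       \sum_k y k * \sum_i \sum_j x i * z j * a i j k).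
Proof.
move=> H.
have E1 : \sum_k (\sum_i \sum_j x i * y j * a i j k) * z k =
    \sum_i \sum_j \sum_k x i * (y j * z k) * a i j k.
  under eq_bigr do rewrite mulr_suml; rewrite exchange_big; apply: eq_bigr => i _.
  under eq_bigr do rewrite mulr_suml; rewrite exchange_big; apply: eq_bigr => j _.
  by apply: eq_bigr => k _ /=; ring.
have E2 : \sum_k y k * (\sum_i \sum_j x i * z j * a i j k) =
    \sum_i \sum_j \sum_k x i * (y j * z k) * a i k j.
  under eq_bigr do rewrite mulr_sumr; rewrite exchange_big; apply: eq_bigr => i _.
  apply: eq_bigr => j _ /=; rewrite mulr_sumr.
  by apply: eq_bigr => k _ /=; ring.
rewrite E1 E2 -big_split [RHS]mulr_sumr [LHS]mulr_suml; apply: eq_bigr => i _ /=.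
rewrite -big_split [RHS]mulr_sumr [LHS]mulr_sumr; apply: eq_bigr => j _ /=.
rewrite -big_split -[z j](sum_delta z) !mulr_sumr.
apply: eq_bigr => k _ /=; rewrite eq_sym.
transitivity (x i * (y j * z k) * (d i * (j == k)%:R)); first by ring.
by rewrite -H; ring.
Qed.

Section FrameConnection.
Context {R : realType} {n : nat} {G : lieGroupType R n} (g : G -> 'M[R]_n)
  (e : 'I_n -> 'rV[R]_n) (A : 'I_n -> 'I_n -> 'I_n -> G -> R).
Implicit Types (p q : G) (X Y Z : vfield G) (u : G -> R).

Local Notation E := (@frame R n G e).
Local Notation D := (@fderiv R n G e).
Local Notation co := (coef g e).
Local Notation c := (struct_cst g e).

(** The connection for which the covariant derivative of the [j]-th frame field
   along the [i]-th has coefficients [A i j k]. *)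
Definition frame_connection X Y : vfield G := fun p =>
  \sum_k (vf_app X (co Y k) p +
          \sum_i \sum_j co X i p * co Y j p * A i j k p) *: E k p.

Hypothesis hg : left_invariant_metric g.
Hypothesis he : orthonormal_wrt (g 1%g) e.
Hypothesis sA : forall i j k, smooth_fun (A i j k).

Lemma coef_frame_connection X Y k p : co (frame_connection X Y) k p =
  vf_app X (co Y k) p + \sum_i \sum_j co X i p * co Y j p * A i j k p.
Proof.
exact: (@coef_frame_sum R n G g e hg he _ (fun k => vf_app X (co Y k) p +
  \sum_i \sum_j co X i p * co Y j p * A i j k p)).
Qed.

Lemma frame_connection_smooth X Y : smooth_vf X -> smooth_vf Y ->
  smooth_vf (frame_connection X Y).
Proof.
move=> sX sY; have sco Z l : smooth_vf Z -> smooth_fun (co Z l).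
  by move=> sZ; exact: coef_smooth.
apply: smooth_vf_sum => k; apply: smooth_vf_scale; last exact: frame_smooth.
apply: smooth_fun_add; first by apply: vf_app_smooth => //; exact: sco.
apply: smooth_fun_sum => i; apply: smooth_fun_sum => j.
by apply: smooth_fun_mul => //; apply: smooth_fun_mul; exact: sco.
Qed.

Lemma frame_connection_affine : affine_connection frame_connection.
Proof.
have sco Z l : smooth_vf Z -> smooth_fun (co Z l).
  by move=> sZ; exact: coef_smooth.
split; first exact: frame_connection_smooth.
- move=> u X X' Y su sX sX' sY; apply: (vfield_ext hg he) => k p.
  rewrite [RHS](coef_lin g e k (a := u p) (X := frame_connection X Y)
    (Y := frame_connection X' Y)) // !coef_frame_connection.
  rewrite (vf_app_lin (a := u p) (X := X) (Y := X')) // mulrDr.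
  rewrite addrACA; congr (_ + _); rewrite mulr_sumr -big_split.
  apply: eq_bigr => i _ /=; rewrite mulr_sumr -big_split; apply: eq_bigr => j _ /=.
  by rewrite (coef_lin g e i (a := u p) (X := X) (Y := X')) //; ring.
- move=> X Y Y' sX sY sY'; apply: (vfield_ext hg he) => k p.
  rewrite [RHS](coef_lin g e k (a := 1) (X := frame_connection X Y)
    (Y := frame_connection X Y')) ?scale1r // !coef_frame_connection mul1r.
  have E1 l : co (fun q => Y q + Y' q) l = fun q => co Y l q + co Y' l q.
    apply/funext => q; rewrite (coef_lin g e l (a := 1) (X := Y) (Y := Y')) ?scale1r //.
    by rewrite mul1r.
  rewrite E1 vf_app_add; [|exact: sco|exact: sco].
  rewrite addrACA; congr (_ + _); rewrite -big_split.
  apply: eq_bigr => i _ /=; rewrite -big_split; apply: eq_bigr => j _ /=.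
  by rewrite E1; ring.
- move=> u X Y su sX sY; apply: (vfield_ext hg he) => k p.
  rewrite [RHS](coef_lin g e k (a := vf_app X u p) (X := Y)
    (Y := fun q => u q *: frame_connection X Y q)) //.
  have E1 l (Z : vfield G) : co (fun q => u q *: Z q) l = fun q => u q * co Z l q.
    apply/funext => q; rewrite (coef_lin g e l (a := u q) (X := Z) (Y := fun=> 0)) ?addr0 //.
    by rewrite [X in _ + X]mxform0l addr0.
  rewrite E1 !coef_frame_connection E1 vf_app_mul //; last exact: sco.
  rewrite mulrDr addrA; congr (_ + _); rewrite mulr_sumr.
  apply: eq_bigr => i _ /=; rewrite mulr_sumr; apply: eq_bigr => j _ /=.
  by rewrite E1; ring.
Qed.

(** On the frame, the two hypotheses on [A] are the absence of torsion and the
   compatibility with [f g]. *)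
Lemma frame_connection_levi_civita (f : G -> R) : smooth_fun f ->
  (forall i j k p, A i j k p - A j i k p = c i j k) ->
  (forall i j k p, f p * (A i j k p + A i k j p) = D i f p * (j == k)%:R) ->
  is_levi_civita (fun p => f p *: g p) frame_connection.
Proof.
move=> sf tors metr; have sco Z l : smooth_vf Z -> smooth_fun (co Z l).
  by move=> sZ; exact: coef_smooth.
have gtE Y Z p : inner (fun p => f p *: g p) Y Z p = f p * \sum_k co Y k p * co Z k p.
  rewrite -(inner_coef hg he) /inner /mxform -scalemxAr -scalemxAl mxE; exact: erefl.
split; first exact: frame_connection_affine.
- move=> X Y Z sX sY sZ p; rewrite !gtE.
  have -> : inner (fun p => f p *: g p) Y Z = fun q => f q * \sum_k co Y k q * co Z k q.
    by apply/funext => q; exact: gtE.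
  have sYZ k : smooth_fun (fun q => co Y k q * co Z k q).
    by apply: smooth_fun_mul; exact: sco.
  rewrite vf_app_mul //; last exact: smooth_fun_sum.
  rewrite vf_app_sumr // (vf_app_frame hg he X f).
  rewrite (conn_metric_alg (fun i => co X i p) (fun k => co Y k p)
    (fun k => co Z k p) (fun i j k => metr i j k p)).
  rewrite -!mulrDr -!big_split; congr (_ * _); apply: eq_bigr => k _ /=.
  have alg (q q' a a' y z : R) :
      q * z + y * q' + (a * z + y * a') = (a + q) * z + y * (a' + q') by ring.
  have sYk : smooth_fun (co Y k) by exact: sco.
  have sZk : smooth_fun (co Z k) by exact: sco.
  rewrite (coef_frame_connection X Y k p) (coef_frame_connection X Z k p).
  rewrite addrC (vf_app_mul X p sYk sZk) addrC.
  exact: alg.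
- move=> X Y sX sY p.
  apply: (vfield_eq hg he (X := fun p => frame_connection X Y p - frame_connection Y X p)) => k.
  rewrite (coef_bracket hg he) //.
  rewrite [LHS](coef_lin g e k (a := -1) (X := frame_connection Y X)
    (Y := frame_connection X Y)); last by rewrite scaleN1r addrC.
  rewrite !coef_frame_connection.
  have -> : \sum_i \sum_j co X i p * co Y j p * c i j k =
      \sum_i \sum_j co X i p * co Y j p * A i j k p -
      \sum_i \sum_j co Y i p * co X j p * A i j k p.
    rewrite [X in _ - X]exchange_big -sumrB; apply: eq_bigr => i _ /=.
    rewrite -sumrB; apply: eq_bigr => j _ /=.
    by rewrite -(tors i j k p); ring.
  ring.
Qed.

End FrameConnection.

(** * Curvature as a tensor *)

Section Curvature.
Context {R : realType} {n : nat} {M : manifoldType R n}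
  (nabla : vfield M -> vfield M -> vfield M).
Implicit Types (X Y Z : vfield M) (u : M -> R).

Definition curvature X Y Z : vfield M := fun p =>
  nabla X (nabla Y Z) p - nabla Y (nabla X Z) p - nabla (lie_bracket X Y) Z p.

Hypothesis aff : affine_connection nabla.
Hypothesis bracket_sm : forall X Y, smooth_vf X -> smooth_vf Y ->
  smooth_vf (lie_bracket X Y).

Let sN X Y : smooth_vf X -> smooth_vf Y -> smooth_vf (nabla X Y).
Proof. by case: aff => s _ _ _; exact: s. Qed.

Let linl u X X' Y : smooth_fun u -> smooth_vf X -> smooth_vf X' -> smooth_vf Y ->
  nabla (fun p => u p *: X p + X' p) Y = fun p => u p *: nabla X Y p + nabla X' Y p.
Proof. by case: aff => _ s _ _; exact: s. Qed.

Let addr X Y Y' : smooth_vf X -> smooth_vf Y -> smooth_vf Y' ->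
  nabla X (fun p => Y p + Y' p) = fun p => nabla X Y p + nabla X Y' p.
Proof. by case: aff => _ _ s _; exact: s. Qed.

Let leib u X Y : smooth_fun u -> smooth_vf X -> smooth_vf Y ->
  nabla X (fun p => u p *: Y p) = fun p => vf_app X u p *: Y p + u p *: nabla X Y p.
Proof. by case: aff => _ _ _ s; exact: s. Qed.

Lemma connection0l Y p : smooth_vf Y -> nabla (fun=> 0) Y p = 0.
Proof.
move=> sY; have := linl (smooth_fun_cst 1) smooth_vf0 smooth_vf0 sY.
have -> : (fun q : M => 1 *: 0 + 0) = (fun=> 0) :> vfield M.
  by apply/funext => q; rewrite scaler0 addr0.
move=> /(congr1 (fun V : vfield M => V p)); rewrite scale1r => E.
by apply: (addrI (nabla (fun=> 0) Y p)); rewrite addr0 -E.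
Qed.

Lemma curvature_linl u X X' Y Z p :
  smooth_fun u -> smooth_vf X -> smooth_vf X' -> smooth_vf Y -> smooth_vf Z ->
  curvature (fun q => u q *: X q + X' q) Y Z p =
  u p *: curvature X Y Z p + curvature X' Y Z p.
Proof.
move=> su sX sX' sY sZ; rewrite /curvature.
have sYu : smooth_fun (fun q => -1 * vf_app Y u q).
  by apply: smooth_fun_mul; [exact: smooth_fun_cst | exact: vf_app_smooth].
have BE : lie_bracket (fun q => u q *: X q + X' q) Y = fun q =>
    (-1 * vf_app Y u q) *: X q + (u q *: lie_bracket X Y q + lie_bracket X' Y q).
  apply/funext => q; rewrite lie_bracket_anti lie_bracket_linr //.
  rewrite (lie_bracket_anti X Y q) (lie_bracket_anti X' Y q).
  have alg (x b b' : 'rV[R]_n) (y k : R) :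
      - (y *: x + k *: b + b') = (-1 * y) *: x + (k *: (- b) + - b').
    by apply/rowP => i; rewrite !mxE; ring.
  exact: alg.
have E1 := congr1 (fun V : vfield M => V p) (linl su sX sX' (sN sY sZ)).
have E2 := congr1 (fun V : vfield M => V p)
  (addr sY (smooth_vf_scale su (sN sX sZ)) (sN sX' sZ)).
have E3 := congr1 (fun V : vfield M => V p) (leib su sY (sN sX sZ)).
have sB := bracket_sm sX sY; have sB' := bracket_sm sX' sY.
have E4 := congr1 (fun V : vfield M => V p) (linl sYu sX (smooth_vf_lin su sB sB') sZ).
have E5 := congr1 (fun V : vfield M => V p) (linl su sB sB' sZ).
rewrite (linl su sX sX' sZ) BE E1 E2 E3 E4 E5.
have alg (a b d a' b' d' xz : 'rV[R]_n) (k y : R) :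
    k *: a + a' - (y *: xz + k *: b + b') - ((-1 * y) *: xz + (k *: d + d')) =
    k *: (a - b - d) + (a' - b' - d').
  apply/rowP => i; rewrite !mxE; ring.
exact: alg.
Qed.

Lemma curvature_anti X Y Z p : smooth_vf X -> smooth_vf Y -> smooth_vf Z ->
  curvature X Y Z p = - curvature Y X Z p.
Proof.
move=> sX sY sZ; rewrite /curvature.
have BE : lie_bracket X Y = fun q => -1 *: lie_bracket Y X q + 0.
  by apply/funext => q; rewrite lie_bracket_anti scaleN1r addr0.
have E := congr1 (fun V : vfield M => V p)
  (linl (smooth_fun_cst (-1)) (bracket_sm sY sX) smooth_vf0 sZ).
rewrite BE E connection0l // addr0 scaleN1r opprK !opprD !opprK.
by congr (_ + _); rewrite addrC.
Qed.

Lemma curvature_linm u X Y Y' Z p :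
  smooth_fun u -> smooth_vf X -> smooth_vf Y -> smooth_vf Y' -> smooth_vf Z ->
  curvature X (fun q => u q *: Y q + Y' q) Z p =
  u p *: curvature X Y Z p + curvature X Y' Z p.
Proof.
move=> su sX sY sY' sZ; rewrite curvature_anti //; last exact: smooth_vf_lin.
rewrite curvature_linl // opprD -scalerN.
exact: (congr2 (fun s t => u p *: s + t) (esym (curvature_anti p sX sY sZ))
  (esym (curvature_anti p sX sY' sZ))).
Qed.

(** The terms in which [u] is differentiated twice form the commutator of the
   derivations [X] and [Y] minus the derivation [lie_bracket X Y], which is zero. *)
Lemma curvature_linr u X Y Z Z' p :
  smooth_fun u -> smooth_vf X -> smooth_vf Y -> smooth_vf Z -> smooth_vf Z' ->
  curvature X Y (fun q => u q *: Z q + Z' q) p =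
  u p *: curvature X Y Z p + curvature X Y Z' p.
Proof.
move=> su sX sY sZ sZ'; rewrite /curvature.
have sB := bracket_sm sX sY.
have first_order V : smooth_vf V -> nabla V (fun q => u q *: Z q + Z' q) =
    fun q => vf_app V u q *: Z q + u q *: nabla V Z q + nabla V Z' q.
  by move=> sV; rewrite (addr sV (smooth_vf_scale su sZ) sZ') leib.
have second_order V W : smooth_vf V -> smooth_vf W ->
    nabla V (nabla W (fun q => u q *: Z q + Z' q)) p =
    vf_app V (vf_app W u) p *: Z p + vf_app W u p *: nabla V Z p +
    (vf_app V u p *: nabla W Z p + u p *: nabla V (nabla W Z) p) +
    nabla V (nabla W Z') p.
  move=> sV sW; rewrite first_order //.
  have sWu := vf_app_smooth sW su.
  have s1 := smooth_vf_scale sWu sZ; have s2 := smooth_vf_scale su (sN sW sZ).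
  have E1 := congr1 (fun T : vfield M => T p) (addr sV (smooth_vf_add s1 s2) (sN sW sZ')).
  have E2 := congr1 (fun T : vfield M => T p) (addr sV s1 s2).
  have E3 := congr1 (fun T : vfield M => T p) (leib sWu sV sZ).
  have E4 := congr1 (fun T : vfield M => T p) (leib su sV (sN sW sZ)).
  by rewrite E1 E2 E3 E4.
rewrite second_order // second_order // first_order // vf_app_bracket //.
have alg (a b d a' b' d' z x y : 'rV[R]_n) (xy yx xu yu k : R) :
    xy *: z + yu *: x + (xu *: y + k *: a) + a' -
    (yx *: z + xu *: y + (yu *: x + k *: b) + b') - ((xy - yx) *: z + k *: d + d') =
    k *: (a - b - d) + (a' - b' - d').
  apply/rowP => i; rewrite !mxE; ring.
exact: alg.
Qed.

End Curvature.

Section Tensors.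
Context {R : realType} {n : nat} {G : lieGroupType R n} (g : G -> 'M[R]_n)
  (e : 'I_n -> 'rV[R]_n).
Implicit Types (p q : G) (X Y Z : vfield G) (u : G -> R).

Local Notation E := (@frame R n G e).
Local Notation co := (coef g e).

Hypothesis hg : left_invariant_metric g.
Hypothesis he : orthonormal_wrt (g 1%g) e.

(** Linearity over smooth functions, observed at the point [p]. *)
Definition tensorial_at (V : lmodType R) p (T : vfield G -> V) :=
  forall u X X', smooth_fun u -> smooth_vf X -> smooth_vf X' ->
  T (fun q => u q *: X q + X' q) = u p *: T X + T X'.

(** Expanding [X] in the frame shows that [T X] only depends on the value of [X]
   at [p]. *)
Lemma tensor_frame (V : lmodType R) p (T : vfield G -> V) X :
  tensorial_at p T -> smooth_vf X -> T X = \sum_i co X i p *: T (E i).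
Proof.
move=> tT sX; rewrite {1}(frame_expand_fun hg he X).
have T0 : T (fun=> 0) = 0.
  have := tT _ _ _ (smooth_fun_cst 1) smooth_vf0 smooth_vf0.
  have -> : (fun q : G => 1 *: 0 + 0) = (fun=> 0) :> vfield G.
    by apply/funext => q; rewrite scaler0 addr0.
  by rewrite scale1r => H; apply: (addrI (T (fun=> 0))); rewrite addr0 -H.
have sE i : smooth_vf (E i) by exact: frame_smooth.
have sc i : smooth_fun (co X i) by exact: coef_smooth.
elim: (index_enum 'I_n) => [|i r IH].
  by under eq_fun do rewrite big_nil; rewrite big_nil.
under eq_fun do rewrite big_cons; rewrite big_cons -IH; apply: tT => //.
by apply: smooth_vf_sum => j; exact: smooth_vf_scale.
Qed.

Lemma vf_extendP p v : smooth_vf (vf_extend p v : vfield G) /\ vf_extend p v p = v.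
Proof.
apply: (@xgetPex _ (fun=> 0) [set V : vfield G | smooth_vf V /\ V p = v]).
exists (fun q => \sum_k mxform (g p) v (E k p) *: E k q); split.
  apply: smooth_vf_sum => k; apply: smooth_vf_scale; last exact: frame_smooth.
  exact: smooth_fun_cst.
exact/esym/(orthonormal_expand (frame_orthonormal hg he p)).
Qed.

(** The trace does not depend on the extensions chosen by [vf_extend]. *)
Lemma trend_tensor p (T : vfield G -> 'rV[R]_n) : tensorial_at p T ->
  trend (fun v => T (vf_extend p v)) = \sum_k mxform (g p) (T (E k)) (E k p).
Proof.
move=> tT; have TE v : T (vf_extend p v) = \sum_i mxform (g p) v (E i p) *: T (E i).
  have [sv vE] := vf_extendP p v.
  by rewrite (tensor_frame tT sv); apply: eq_bigr => i _; rewrite /coef /inner vE.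
rewrite (trend_orthonormal (frame_orthonormal hg he p)).
  apply: eq_bigr => k _; congr mxform; rewrite TE.
  rewrite (bigD1 k) //= (frame_orthonormal hg he p k k) eqxx scale1r big1 ?addr0 //.
  move=> i ik; rewrite (frame_orthonormal hg he p k i) eq_sym (negbTE ik).
  by rewrite scale0r.
move=> a v w; rewrite !TE scaler_sumr -big_split; apply: eq_bigr => i _ /=.
by rewrite mxform_linl scalerDl scalerA.
Qed.

End Tensors.

(** * The Ricci tensor in terms of structure constants *)

Section RicciAlgebra.
Context {R : realFieldType} {n : nat} (c : 'I_n -> 'I_n -> 'I_n -> R).
Implicit Types (i j k l : 'I_n) (f : 'I_n -> R) (X : 'I_n -> 'I_n -> 'I_n -> R).

(** The Koszul formula in an orthonormal frame with constant structure
   constants [c i j k], the [k]-th coefficient of the bracket of fields [i] and [j]. *)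
Definition christoffel i j k : R := (c i j k - c j k i + c k i j) / 2.

(** The change of the Levi-Civita connection under [g |-> exp (- 2 phi) g], for
   [f i] the derivative of [phi] along the [i]-th frame field. *)
Definition conformal_shift f i j k : R :=
  - (f i * (j == k)%:R) - f j * (i == k)%:R + (i == j)%:R * f k.

Definition conformal_christoffel f i j k : R :=
  christoffel i j k + conformal_shift f i j k.

(** The trace of [ad] of the [l]-th frame vector. *)
Definition modular l : R := \sum_m c l m m.

Local Notation Gam := christoffel.
Local Notation S := conformal_shift.
Local Notation A := conformal_christoffel.

Hypothesis anti : forall i j k, c i j k = - c j i k.
Hypothesis jac : forall i j k m,
  \sum_l (c j k l * c i l m + c k i l * c j l m + c i j l * c k l m) = 0.

Lemma christoffel_skew i j k : Gam i j k = - Gam i k j.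
Proof. by rewrite /christoffel (anti j i k) (anti i k j) (anti j k i); field. Qed.

Lemma conformal_christoffel_torsion f i j k : A f i j k - A f j i k = c i j k.
Proof.
rewrite /conformal_christoffel /conformal_shift /christoffel (eq_sym j i).
by rewrite (anti j i k) (anti k j i) (anti k i j) (anti j k i); field.
Qed.

Lemma conformal_christoffel_metric f i j k :
  A f i j k + A f i k j = - 2 * f i * (j == k)%:R.
Proof.
rewrite /conformal_christoffel /conformal_shift (christoffel_skew i k j).
by rewrite (eq_sym k j); ring.
Qed.

Let sum_deltaR F k : \sum_i F i * (k == i)%:R = F k :> R.
Proof. by under eq_bigr do rewrite eq_sym; exact: sum_delta. Qed.

Lemma christoffel_trace l : \sum_i Gam i l i = - modular l.
Proof.
rewrite /modular -sumrN; apply: eq_bigr => i _.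
have cii : c i i l = 0 by have := anti i i l; lra.
by rewrite /christoffel cii (anti i l i); field.
Qed.

Lemma christoffel_trace_left l : \sum_i Gam i i l = modular l.
Proof.
by under eq_bigr do rewrite christoffel_skew; rewrite sumrN christoffel_trace opprK.
Qed.

Lemma conformal_shift_trace f l : \sum_i S f i l i = - n%:R * f l.
Proof.
rewrite /conformal_shift !big_split /= !sumrN sum_deltaR.
have -> : \sum_(i < n) f l * (i == i)%:R = n%:R * f l.
  under eq_bigr do rewrite eqxx mulr1.
  by rewrite sumr_const card_ord mulr_natl.
have -> : \sum_(i < n) (i == l)%:R * f i = f l.
  by under eq_bigr do rewrite mulrC; exact: sum_delta.
ring.
Qed.

(** Stated for any [X] because [conformal_quadratic] uses it both for the
   Christoffel symbols and for the shift itself. *)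
Lemma shift_contraction X f j k :
  \sum_i \sum_l X i j l * S f l k i =
  - (\sum_l X k j l * f l) - f k * (\sum_i X i j i) + \sum_i X i j k * f i.
Proof.
have E1 : \sum_i \sum_l X i j l * (f l * (k == i)%:R) = \sum_l X k j l * f l.
  rewrite exchange_big; apply: eq_bigr => l _ /=.
  under eq_bigr do rewrite mulrA.
  exact: (sum_deltaR (fun i => X i j l * f l)).
have E2 : \sum_i \sum_l X i j l * (f k * (l == i)%:R) = f k * \sum_i X i j i.
  rewrite mulr_sumr; apply: eq_bigr => i _.
  under eq_bigr do rewrite mulrA.
  by rewrite (sum_delta (fun l => X i j l * f k)) mulrC.
have E3 : \sum_i \sum_l X i j l * ((l == k)%:R * f i) = \sum_i X i j k * f i.
  apply: eq_bigr => i _; under eq_bigr do rewrite mulrCA mulrC.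
  exact: (sum_delta (fun l => X i j l * f i)).
rewrite -E1 -E2 -E3 -!sumrN -!big_split; apply: eq_bigr => i _ /=.
rewrite -!sumrN -!big_split; apply: eq_bigr => l _ /=.
by rewrite /conformal_shift; ring.
Qed.

Lemma shift_contraction_left X f j k :
  \sum_i \sum_l S f i j l * X l k i =
  - (\sum_l X j k l * f l) - f j * (\sum_i X i k i) + \sum_i X i k j * f i.
Proof.
rewrite -shift_contraction exchange_big; apply: eq_bigr => i _ /=.
by apply: eq_bigr => l _; rewrite mulrC.
Qed.

Let shift_row f j k : \sum_l S f j k l * f l =
  - (2 * f j * f k) + (j == k)%:R * \sum_l f l * f l.
Proof.
have -> : \sum_l S f j k l * f l = \sum_l (- f j * (f l * (k == l)%:R)
    - f k * (f l * (j == l)%:R) + (j == k)%:R * (f l * f l)).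
  by apply: eq_bigr => l _; rewrite /conformal_shift; ring.
rewrite !big_split /= sumrN -!mulr_sumr !sum_deltaR; ring.
Qed.

Let shift_col f j k : \sum_i S f i j k * f i = - ((j == k)%:R * \sum_l f l * f l).
Proof.
have -> : \sum_i S f i j k * f i = \sum_i (- (j == k)%:R * (f i * f i)
    - f j * (f i * (i == k)%:R) + f k * (f i * (i == j)%:R)).
  by apply: eq_bigr => i _; rewrite /conformal_shift; ring.
rewrite !big_split /= sumrN -!mulr_sumr !sum_delta; ring.
Qed.

(** The terms without shift, with one shift and with two, by
   [shift_contraction]. *)
Lemma conformal_quadratic f j k :
  \sum_i \sum_l A f i j l * A f l k i =
  \sum_i \sum_l Gam i j l * Gam l k i
  - \sum_l (Gam k j l + Gam j k l) * f l + f k * modular j + f j * modular k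
  + (n%:R + 2) * f j * f k - 2 * (j == k)%:R * \sum_l f l * f l.
Proof.
have -> : \sum_i \sum_l A f i j l * A f l k i =
    \sum_i \sum_l Gam i j l * Gam l k i + \sum_i \sum_l Gam i j l * S f l k i +
    \sum_i \sum_l S f i j l * Gam l k i + \sum_i \sum_l S f i j l * S f l k i.
  rewrite -!big_split; apply: eq_bigr => i _ /=.
  rewrite -!big_split; apply: eq_bigr => l _ /=.
  by rewrite /conformal_christoffel; ring.
rewrite shift_contraction shift_contraction_left (shift_contraction (S f)).
rewrite shift_row shift_col conformal_shift_trace !christoffel_trace.
have -> : \sum_i Gam i k j * f i = - \sum_i Gam i j k * f i.
  by rewrite -sumrN; apply: eq_bigr => i _; rewrite christoffel_skew mulNr.
under [\sum_l (_ + _) * _]eq_bigr do rewrite mulrDl.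
rewrite big_split /= (eq_sym k j); ring.
Qed.

(** The Ricci tensor of a left-invariant metric on a frame orthonormal for it.
   The sums are the traces of [ad ad] and of [ad ad^*], the mean curvature terms
   and the trace of [J J]. *)
Definition left_invariant_ricci j k : R :=
  - (1 / 2) * (\sum_i \sum_l c j i l * c k l i + \sum_i \sum_l c j i l * c k i l
               + \sum_l modular l * c l j k + \sum_l modular l * c l k j)
  + 1 / 4 * \sum_i \sum_l c i l j * c i l k.

Let skew_sum (P N : 'I_n -> 'I_n -> R) : (forall i l, P i l = - P l i) ->
  \sum_i \sum_l P i l * (N i l + N l i) = 0.
Proof.
move=> aP; set s := LHS; have E : s = - s.
  rewrite {1}/s exchange_big -sumrN; apply: eq_bigr => i _ /=.
  by rewrite -sumrN; apply: eq_bigr => l _; rewrite aP; ring.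
by lra.
Qed.

(** In the first sum, the part of [Gam j k l] antisymmetric in [j] and [k]
   contributes the trace of [ad] of a bracket, which is zero.  In the second, the
   products of a symmetric and an antisymmetric factor sum to zero. *)
Lemma christoffel_ricci j k :
  - (\sum_l Gam j k l * modular l) - \sum_i \sum_l Gam i j l * Gam l k i =
  left_invariant_ricci j k.
Proof.
have E1 : \sum_l Gam j k l * modular l =
    1 / 2 * (\sum_l modular l * c l j k + \sum_l modular l * c l k j).
  have T := jacobi_trace j k anti jac.
  rewrite -[X in 1 / 2 * X]addr0 -[X in _ + X]T -!big_split mulr_sumr.
  by apply: eq_bigr => l _ /=; rewrite /christoffel /modular (anti k l j); field.
have E2 : \sum_i \sum_l Gam i j l * Gam l k i =
    1 / 4 * (\sum_i \sum_l (c j i l + c j l i) * (c k i l + c k l i)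
    + \sum_i \sum_l c i l j * (c k i l + c k l i)
    - \sum_i \sum_l c i l k * (c j i l + c j l i)
    - \sum_i \sum_l c i l j * c i l k).
  rewrite -!sumrN -!big_split mulr_sumr; apply: eq_bigr => i _ /=.
  rewrite -!sumrN -!big_split mulr_sumr; apply: eq_bigr => l _ /=.
  by rewrite /christoffel (anti i j l) (anti l i j) (anti l k i); field.
have sA m i l : c i l m = - c l i m by exact: anti.
rewrite (skew_sum (fun i l => c k i l) (sA j)) (skew_sum (fun i l => c j i l) (sA k)) in E2.
have E3 : \sum_i \sum_l (c j i l + c j l i) * (c k i l + c k l i) =
    2 * \sum_i \sum_l c j i l * c k i l + 2 * \sum_i \sum_l c j i l * c k l i.
  have X1 : \sum_i \sum_l c j l i * c k l i = \sum_i \sum_l c j i l * c k i l.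
    by rewrite exchange_big.
  have X2 : \sum_i \sum_l c j l i * c k i l = \sum_i \sum_l c j i l * c k l i.
    by rewrite exchange_big.
  transitivity (\sum_i \sum_l c j i l * c k i l + \sum_i \sum_l c j l i * c k l i
    + (\sum_i \sum_l c j i l * c k l i + \sum_i \sum_l c j l i * c k i l)).
    rewrite -!big_split; apply: eq_bigr => i _ /=.
    by rewrite -!big_split; apply: eq_bigr => l _ /=; ring.
  by rewrite X1 X2; ring.
by rewrite /left_invariant_ricci E1 E2 E3; field.
Qed.

(** The Hessian of a function with first derivatives [f] and second derivatives
   [ff] along the frame. *)
Definition frame_hessian (f : 'I_n -> R) (ff : 'I_n -> 'I_n -> R) j k : R :=
  ff j k - \sum_l Gam j k l * f l.

(** Conformal change of the Ricci tensor; [f i] and [ff i j] stand for the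
   first and second derivatives of the conformal exponent along the frame. *)
Lemma conformal_ricci f (ff : 'I_n -> 'I_n -> R) (dA : 'I_n -> 'I_n -> 'I_n -> 'I_n -> R) j k :
  (forall i j, ff i j - ff j i = \sum_l c i j l * f l) ->
  (forall m i j k, dA m i j k = conformal_shift (ff m) i j k) ->
  \sum_i (dA i j k i - dA j i k i +
    \sum_l (A f j k l * A f i l i - A f i k l * A f j l i - c i j l * A f l k i)) =
  left_invariant_ricci j k +
  (\sum_i frame_hessian f ff i i - (n%:R - 2) * \sum_l f l * f l) * (j == k)%:R +
  (n%:R - 2) * (frame_hessian f ff j k + f j * f k).
Proof.
move=> comm dAE.
have D1 : \sum_i dA i j k i = - ff k j - ff j k + (j == k)%:R * \sum_i ff i i.
  have -> : \sum_i dA i j k i = \sum_i (- (ff i j * (k == i)%:R) - ff i k * (j == i)%:R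
      + (j == k)%:R * ff i i).
    by apply: eq_bigr => i _; rewrite dAE.
  by rewrite !big_split /= !sumrN !sum_deltaR -mulr_sumr.
have D2 : \sum_i dA j i k i = - n%:R * ff j k.
  by under eq_bigr do rewrite dAE; exact: conformal_shift_trace.
have Q1 : \sum_i \sum_l A f j k l * A f i l i =
    - \sum_l Gam j k l * modular l - n%:R * \sum_l Gam j k l * f l
    + f j * modular k + f k * modular j + 2 * n%:R * f j * f k
    - (j == k)%:R * (\sum_l f l * modular l + n%:R * \sum_l f l * f l).
  rewrite exchange_big.
  have -> : \sum_l \sum_i A f j k l * A f i l i =
      \sum_l A f j k l * (- modular l - n%:R * f l).
    apply: eq_bigr => l _; rewrite -mulr_sumr big_split /= christoffel_trace.
    by rewrite conformal_shift_trace mulNr.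
  have -> : \sum_l A f j k l * (- modular l - n%:R * f l) =
    - \sum_l Gam j k l * modular l - n%:R * (\sum_l Gam j k l * f l)
    - \sum_l S f j k l * modular l - n%:R * (\sum_l S f j k l * f l).
    rewrite !mulr_sumr -!sumrN -!big_split; apply: eq_bigr => l _ /=.
    by rewrite /conformal_christoffel; ring.
  have -> : \sum_l S f j k l * modular l = - f j * modular k - f k * modular j
      + (j == k)%:R * \sum_l f l * modular l.
    have -> : \sum_l S f j k l * modular l = \sum_l (- f j * (modular l * (k == l)%:R)
        - f k * (modular l * (j == l)%:R) + (j == k)%:R * (f l * modular l)).
      by apply: eq_bigr => l _; rewrite /conformal_shift; ring.
    by rewrite !big_split /= sumrN -!mulr_sumr !sum_deltaR; ring.
  rewrite shift_row; ring.
(* The torsion is [c i j l = A f i j l - A f j i l]; exchanging the summation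
   indices cancels the first product against one half of the second. *)
have Q2 : \sum_i \sum_l (A f i k l * A f j l i + c i j l * A f l k i) =
    \sum_i \sum_l A f i j l * A f l k i.
  have -> : \sum_i \sum_l (A f i k l * A f j l i + c i j l * A f l k i) =
      \sum_i \sum_l A f i k l * A f j l i +
      (\sum_i \sum_l A f i j l * A f l k i - \sum_i \sum_l A f j i l * A f l k i).
    rewrite -sumrB -big_split; apply: eq_bigr => i _ /=.
    rewrite -sumrB -big_split; apply: eq_bigr => l _ /=.
    by rewrite -(conformal_christoffel_torsion f i j l); ring.
  have -> : \sum_i \sum_l A f i k l * A f j l i = \sum_i \sum_l A f j i l * A f l k i.
    rewrite exchange_big; apply: eq_bigr => i _; apply: eq_bigr => l _.
    by rewrite mulrC.
  ring.
have -> : \sum_i (dA i j k i - dA j i k i + \sum_l (A f j k l * A f i l i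
      - A f i k l * A f j l i - c i j l * A f l k i)) =
    \sum_i dA i j k i - \sum_i dA j i k i + \sum_i \sum_l A f j k l * A f i l i
    - \sum_i \sum_l (A f i k l * A f j l i + c i j l * A f l k i).
  rewrite -!sumrN -!big_split; apply: eq_bigr => i _ /=.
  rewrite -sumrN -addrA -big_split; congr (_ + _); apply: eq_bigr => l _ /=; ring.
rewrite D1 D2 Q1 Q2 conformal_quadratic -christoffel_ricci.
have H1 : \sum_i frame_hessian f ff i i = \sum_i ff i i - \sum_l f l * modular l.
  rewrite /frame_hessian sumrB exchange_big; congr (_ - _); apply: eq_bigr => l _ /=.
  by rewrite -mulr_suml christoffel_trace_left mulrC.
have H2 : \sum_l (Gam k j l + Gam j k l) * f l =
    2 * \sum_l Gam j k l * f l - (ff j k - ff k j).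
  rewrite comm mulr_sumr -sumrB; apply: eq_bigr => l _.
  have T := conformal_christoffel_torsion (fun=> 0) j k l.
  by rewrite -T /conformal_christoffel /conformal_shift; ring.
rewrite H1 H2 /frame_hessian; ring.
Qed.

End RicciAlgebra.

(** * The Ricci tensor of a conformal metric *)

Section ConformalMetric.
Context {R : realType} {n : nat} {G : lieGroupType R n} (g : G -> 'M[R]_n)
  (e : 'I_n -> 'rV[R]_n) (phi : G -> R).
Implicit Types (p q : G) (X Y Z : vfield G) (u : G -> R).

Local Notation E := (@frame R n G e).
Local Notation D := (@fderiv R n G e).
Local Notation co := (coef g e).
Local Notation c := (struct_cst g e).

Hypothesis hg : left_invariant_metric g.
Hypothesis he : orthonormal_wrt (g 1%g) e.
Hypothesis hphi : smooth_fun phi.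

Definition conformal_factor p : R := expR (- 2 * phi p).
Definition conformal_metric p : 'M[R]_n := conformal_factor p *: g p.
Definition conformal_coef i j k p : R :=
  conformal_christoffel c (fun i => D i phi p) i j k.

Local Notation f := conformal_factor.
Local Notation gt := conformal_metric.
Local Notation A := conformal_coef.
Local Notation L := (levi_civita gt).

Lemma fderiv_smooth i u : smooth_fun u -> smooth_fun (D i u).
Proof. by move=> su; apply: vf_app_smooth => //; exact: frame_smooth. Qed.

Lemma m2phi_smooth : smooth_fun (fun p => - 2 * phi p).
Proof. by apply: smooth_fun_mul => //; exact: smooth_fun_cst. Qed.

Lemma conformal_factor_smooth : smooth_fun f.
Proof. by apply: smooth_fun_expR; exact: m2phi_smooth. Qed.

Lemma conformal_factor_neq0 p : f p != 0.
Proof. by rewrite gt_eqF // expR_gt0. Qed.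

Lemma vf_app_conformal_factor X p : vf_app X f p = f p * (- 2 * vf_app X phi p).
Proof.
rewrite (vf_app_expR X p m2phi_smooth); congr (_ * _).
rewrite (vf_app_mul X p (smooth_fun_cst (- 2)) hphi) vf_app_cst.
by rewrite mul0r add0r.
Qed.

(** The form in which smoothness and derivatives are read off. *)
Lemma conformal_coefE i j k : A i j k = fun p => christoffel c i j k +
  (- (j == k)%:R * D i phi p + (- (i == k)%:R * D j phi p + (i == j)%:R * D k phi p)).
Proof.
apply/funext => p; rewrite /A /conformal_christoffel /conformal_shift; ring.
Qed.

Lemma conformal_coef_smooth i j k : smooth_fun (A i j k).
Proof.
rewrite conformal_coefE; apply: smooth_fun_add; first exact: smooth_fun_cst.
apply: smooth_fun_add; last apply: smooth_fun_add;
  (apply: smooth_fun_mul; [exact: smooth_fun_cst | exact: fderiv_smooth]).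
Qed.

Lemma frame_connection_conformal :
  is_levi_civita gt (frame_connection g e A).
Proof.
apply: frame_connection_levi_civita => //.
- exact: conformal_coef_smooth.
- exact: conformal_factor_smooth.
- by move=> i j k p; apply: conformal_christoffel_torsion => *; exact: struct_cst_anti.
- move=> i j k p; rewrite [D i f p](vf_app_conformal_factor (E i) p).
  rewrite /conformal_coef.
  rewrite conformal_christoffel_metric; last by move=> *; exact: struct_cst_anti.
  by rewrite -[RHS]mulrA.
Qed.

Lemma inner_conformal X Y p : inner gt X Y p = f p * inner g X Y p.
Proof.
rewrite /inner /mxform /gt -scalemxAr -scalemxAl mxE; exact: erefl.
Qed.

(** The choice made by [levi_civita] is meaningful because [frame_connection]
   provides a connection to choose. *)
Lemma levi_civita_conformal : is_levi_civita gt L.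
Proof.
apply: (@xgetPex _ (fun _ _ _ => 0) [set nabla | is_levi_civita gt nabla]).
by exists (frame_connection g e A); exact: frame_connection_conformal.
Qed.

Lemma levi_civita_frame X Y : smooth_vf X -> smooth_vf Y ->
  L X Y = frame_connection g e A X Y.
Proof.
move=> sX sY; apply: (vfield_ext hg he) => k p.
apply: (mulfI (conformal_factor_neq0 p)); rewrite -!inner_conformal.
apply: levi_civita_unique => //; last exact: frame_smooth.
- by move=> q; rewrite /gt linearZ /=; case: hg => -[-> _ _].
- exact: levi_civita_conformal.
- exact: frame_connection_conformal.
Qed.

Lemma coef_levi_civita X Y k p : smooth_vf X -> smooth_vf Y ->
  co (L X Y) k p = vf_app X (co Y k) p +
    \sum_i \sum_j co X i p * co Y j p * A i j k p.
Proof. by move=> sX sY; rewrite levi_civita_frame // coef_frame_connection. Qed.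

Lemma levi_civita_smooth X Y : smooth_vf X -> smooth_vf Y -> smooth_vf (L X Y).
Proof. by move=> sX sY; case: levi_civita_conformal => -[s _ _ _] _ _; exact: s. Qed.

Let sE i : smooth_vf (E i). Proof. exact: frame_smooth. Qed.

Lemma coef_frame_fun i k : co (E i) k = fun=> (i == k)%:R.
Proof. by apply/funext => p; exact: coef_frame. Qed.

Lemma coef_levi_civita_framel i Y k p : smooth_vf Y ->
  co (L (E i) Y) k p = D i (co Y k) p + \sum_j co Y j p * A i j k p.
Proof.
move=> sY; rewrite coef_levi_civita //; congr (_ + _).
rewrite exchange_big; apply: eq_bigr => j _ /=.
under eq_bigr do rewrite coef_frame_fun -mulrA mulrC eq_sym.
exact: (sum_delta (fun i => co Y j p * A i j k p)).
Qed.

Lemma coef_levi_civita_frame i j k : co (L (E i) (E j)) k = A i j k.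
Proof.
apply/funext => p; rewrite coef_levi_civita_framel // coef_frame_fun.
rewrite [D _ _ _]vf_app_cst add0r.
under eq_bigr do rewrite coef_frame_fun mulrC eq_sym.
exact: (sum_delta (fun j => A i j k p)).
Qed.

Lemma coef_levi_civita_framer X j k p : smooth_vf X ->
  co (L X (E j)) k p = \sum_i co X i p * A i j k p.
Proof.
move=> sX; rewrite coef_levi_civita // coef_frame_fun vf_app_cst add0r.
apply: eq_bigr => i _.
under eq_bigr do rewrite coef_frame_fun mulrAC eq_sym.
exact: (sum_delta (fun j => co X i p * A i j k p)).
Qed.

Lemma coef_sub X Y Z k p : Z p = X p - Y p -> co Z k p = co X k p - co Y k p.
Proof.
move=> ZE; rewrite (coef_lin g e k (a := -1) (X := Y) (Y := X)) ?mulN1r 1?addrC //.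
by rewrite ZE scaleN1r addrC.
Qed.

Lemma coef_riemann i j k m p : co (riemann gt (E i) (E j) (E k)) m p =
  D i (A j k m) p - D j (A i k m) p + \sum_l (A j k l p * A i l m p
    - A i k l p * A j l m p - c i j l * A l k m p).
Proof.
have sL a b : smooth_vf (L (E a) (E b)) by exact: levi_civita_smooth.
rewrite (coef_sub (X := fun p => L (E i) (L (E j) (E k)) p - L (E j) (L (E i) (E k)) p)
  (Y := L (lie_bracket (E i) (E j)) (E k))) //.
rewrite (coef_sub (X := L (E i) (L (E j) (E k))) (Y := L (E j) (L (E i) (E k)))) //.
rewrite !coef_levi_civita_framel // coef_levi_civita_framer; last first.
  exact: (bracket_smooth hg he).
rewrite !coef_levi_civita_frame.
have cb l : co (lie_bracket (E i) (E j)) l p = c i j l.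
  exact: (@coef_frame_sum R n G g e hg he _ (c i j) p l (lie_bracket_frame he i j p)).
under [X in _ - X]eq_bigr do rewrite cb.
under [X in _ + X - (_ + _)]eq_bigr do rewrite coef_levi_civita_frame.
under [X in _ - (_ + X)]eq_bigr do rewrite coef_levi_civita_frame.
rewrite !sumrB.
have alg (a b x y z : R) : a + x - (b + y) - z = a - b + (x - y - z) by ring.
exact: alg.
Qed.

Let affL : affine_connection L. Proof. by case: levi_civita_conformal. Qed.
Let bs X Y : smooth_vf X -> smooth_vf Y -> smooth_vf (lie_bracket X Y).
Proof. exact: (bracket_smooth hg he). Qed.

Lemma ricci_sum Y Z p : smooth_vf Y -> smooth_vf Z ->
  ricci gt Y Z p = \sum_k mxform (g p) (riemann gt (E k) Y Z p) (E k p).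
Proof.
move=> sY sZ; apply: (trend_tensor hg he (T := fun X => riemann gt X Y Z p)).
by move=> u X X' su sX sX'; exact: (curvature_linl affL bs).
Qed.

Lemma ricci_tensorl Z p : smooth_vf Z ->
  tensorial_at p (fun Y => ricci gt Y Z p : R^o).
Proof.
move=> sZ u Y Y' su sY sY'; rewrite !ricci_sum //; last exact: smooth_vf_lin.
rewrite scaler_sumr -big_split; apply: eq_bigr => k _ /=.
have C := curvature_linm affL bs p su (sE k) sY sY' sZ.
by apply: etrans (congr1 (fun v => mxform (g p) v _) C) _; exact: mxform_linl.
Qed.

Lemma ricci_tensorr Y p : smooth_vf Y ->
  tensorial_at p (fun Z => ricci gt Y Z p : R^o).
Proof.
move=> sY u Z Z' su sZ sZ'; rewrite !ricci_sum //; last exact: smooth_vf_lin.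
rewrite scaler_sumr -big_split; apply: eq_bigr => k _ /=.
have C := curvature_linr affL bs p su (sE k) sY sZ sZ'.
by apply: etrans (congr1 (fun v => mxform (g p) v _) C) _; exact: mxform_linl.
Qed.

Lemma fderiv_conformal_coef m i j k p :
  D m (A i j k) p = conformal_shift (fun l => D m (D l phi) p) i j k.
Proof.
rewrite conformal_coefE.
have sc (a : R) l : smooth_fun (fun q => a * D l phi q).
  by apply: smooth_fun_mul; [exact: smooth_fun_cst | exact: fderiv_smooth].
have Dc (a : R) l : vf_app (E m) (fun q => a * D l phi q) p = a * D m (D l phi) p.
  have M := vf_app_mul (E m) p (smooth_fun_cst a) (fderiv_smooth l hphi).
  by apply: etrans M _; rewrite vf_app_cst mul0r add0r.
have S2 := smooth_fun_add (sc (- (i == k)%:R) j) (sc (i == j)%:R k).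
have S1 := smooth_fun_add (sc (- (j == k)%:R) i) S2.
apply: etrans (vf_app_add _ p (smooth_fun_cst _) S1) _; rewrite vf_app_cst add0r.
apply: etrans (vf_app_add _ p (sc _ i) S2) _.
apply: etrans (congr1 (fun t => _ + t) (vf_app_add _ p (sc _ j) (sc _ k))) _.
apply: etrans (congr2 +%R (Dc _ i) (congr2 +%R (Dc _ j) (Dc _ k))) _.
have alg (x y z a b d : R) : - x * a + (- y * b + z * d) = - (a * x) - b * y + z * d.
  by ring.
exact: alg.
Qed.

Lemma ricci_conformal_frame j k p :
  let dphi i := D i phi p in
  let hess := frame_hessian c dphi (fun i j => D i (D j phi) p) in
  ricci gt (E j) (E k) p = left_invariant_ricci c j k +
  (\sum_i hess i i - (n%:R - 2) * \sum_l dphi l * dphi l) * (j == k)%:R +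
  (n%:R - 2) * (hess j k + dphi j * dphi k).
Proof.
move=> dphi hess; apply: etrans (ricci_sum p (sE j) (sE k)) _.
apply: etrans (eq_bigr _ (fun i _ => coef_riemann i j k i p)) _.
apply: (@conformal_ricci R n c _ _ dphi (fun i j => D i (D j phi) p)
  (fun m i j k => D m (A i j k) p)).
- by move=> *; exact: struct_cst_anti.
- by move=> *; exact: struct_cst_jacobi.
- by move=> a b; exact: fderiv_comm.
- by move=> *; exact: fderiv_conformal_coef.
Qed.

End ConformalMetric.

Section LeftInvariantMetric.
Context {R : realType} {n : nat} {G : lieGroupType R n} (g : G -> 'M[R]_n)
  (e : 'I_n -> 'rV[R]_n).
Implicit Types (p q : G) (X Y Z : vfield G) (u : G -> R).

Local Notation E := (@frame R n G e).
Local Notation D := (@fderiv R n G e).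
Local Notation co := (coef g e).
Local Notation c := (struct_cst g e).

Hypothesis hg : left_invariant_metric g.
Hypothesis he : orthonormal_wrt (g 1%g) e.

(** With exponent 0 the results on conformal metrics specialize to [g] itself. *)
Lemma conformal_metric0 : conformal_metric g (fun=> 0) = g.
Proof.
by apply/funext => p; rewrite /conformal_metric /conformal_factor mulr0 expR0 scale1r.
Qed.

Lemma conformal_coef0 i j k p : conformal_coef g e (fun=> 0) i j k p = christoffel c i j k.
Proof.
rewrite conformal_coefE ![D _ _ _]vf_app_cst !mulr0 !addr0; exact: erefl.
Qed.

Lemma coef_gradient u k p : co (gradient g u) k p = D k u p.
Proof.
rewrite /coef /inner /gradient.
apply: (riesz_orthonormal (frame_orthonormal hg he p)) => a v w.
exact: linearP.
Qed.

Lemma gradient_smooth u : smooth_fun u -> smooth_vf (gradient g u).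
Proof.
move=> su; rewrite (frame_expand_fun hg he (gradient g u)).
apply: smooth_vf_sum => k; apply: smooth_vf_scale; last exact: frame_smooth.
have -> : co (gradient g u) k = D k u by apply/funext => p; exact: coef_gradient.
exact: fderiv_smooth.
Qed.

Lemma hessian_frame u j k p : smooth_fun u ->
  hessian g u (E j) (E k) p =
  frame_hessian c (fun i => D i u p) (fun i j => D i (D j u) p) j k.
Proof.
move=> su; rewrite /hessian -[levi_civita g]/(levi_civita g).
rewrite -[inner _ _ _ _]/(co (levi_civita g (E j) (gradient g u)) k p).
rewrite -{2}conformal_metric0.
rewrite (coef_levi_civita_framel hg he (smooth_fun_cst 0)); last exact: gradient_smooth.
have -> : co (gradient g u) k = D k u by apply/funext => q; exact: coef_gradient.
rewrite /frame_hessian -sumrN; congr (_ + _); apply: eq_bigr => l _.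
rewrite conformal_coef0 coef_gradient christoffel_skew; last first.
  by move=> *; exact: struct_cst_anti.
by rewrite mulrN mulrC.
Qed.

Lemma levi_civita_affine : affine_connection (levi_civita g).
Proof.
rewrite -conformal_metric0.
by case: (levi_civita_conformal hg he (smooth_fun_cst (M := G) 0)).
Qed.

Lemma laplacian_frame u p : smooth_fun u ->
  laplacian g u p = \sum_i hessian g u (E i) (E i) p.
Proof.
move=> su; apply: (trend_tensor hg he (T := fun X => levi_civita g X (gradient g u) p)).
move=> v X X' sv sX sX'; case: levi_civita_affine => _ lin _ _.
by rewrite lin //; exact: gradient_smooth.
Qed.

Lemma vnorm_gradient u p : vnorm g (gradient g u) p ^+ 2 = \sum_l D l u p * D l u p.
Proof.
have -> : \sum_l D l u p * D l u p = inner g (gradient g u) (gradient g u) p.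
  by rewrite (inner_coef hg he); apply: eq_bigr => l _; rewrite coef_gradient.
rewrite sqr_sqrtr // (inner_coef hg he); apply: sumr_ge0 => l _.
by rewrite -expr2 sqr_ge0.
Qed.

End LeftInvariantMetric.

(** * Traces over the Lie algebra *)

Section LieAlgebraTraces.
Context {R : realType} {n : nat} {G : lieGroupType R n} (g : G -> 'M[R]_n)
  (e : 'I_n -> 'rV[R]_n).
Implicit Types (p : G) (u v w y z : 'rV[R]_n).

Local Notation B := (g 1%g).
Local Notation c := (struct_cst g e).
Local Notation "[ u , v ]L" := (lbr G u v) (at level 0, format "[ u ,  v ]L").

Hypothesis hg : left_invariant_metric g.
Hypothesis he : orthonormal_wrt B e.

Lemma linear_expand (F : 'rV[R]_n -> R) v : linear_for *%R F ->
  F v = \sum_k mxform B v (e k) * F (e k).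
Proof.
move=> lF; pose L : {linear 'rV[R]_n -> R^o} :=
  HB.pack F (GRing.isLinear.Build R 'rV[R]_n R^o *:%R F lF).
rewrite {1}(orthonormal_expand he v) -[F]/(L : 'rV[R]_n -> R^o) linear_sum.
by apply: eq_bigr => k _; rewrite linearZ.
Qed.

Lemma left_vf_lin (a : R) u v p :
  left_vf (a *: u + v) p = a *: left_vf u p + left_vf v p.
Proof. by rewrite /left_vf /tangent_map linearP. Qed.

Lemma lbr_linr (a : R) u v w : [w, a *: u + v]L = a *: [w, u]L + [w, v]L.
Proof.
have E : left_vf (a *: u + v) = (fun p : G => a *: left_vf u p + left_vf v p) :> vfield G.
  by apply/funext => p; exact: left_vf_lin.
rewrite {1}/lbr E (lie_bracket_linr _ _ (smooth_fun_cst a)); [|exact: left_vf_smooth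
  |exact: left_vf_smooth].
by rewrite vf_app_cst scale0r add0r.
Qed.

Lemma lbr_linl (a : R) u v w : [a *: u + v, w]L = a *: [u, w]L + [v, w]L.
Proof.
apply: etrans (lbr_anti (G := G) _ _) _; apply: etrans (congr1 -%R (lbr_linr _ _ _ _)) _.
rewrite opprD -scalerN; exact: (congr2 (fun s t => a *: s + t)
  (esym (lbr_anti (G := G) u w)) (esym (lbr_anti (G := G) v w))).
Qed.

Lemma mxform_lbr_linr (a : R) u v w y :
  mxform B [w, a *: u + v]L y = a * mxform B [w, u]L y + mxform B [w, v]L y.
Proof. by rewrite (lbr_linr a u v w); exact: mxform_linl. Qed.

Lemma mxform_lbr_linl (a : R) u v w y :
  mxform B [a *: u + v, w]L y = a * mxform B [u, w]L y + mxform B [v, w]L y.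
Proof. by rewrite (lbr_linl a u v w); exact: mxform_linl. Qed.

Lemma mxformr_lbr_linr (a : R) u v w y :
  mxform B y [w, a *: u + v]L = a * mxform B y [w, u]L + mxform B y [w, v]L.
Proof. by rewrite (lbr_linr a u v w); exact: mxform_linr. Qed.

Lemma mxformr_lbr_linl (a : R) u v w y :
  mxform B y [a *: u + v, w]L = a * mxform B y [u, w]L + mxform B y [v, w]L.
Proof. by rewrite (lbr_linl a u v w); exact: mxform_linr. Qed.

Lemma lbr_expandr u v k :
  mxform B [u, v]L (e k) = \sum_l mxform B v (e l) * mxform B [u, e l]L (e k).
Proof.
apply: (linear_expand (F := fun v => mxform B [u, v]L (e k))) => a x y.
exact: mxform_lbr_linr.
Qed.

Lemma lie_bracket_left_fun u v :
  lie_bracket (left_vf u : vfield G) (left_vf v) = left_vf [u, v]L.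
Proof. by apply/funext => p; exact: lie_bracket_left_vf. Qed.

Lemma trLie_ad_ad y z : trLie (ad (left_vf y : vfield G) \o ad (left_vf z)) =
  \sum_i \sum_l mxform B [y, e i]L (e l) * mxform B [z, e l]L (e i).
Proof.
rewrite /trLie.
have -> : (fun v => (ad (left_vf y : vfield G) \o ad (left_vf z)) (left_vf v) 1%g) =
    fun v => [y, [z, v]L]L.
  by apply/funext => v; rewrite /= /ad !lie_bracket_left_fun; exact: left_vf1.
rewrite (trend_orthonormal he); last by move=> a u v; rewrite !lbr_linr.
rewrite exchange_big; apply: eq_bigr => i _ /=; rewrite lbr_expandr.
by apply: eq_bigr => l _; rewrite mulrC.
Qed.

Lemma inner_left_vf1 u v : inner g (left_vf u : vfield G) (left_vf v) 1%g = mxform B u v.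
Proof. by rewrite /inner !left_vf1. Qed.

(** The vector at the unit representing the adjoint of [ad z] applied to [v]. *)
Definition adj_vec z v : 'rV[R]_n := riesz B (fun w => mxform B v [z, w]L).

Lemma ad_adj_left_vf z v :
  ad_adj g (left_vf z) (left_vf v) = left_vf (adj_vec z v) :> vfield G.
Proof.
rewrite /ad_adj; congr (left_vf (riesz _ _)); apply/funext => w.
by rewrite /ad lie_bracket_left_fun inner_left_vf1.
Qed.

Lemma mxform_adj_vec z v k : mxform B (adj_vec z v) (e k) = mxform B v [z, e k]L.
Proof.
apply: (riesz_orthonormal he) => a u w.
exact: mxformr_lbr_linr.
Qed.

Lemma adj_vec_linr z (a : R) u v : adj_vec z (a *: u + v) = a *: adj_vec z u + adj_vec z v.
Proof.
apply: (orthonormal_inj he) => k; apply: etrans (mxform_adj_vec z _ k) _.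
apply: etrans _ (esym (mxform_linl B a (adj_vec z u) (adj_vec z v) (e k))).
apply: etrans _ (esym (congr2 (fun s t => a * s + t) (mxform_adj_vec z u k)
  (mxform_adj_vec z v k))).
exact: mxform_linl.
Qed.

Lemma adj_vec_linl v (a : R) y z : adj_vec (a *: y + z) v = a *: adj_vec y v + adj_vec z v.
Proof.
apply: (orthonormal_inj he) => k; apply: etrans (mxform_adj_vec _ v k) _.
apply: etrans _ (esym (mxform_linl B a (adj_vec y v) (adj_vec z v) (e k))).
apply: etrans _ (esym (congr2 (fun s t => a * s + t) (mxform_adj_vec y v k)
  (mxform_adj_vec z v k))).
exact: mxformr_lbr_linl.
Qed.

Let BT : B^T = B. Proof. by case: hg => -[s _ _] _; exact: s. Qed.

Lemma trLie_ad_adj y z : trLie (ad (left_vf y : vfield G) \o ad_adj g (left_vf z)) =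
  \sum_i \sum_l mxform B [y, e i]L (e l) * mxform B [z, e i]L (e l).
Proof.
rewrite /trLie.
have -> : (fun v => (ad (left_vf y : vfield G) \o ad_adj g (left_vf z)) (left_vf v) 1%g) =
    fun v => [y, adj_vec z v]L.
  by apply/funext => v; rewrite /= ad_adj_left_vf /ad lie_bracket_left_fun; exact: left_vf1.
rewrite (trend_orthonormal he); last by move=> a u v; rewrite adj_vec_linr lbr_linr.
rewrite exchange_big; apply: eq_bigr => i _ /=; rewrite lbr_expandr.
apply: eq_bigr => l _; rewrite mxform_adj_vec mulrC; congr (_ * _).
exact: mxform_sym.
Qed.

(** The sign comes from the skew-symmetry of the endomorphisms [Jend g X]. *)
Lemma trLie_Jend y z : trLie (Jend g (left_vf y : vfield G) \o Jend g (left_vf z)) =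
  - \sum_i \sum_l mxform B [e i, e l]L y * mxform B [e i, e l]L z.
Proof.
rewrite /trLie.
have -> : (fun v => (Jend g (left_vf y : vfield G) \o Jend g (left_vf z)) (left_vf v) 1%g) =
    fun v => adj_vec (adj_vec v z) y.
  by apply/funext => v; rewrite /= /Jend !ad_adj_left_vf; exact: left_vf1.
rewrite (trend_orthonormal he); last by move=> a u v; rewrite !adj_vec_linl.
rewrite -sumrN; apply: eq_bigr => i _; rewrite mxform_adj_vec.
have E := linear_expand (F := fun v => mxform B y [v, e i]L) (adj_vec (e i) z).
rewrite E; last first.
  move=> a u v.
  exact: mxformr_lbr_linl.
rewrite -sumrN; apply: eq_bigr => l _; rewrite mxform_adj_vec.
have A : mxform B y [e l, e i]L = - mxform B [e i, e l]L y.
  rewrite (mxform_sym y) // -[RHS]mulN1r -[RHS]addr0 -(mxform0l B y) -mxform_linl.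
  by rewrite addr0 scaleN1r; congr (mxform B _ y); exact: lbr_anti.
by rewrite A (mxform_sym z) // mulrN mulrC.
Qed.

Lemma mean_curvature_inner y z p :
  inner g (ad (mean_curvature_vector g) (left_vf y)) (left_vf z) p =
  \sum_l modular c l * mxform B [e l, y]L z.
Proof.
rewrite /ad /mean_curvature_vector lie_bracket_left_fun /inner (mxform_left_vf hg).
set h := riesz _ _.
have adE v : trLie (ad (left_vf v : vfield G)) = \sum_m mxform B [v, e m]L (e m).
  rewrite /trLie.
  have -> : (fun w => ad (left_vf v : vfield G) (left_vf w) 1%g) = fun w => [v, w]L.
    by apply/funext => w; rewrite /ad lie_bracket_left_fun; exact: left_vf1.
  by rewrite (trend_orthonormal he) // => a u w; exact: lbr_linr.
have lin : linear_for *%R (fun v => mxform B [v, y]L z).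
  by move=> a u v; exact: mxform_lbr_linl.
apply: etrans (linear_expand h lin) _; apply: eq_bigr => l _; congr (_ * _).
have lin2 : linear_for *%R (fun v => trLie (ad (left_vf v : vfield G))).
  move=> a u v; apply: etrans (adE _) _.
  apply: etrans _ (esym (congr2 (fun s t => a * s + t) (adE u) (adE v))).
  rewrite mulr_sumr -big_split; apply: eq_bigr => m _.
  exact: mxform_lbr_linl.
exact: etrans (riesz_orthonormal he (e l) lin2) (adE _).
Qed.

(** The same form as [left_invariant_ricci], on arbitrary vectors of the Lie
   algebra. *)
Definition lie_ricci y z : R :=
  - (1 / 2) * (\sum_i \sum_l mxform B [y, e i]L (e l) * mxform B [z, e l]L (e i)
    + \sum_i \sum_l mxform B [y, e i]L (e l) * mxform B [z, e i]L (e l)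
    + \sum_l modular c l * mxform B [e l, y]L z
    + \sum_l modular c l * mxform B [e l, z]L y)
  + 1 / 4 * \sum_i \sum_l mxform B [e i, e l]L y * mxform B [e i, e l]L z.

Lemma lie_ricci_sym y z : lie_ricci y z = lie_ricci z y.
Proof.
rewrite /lie_ricci.
have sumC (a b : 'I_n -> 'I_n -> R) :
    \sum_i \sum_l a i l * b i l = \sum_i \sum_l b i l * a i l.
  by apply: eq_bigr => i _; apply: eq_bigr => l _; exact: mulrC.
have sumCT (a b : 'I_n -> 'I_n -> R) :
    \sum_i \sum_l a i l * b l i = \sum_i \sum_l b i l * a l i.
  by rewrite exchange_big; apply: eq_bigr => i _; apply: eq_bigr => l _; exact: mulrC.
have E1 := sumCT (fun i l => mxform B [y, e i]L (e l)) (fun i l => mxform B [z, e i]L (e l)).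
have E2 := sumC (fun i l => mxform B [y, e i]L (e l)) (fun i l => mxform B [z, e i]L (e l)).
have E3 := sumC (fun i l => mxform B [e i, e l]L y) (fun i l => mxform B [e i, e l]L z).
apply: etrans (congr2 (fun s t => - (1 / 2) * (s + _ + _) + 1 / 4 * t)
  (congr2 +%R E1 E2) E3) _.
have alg (a b s t d : R) : - (1 / 2) * (a + b + s + t) + 1 / 4 * d =
  - (1 / 2) * (a + b + t + s) + 1 / 4 * d by ring.
exact: alg.
Qed.

Lemma lie_ricci_linl z : linear_for *%R (lie_ricci ^~ z).
Proof.
move=> a y y'; rewrite /lie_ricci.
have sum1 (F F1 F2 : 'I_n -> R) : (forall i, F i = a * F1 i + F2 i) ->
    \sum_i F i = a * \sum_i F1 i + \sum_i F2 i.
  by move=> FE; rewrite mulr_sumr -big_split; apply: eq_bigr => i _.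
have br w k := mxform_lbr_linl a y y' w k.
have br' w k := mxform_lbr_linr a y y' w k.
have dist (a1 a2 b : R) : (a * a1 + a2) * b = a * (a1 * b) + a2 * b by ring.
have dist' (a1 a2 b : R) : b * (a * a1 + a2) = a * (b * a1) + b * a2 by ring.
have E1 := sum1 _ _ _ (fun i => sum1 _ _ _ (fun l =>
  etrans (congr1 ( *%R^~ (mxform B [z, e l]L (e i))) (br (e i) (e l))) (dist _ _ _))).
have E2 := sum1 _ _ _ (fun i => sum1 _ _ _ (fun l =>
  etrans (congr1 ( *%R^~ (mxform B [z, e i]L (e l))) (br (e i) (e l))) (dist _ _ _))).
have E3 := sum1 _ _ _ (fun l =>
  etrans (congr1 ( *%R (modular c l)) (br' (e l) z)) (dist' _ _ _)).
have E4 := sum1 _ _ _ (fun l =>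
  etrans (congr1 ( *%R (modular c l)) (mxform_linr B a y y' [e l, z]L)) (dist' _ _ _)).
have E5 := sum1 _ _ _ (fun i => sum1 _ _ _ (fun l =>
  etrans (congr1 ( *%R^~ (mxform B [e i, e l]L z)) (mxform_linr B a y y' [e i, e l]L))
    (dist _ _ _))).
apply: etrans (congr2 (fun s t => - (1 / 2) * s + 1 / 4 * t)
  (congr2 +%R (congr2 +%R (congr2 +%R E1 E2) E3) E4) E5) _.
have alg (a1 a2 a3 a4 a5 b1 b2 b3 b4 b5 : R) :
  - (1 / 2) * (a * a1 + b1 + (a * a2 + b2) + (a * a3 + b3) + (a * a4 + b4))
    + 1 / 4 * (a * a5 + b5) =
  a * (- (1 / 2) * (a1 + a2 + a3 + a4) + 1 / 4 * a5) +
    (- (1 / 2) * (b1 + b2 + b3 + b4) + 1 / 4 * b5) by ring.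
exact: alg.
Qed.

(** Bilinearity reduces [lie_ricci] to the frame, where it is
   [left_invariant_ricci] by definition. *)
Lemma lie_ricci_frame y z : lie_ricci y z =
  \sum_j \sum_k mxform B y (e j) * mxform B z (e k) * left_invariant_ricci c j k.
Proof.
rewrite (linear_expand _ (lie_ricci_linl z)); apply: eq_bigr => j _.
have linr : linear_for *%R (lie_ricci (e j)).
  by move=> a u v; rewrite !(lie_ricci_sym (e j)); exact: lie_ricci_linl.
rewrite (linear_expand z linr) mulr_sumr; apply: eq_bigr => k _.
exact: mulrA.
Qed.

Lemma lie_ricciE y z p :
  - (1 / 2) * (trLie (ad (left_vf y : vfield G) \o ad (left_vf z))
    + trLie (ad (left_vf y : vfield G) \o ad_adj g (left_vf z))
    + inner g (ad (mean_curvature_vector g) (left_vf y)) (left_vf z) p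
    + inner g (ad (mean_curvature_vector g) (left_vf z)) (left_vf y) p)
  - 1 / 4 * trLie (Jend g (left_vf y : vfield G) \o Jend g (left_vf z)) =
  lie_ricci y z.
Proof.
apply: etrans (congr2 (fun s t => - (1 / 2) * s - 1 / 4 * t)
  (congr2 +%R (congr2 +%R (congr2 +%R (trLie_ad_ad y z) (trLie_ad_adj y z))
    (mean_curvature_inner y z p)) (mean_curvature_inner z y p)) (trLie_Jend y z)) _.
by rewrite mulrN opprK.
Qed.

End LieAlgebraTraces.

(** * The soliton equation *)

Section LieDerivative.
Context {R : realType} {n : nat} {M : manifoldType R n} (g : M -> 'M[R]_n).
Implicit Types (X Y Z : vfield M) (u : M -> R).

Hypothesis inner_sm : forall Y Z, smooth_vf Y -> smooth_vf Z -> smooth_fun (inner g Y Z).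
Hypothesis g_sym : forall p, (g p)^T = g p.

Lemma inner_sym Y Z p : inner g Y Z p = inner g Z Y p.
Proof. exact: mxform_sym. Qed.

Lemma lie_derivative_sym X Y Z p :
  lie_derivative X g Y Z p = lie_derivative X g Z Y p.
Proof.
rewrite /lie_derivative.
have -> : inner g Y Z = inner g Z Y by apply/funext => q; exact: inner_sym.
have E1 := inner_sym (lie_bracket X Y) Z p.
have E2 := inner_sym Y (lie_bracket X Z) p.
apply: etrans (congr2 (fun s t => _ - s - t) E1 E2) _.
by rewrite addrAC.
Qed.

(** The derivative of [u] comes once from the inner product and once from the
   bracket, with opposite signs. *)
Lemma lie_derivative_linl X u Y Y' Z p : smooth_vf X -> smooth_fun u ->
  smooth_vf Y -> smooth_vf Y' -> smooth_vf Z ->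
  lie_derivative X g (fun q => u q *: Y q + Y' q) Z p =
  u p * lie_derivative X g Y Z p + lie_derivative X g Y' Z p.
Proof.
move=> sX su sY sY' sZ; rewrite /lie_derivative.
have -> : inner g (fun q => u q *: Y q + Y' q) Z =
    fun q => u q * inner g Y Z q + inner g Y' Z q.
  by apply/funext => q; exact: mxform_linl.
have sYZ := inner_sm sY sZ; have sYZ' := inner_sm sY' sZ.
have E1 := vf_app_add X p (smooth_fun_mul su sYZ) sYZ'.
have E2 := vf_app_mul X p su sYZ.
have E3 : inner g (lie_bracket X (fun q => u q *: Y q + Y' q)) Z p =
    vf_app X u p * inner g Y Z p +
    (u p * inner g (lie_bracket X Y) Z p + inner g (lie_bracket X Y') Z p).
  rewrite {1}/inner (lie_bracket_linr X p su sY sY') -addrA mxform_linl.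
  by congr (_ + _); exact: mxform_linl.
have E4 : inner g (fun q => u q *: Y q + Y' q) (lie_bracket X Z) p =
    u p * inner g Y (lie_bracket X Z) p + inner g Y' (lie_bracket X Z) p.
  exact: mxform_linl.
apply: etrans (congr2 (fun s t => s - t) (congr2 (fun s t => s - t)
  (etrans E1 (congr1 (fun s => s + _) E2)) E3) E4) _.
have alg (a b d k x y z b' d' : R) :
  x * a + k * y + z - (x * a + (k * b + b')) - (k * d + d') =
  k * (y - b - d) + (z - b' - d') by ring.
exact: alg.
Qed.

End LieDerivative.

Section SolitonEquation.
Context {R : realType} {n : nat} {G : lieGroupType R n} (g : G -> 'M[R]_n)
  (e : 'I_n -> 'rV[R]_n) (phi : G -> R).
Implicit Types (p q : G) (X Y Z : vfield G) (u : G -> R).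

Local Notation E := (@frame R n G e).
Local Notation D := (@fderiv R n G e).
Local Notation co := (coef g e).
Local Notation c := (struct_cst g e).
Local Notation f := (conformal_factor phi).
Local Notation gt := (conformal_metric g phi).

Hypothesis hg : left_invariant_metric g.
Hypothesis he : orthonormal_wrt (g 1%g) e.
Hypothesis hphi : smooth_fun phi.

Lemma tensor2_frame p (T : vfield G -> vfield G -> R) Y Z :
  (forall Z, smooth_vf Z -> tensorial_at p (fun Y => T Y Z : R^o)) ->
  (forall Y, smooth_vf Y -> tensorial_at p (fun Z => T Y Z : R^o)) ->
  smooth_vf Y -> smooth_vf Z ->
  T Y Z = \sum_j \sum_k co Y j p * co Z k p * T (E j) (E k).
Proof.
move=> tl tr sY sZ; apply: etrans (tensor_frame hg he (tl Z sZ) sY) _.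
apply: eq_bigr => j _.
have -> := tensor_frame hg he (tr (E j) (frame_smooth e j)) sZ.
by rewrite scaler_sumr; apply: eq_bigr => k _; rewrite scalerA.
Qed.

Lemma metric_sym p : (g p)^T = g p.
Proof. by case: hg => -[s _ _] _; exact: s. Qed.

Lemma hessian_tensorl u Z p : smooth_fun u ->
  tensorial_at p (fun Y => hessian g u Y Z p : R^o).
Proof.
move=> su v Y Y' sv sY sY'; case: (levi_civita_affine hg he) => _ lin _ _.
have E := lin v Y Y' _ sv sY sY' (gradient_smooth hg he su).
rewrite /hessian E; exact: mxform_linl.
Qed.

Lemma hessian_tensorr u Y p : tensorial_at p (fun Z => hessian g u Y Z p : R^o).
Proof. by move=> v Z Z' _ _ _; exact: mxform_linr. Qed.

Lemma lie_derivative_conformal X Y Z p :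
  smooth_vf X -> smooth_vf Y -> smooth_vf Z ->
  lie_derivative X gt Y Z p =
  vf_app X f p * inner g Y Z p + f p * lie_derivative X g Y Z p.
Proof.
move=> sX sY sZ; rewrite /lie_derivative.
have -> : inner gt Y Z = fun q => f q * inner g Y Z q.
  by apply/funext => q; exact: inner_conformal.
have sf : smooth_fun f by exact: conformal_factor_smooth.
have E1 := vf_app_mul X p sf (inner_smooth hg.1 sY sZ).
apply: etrans (congr2 (fun s t => s - t) (congr2 (fun s t => s - t) E1
  (inner_conformal g phi (lie_bracket X Y) Z p))
  (inner_conformal g phi Y (lie_bracket X Z) p)) _.
have alg (a k x y d : R) : a + k * x - k * y - k * d = a + k * (x - y - d) by ring.
exact: alg.
Qed.

Lemma coef_left_vf v j p : co (left_vf v) j p = mxform (g 1%g) v (e j).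
Proof. exact: mxform_left_vf. Qed.

(** Two derivatives of [exp phi] produce the Hessian of [phi] and the square of
   its differential; this is how [psi] absorbs both terms of the conformal change. *)
Lemma hessian_exp_frame j k p :
  hessian g (fun q => expR (phi q)) (E j) (E k) p = expR (phi p) *
  (frame_hessian c (fun i => D i phi p) (fun i j => D i (D j phi) p) j k
   + D j phi p * D k phi p).
Proof.
have D1 i : D i (fun q => expR (phi q)) = fun q => expR (phi q) * D i phi q.
  by apply/funext => q; exact: vf_app_expR.
rewrite (hessian_frame hg he _ _ _ (smooth_fun_expR hphi)) /frame_hessian !D1.
have D2 : D j (fun q => expR (phi q) * D k phi q) p =
    expR (phi p) * D j phi p * D k phi p + expR (phi p) * D j (D k phi) p.
  have M := vf_app_mul (E j) p (smooth_fun_expR hphi) (fderiv_smooth e k hphi).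
  by apply: etrans M _; congr (_ * _ + _); exact: vf_app_expR.
have S : \sum_l christoffel c j k l * D l (fun q => expR (phi q)) p =
    expR (phi p) * \sum_l christoffel c j k l * D l phi p.
  rewrite mulr_sumr; apply: eq_bigr => l _; rewrite D1; exact: mulrCA.
apply: etrans (congr2 (fun s t => s - t) D2 S) _.
have alg (x a b d s : R) : x * a * b + x * d - x * s = x * (d - s + a * b) by ring.
exact: alg.
Qed.

(** Both sides are bilinear, so the formula is checked on the frame; there it is
   [conformal_ricci]. *)
Lemma ricci_conformal_left y z p :
  let Y : vfield G := left_vf y in let Z : vfield G := left_vf z in
  ricci gt Y Z p = lie_ricci g e y z
  + (laplacian g phi p - (n%:R - 2) * vnorm g (gradient g phi) p ^+ 2) * inner g Y Z p
  + (n%:R - 2) / expR (phi p) * hessian g (fun q => expR (phi q)) Y Z p.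
Proof.
move=> Y Z; have sY : smooth_vf Y by exact: left_vf_smooth.
have sZ : smooth_vf Z by exact: left_vf_smooth.
have Ric := @tensor2_frame p (fun Y Z => ricci gt Y Z p) Y Z
  (fun V sV => @ricci_tensorl R n G g e phi hg he hphi V p sV)
  (fun V sV => @ricci_tensorr R n G g e phi hg he hphi V p sV) sY sZ.
have Hess := @tensor2_frame p (fun Y Z => hessian g (fun q => expR (phi q)) Y Z p) Y Z
  (fun V _ => @hessian_tensorl _ V p (smooth_fun_expR hphi))
  (fun V _ => @hessian_tensorr (fun q => expR (phi q)) V p) sY sZ.
have IE : inner g Y Z p = \sum_j \sum_k co Y j p * co Z k p * (j == k)%:R.
  rewrite (inner_coef hg he); apply: eq_bigr => j _.
  under [RHS]eq_bigr do rewrite eq_sym.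
  by rewrite (sum_delta (fun k => co Y j p * co Z k p)).
have LR : lie_ricci g e y z =
    \sum_j \sum_k co Y j p * co Z k p * left_invariant_ricci c j k.
  apply: etrans (lie_ricci_frame he y z) _; apply: eq_bigr => j _; apply: eq_bigr => k _.
  by rewrite !coef_left_vf.
set K := laplacian g phi p - _.
apply: etrans Ric _; apply: esym.
apply: etrans (congr2 +%R (congr2 +%R LR (congr1 ( *%R K) IE))
  (congr1 ( *%R ((n%:R - 2) / expR (phi p))) Hess)) _.
rewrite !mulr_sumr -!big_split; apply: eq_bigr => j _.
rewrite !mulr_sumr -!big_split; apply: eq_bigr => k _.
rewrite (ricci_conformal_frame hg he hphi j k p) hessian_exp_frame.
have KE : K = \sum_i frame_hessian c (fun i => D i phi p)
    (fun i j => D i (D j phi) p) i i - (n%:R - 2) * \sum_l D l phi p * D l phi p.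
  rewrite /K (laplacian_frame hg he) // (vnorm_gradient hg he); congr (_ - _).
  by apply: eq_bigr => i _; exact: hessian_frame.
rewrite /= -KE; have x0 : expR (phi p) != 0 by rewrite gt_eqF // expR_gt0.
have alg (a b r d h m x : R) : x != 0 ->
    a * b * r + K * (a * b * d) + m / x * (a * b * (x * h)) =
    a * b * (r + K * d + m * h).
  by move=> x0'; field.
exact: alg.
Qed.

(** The soliton equation for [f g] is the vanishing of this tensor. *)
Definition soliton_defect X (lambda : R) Y Z p : R :=
  lie_derivative X gt Y Z p - 2 * (lambda * inner gt Y Z p - ricci gt Y Z p).

Let inner_sm Y Z : smooth_vf Y -> smooth_vf Z -> smooth_fun (inner gt Y Z).
Proof.
move=> sY sZ; have -> : inner gt Y Z = fun q => f q * inner g Y Z q.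
  by apply/funext => q; exact: inner_conformal.
apply: smooth_fun_mul; first exact: conformal_factor_smooth.
exact: inner_smooth hg.1 sY sZ.
Qed.

Let gt_sym p : (gt p)^T = gt p.
Proof. by rewrite /conformal_metric linearZ /= metric_sym. Qed.

Lemma soliton_defect_tensorl X lambda Z p : smooth_vf X -> smooth_vf Z ->
  tensorial_at p (fun Y => soliton_defect X lambda Y Z p : R^o).
Proof.
move=> sX sZ u Y Y' su sY sY'.
have E1 := lie_derivative_linl inner_sm p sX su sY sY' sZ.
have E2 : inner gt (fun q => u q *: Y q + Y' q) Z p = u p * inner gt Y Z p + inner gt Y' Z p.
  exact: mxform_linl.
have E3 := @ricci_tensorl R n G g e phi hg he hphi Z p sZ u Y Y' su sY sY'.
apply: etrans (congr2 (fun s t => s - 2 * t) E1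
  (congr2 (fun s t => lambda * s - t) E2 E3)) _.
have alg (k a a' i i' r r' : R) : k * a + a' - 2 * (lambda * (k * i + i') - (k * r + r')) =
    k * (a - 2 * (lambda * i - r)) + (a' - 2 * (lambda * i' - r')) by ring.
exact: alg.
Qed.

Lemma soliton_defect_tensorr X lambda Y p : smooth_vf X -> smooth_vf Y ->
  tensorial_at p (fun Z => soliton_defect X lambda Y Z p : R^o).
Proof.
move=> sX sY u Z Z' su sZ sZ'.
have E1 : lie_derivative X gt Y (fun q => u q *: Z q + Z' q) p =
    u p * lie_derivative X gt Y Z p + lie_derivative X gt Y Z' p.
  apply: etrans (lie_derivative_sym gt_sym _ _ _ _) _.
  apply: etrans (lie_derivative_linl inner_sm p sX su sZ sZ' sY) _.
  exact: (congr2 (fun s t => u p * s + t) (lie_derivative_sym gt_sym _ _ _ _)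
    (lie_derivative_sym gt_sym _ _ _ _)).
have E2 : inner gt Y (fun q => u q *: Z q + Z' q) p = u p * inner gt Y Z p + inner gt Y Z' p.
  exact: mxform_linr.
have E3 := @ricci_tensorr R n G g e phi hg he hphi Y p sY u Z Z' su sZ sZ'.
apply: etrans (congr2 (fun s t => s - 2 * t) E1
  (congr2 (fun s t => lambda * s - t) E2 E3)) _.
have alg (k a a' i i' r r' : R) : k * a + a' - 2 * (lambda * (k * i + i') - (k * r + r')) =
    k * (a - 2 * (lambda * i - r)) + (a' - 2 * (lambda * i' - r')) by ring.
exact: alg.
Qed.

(** The defect is tensorial in both arguments. *)
Lemma soliton_defect_frame X lambda Y Z p :
  smooth_vf X -> smooth_vf Y -> smooth_vf Z ->
  (forall j k, soliton_defect X lambda (E j) (E k) p = 0) ->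
  soliton_defect X lambda Y Z p = 0.
Proof.
move=> sX sY sZ d0; rewrite (@tensor2_frame p (fun Y Z => soliton_defect X lambda Y Z p) Y Z
  (fun V sV => soliton_defect_tensorl lambda p sX sV)
  (fun V sV => soliton_defect_tensorr lambda p sX sV) sY sZ).
by apply: big1 => j _; apply: big1 => k _; rewrite d0 mulr0.
Qed.

Lemma soliton_defect_left X lambda y z p : smooth_vf X ->
  let Y : vfield G := left_vf y in let Z : vfield G := left_vf z in
  let H : vfield G := mean_curvature_vector g in
  - (1 / 2) * (trLie (ad Y \o ad Z) + trLie (ad Y \o ad_adj g Z)
               + inner g (ad H Y) Z p + inner g (ad H Z) Y p)
  - 1 / 4 * trLie (Jend g Y \o Jend g Z)
  + (laplacian g phi p - (n%:R - 2) * vnorm g (gradient g phi) p ^+ 2) * inner g Y Z p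
  + (n%:R - 2) / expR (phi p) * hessian g (fun q => expR (phi q)) Y Z p
  - lambda * f p * inner g Y Z p
  + 1 / 2 * vf_app X f p * inner g Y Z p
  + 1 / 2 * f p * lie_derivative X g Y Z p = 1 / 2 * soliton_defect X lambda Y Z p.
Proof.
move=> sX Y Z H; have sY : smooth_vf Y by exact: left_vf_smooth.
have sZ : smooth_vf Z by exact: left_vf_smooth.
have D : soliton_defect X lambda Y Z p = vf_app X f p * inner g Y Z p
    + f p * lie_derivative X g Y Z p
    - 2 * (lambda * (f p * inner g Y Z p) - (lie_ricci g e y z
  + (laplacian g phi p - (n%:R - 2) * vnorm g (gradient g phi) p ^+ 2) * inner g Y Z p
  + (n%:R - 2) / expR (phi p) * hessian g (fun q => expR (phi q)) Y Z p)).
  exact: (congr2 (fun s t => s - 2 * t) (lie_derivative_conformal p sX sY sZ)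
    (congr2 (fun s t => lambda * s - t) (inner_conformal g phi Y Z p)
      (ricci_conformal_left y z p))).
apply: etrans _ (esym (congr1 ( *%R (1 / 2)) D)).
apply: etrans (congr1 (fun t => t + _ + _ - _ + _ + _) (lie_ricciE hg he y z p)) _.
have alg (r s t i l xf fp : R) : r + s + t - lambda * fp * i + 1 / 2 * xf * i
    + 1 / 2 * fp * l = 1 / 2 * (xf * i + fp * l - 2 * (lambda * (fp * i) - (r + s + t))).
  by field.
exact: alg.
Qed.

End SolitonEquation.

Theorem proposition2p8 (R : realType) (n : nat) (G : lieGroupType R n)
    (g : G -> 'M[R]_n) (phi : G -> R)
    (hg : left_invariant_metric g)
    (hphi : smooth_fun phi) (hphi1 : phi 1%g = 0) :
  let f : G -> R := fun p => expR (- 2 * phi p) in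
  let psi : G -> R := fun p => expR (phi p) in
  let gt : G -> 'M[R]_n := fun p => f p *: g p in
  let H : vfield G := mean_curvature_vector g in
  ricci_soliton gt <->
  exists (X : vfield G) (lambda : R), smooth_vf X /\
    forall Y Z : vfield G, left_invariant_vf Y -> left_invariant_vf Z ->
    forall p : G,
      - (1 / 2) * (trLie (ad Y \o ad Z) + trLie (ad Y \o ad_adj g Z)
                   + inner g (ad H Y) Z p + inner g (ad H Z) Y p)
      - 1 / 4 * trLie (Jend g Y \o Jend g Z)
      + (laplacian g phi p - (n%:R - 2) * vnorm g (gradient g phi) p ^+ 2)
          * inner g Y Z p
      + (n%:R - 2) / psi p * hessian g psi Y Z p
      - lambda * f p * inner g Y Z p
      + 1 / 2 * vf_app X f p * inner g Y Z p
      + 1 / 2 * f p * lie_derivative X g Y Z p = 0.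
Proof.
move=> f psi gt H.
have [e he] : exists e, orthonormal_wrt (g 1%g) e.
  by case: hg => -[gT gpos _] _; exact: orthonormal_exists (gT _) (gpos _).
split=> -[X [lambda [sX sol]]]; exists X, lambda; split=> //.
  move=> Y Z lY lZ p.
  have sY := lY.1; have sZ := lZ.1; have S := sol Y Z sY sZ p.
  rewrite (left_invariant_vfE lY) (left_invariant_vfE lZ).
  apply: etrans (soliton_defect_left hg he hphi lambda _ _ p sX) _.
  have D : soliton_defect g phi X lambda (left_vf (Y 1%g)) (left_vf (Z 1%g)) p = 0.
    rewrite -(left_invariant_vfE lY) -(left_invariant_vfE lZ).
    by apply/eqP; rewrite subr_eq0; apply/eqP.
  by apply: etrans (congr1 ( *%R (1 / 2)) D) _; rewrite mulr0.
move=> Y Z sY sZ p; apply/eqP; rewrite -subr_eq0; apply/eqP.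
change (soliton_defect g phi X lambda Y Z p = 0).
apply: (@soliton_defect_frame R n G g e phi hg he hphi X lambda Y Z p sX sY sZ) => j k.
have S := sol (left_vf (e j)) (left_vf (e k)) (left_vf_linv _) (left_vf_linv _) p.
have D := etrans (esym (soliton_defect_left hg he hphi lambda (e j) (e k) p sX)) S.
have h0 : 1 / 2 != 0 :> R by rewrite mul1r invr_neq0 // pnatr_eq0.
by apply: (mulfI h0); apply: etrans D _; rewrite mulr0.
Qed.
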